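(* Let $\nu\in(0,2)$ and $\ell\in\{1,2\}$. Let $X$ be a stationary, isotropic Gaussian random field on $\mathbb R^2$ with covariance function $K(\mathbf x,\mathbf y)=\tilde K(\mathbf x-\mathbf y)$ of the form described in the context, with smoothness parameter $\nu$. Let $\Omega\subset\mathbb R^2$ be an open set containing $[0,1]^2$ and let $\tilde\varphi=(\varphi_1,\varphi_2):\Omega\to\mathbb R^2$ be a $C^2(\Omega)$ diffeomorphism (as defined in the context). Suppose that the function $\mathcal J_{\nu,\ell}(\cdot,\cdot)$ defined in the context is not identically $0$ on $[0,1]^2$. Let $\Delta=\{(\varphi_1(u,v),\varphi_2(u,v))':0\le u,v\le1\}$ and suppose that (i) $\tilde K^{(a_1,a_2)}(\cdot)$ is a continuous function on an open set containing $\{\mathbf x-\mathbf y:\mathbf x,\mathbf y\in\Delta,\ \mathbf x\ne\mathbf y\}$ whenever $a_1,a_2$ are nonnegative integers such that $a_1+a_2=4$, and (ii) there exists a constant $\tilde C$ such that $|\tilde K^{(a_1,a_2)}(\mathbf x-\mathbf y)|\le\tilde C\|\mathbf x-\mathbf y\|^{2\nu-4}$ for all nonnegative integers $a_1,a_2$ with $a_1+a_2=4$ and all $\mathbf x,\mathbf y\in\Delta$ with $\mathbf x\ne\mathbf y$. Let $\hat\nu_{c,\ell}\in[0,2]$ satisfy $$\Bigl\{\frac{\bar V_{1,\ell}\bar F_{\ell,n}(\hat\nu_{c,\ell})}{\bar V_{2,\ell}}-1\Bigr\}^2=\min_{0\le\nu^*\le2}\Bigl\{\frac{\bar V_{1,\ell}\bar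 F_{\ell,n}(\nu^* )}{\bar V_{2,\ell}}-1\Bigr\}^2 .$$ Then $\hat\nu_{c,\ell}\to\nu$ as $n\to\infty$ almost surely.
   Context: Notation: $\|\cdot\|$ is the Euclidean norm; $\lfloor\cdot\rfloor$ is the greatest integer function. Covariance model. $X$ is a stationary, isotropic Gaussian random field on $\mathbb R^2$ with constant mean $\mu$ and covariance function $$K(\mathbf x,\mathbf y)=\operatorname{Cov}\{X(\mathbf x),X(\mathbf y)\}=\sum_{j=0}^{\lfloor\nu\rfloor}\beta_j\|\mathbf x-\mathbf y\|^{2j}+\beta_\nu^*G_\nu(\|\mathbf x-\mathbf y\|)+r(\mathbf x,\mathbf y),$$ where $\nu>0$, $\beta_\nu^*\ne0$, $\beta_0,\dots,\beta_{\lfloor\nu\rfloor}$ are constants; $r(\mathbf x,\mathbf y)=O(\|\mathbf x-\mathbf y\|^{2\nu+\tau})$ as $\|\mathbf x-\mathbf y\|\to0$ for some constant $\tau>0$; and for any $\nu>0$, $G_\nu:[0,\infty)\to\mathbb R$ satisfies $G_\nu(0)=0$ and, for $s>0$, $G_\nu(s)=s^{2\nu}$ if $\nu\notin\mathbb Z$, $G_\nu(s)=s^{2\nu}\log(s)$ if $\nu\in\mathbb Z$. Write $\tilde K(\mathbf x-\mathbf y)=K(\mathbf x,\mathbf y)$ and, for $\mathbf x=(x_1,x_2)'$, $\tilde K^{(a_1,a_2)}(\mathbf x)=\frac{\partial^{a_1+a_2}}{\partial x_1^{a_1}\partial x_2^{a_2}}\tilde K(\mathbf x)$. Diffeomorphism.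 A $C^1(\Omega)$ diffeomorphism is a continuous invertible map $\tilde\varphi:\Omega\to\mathbb R^2$ with continuous first-order partial derivatives on $\Omega$ whose inverse has continuous first-order partial derivatives on the range of $\tilde\varphi$; a $C^2(\Omega)$ diffeomorphism is a $C^1(\Omega)$ diffeomorphism with continuous second-order mixed partial derivatives. Write $\varphi_j^{(1,0)}(u,v)=\partial\varphi_j(u,v)/\partial u$, $\varphi_j^{(0,1)}(u,v)=\partial\varphi_j(u,v)/\partial v$. Quadratic variation. For $1\le i_1,i_2\le n$ let $\mathbf x^{i_1,i_2}=(x_1^{i_1,i_2},x_2^{i_1,i_2})'=(\varphi_1(i_1/n,i_2/n),\varphi_2(i_1/n,i_2/n))'$ and $X_{i_1,i_2}=X(\mathbf x^{i_1,i_2})$. For $\theta\in\{1,2\}$ and $1\le i_1,i_2\le n-\theta$ let $$A_{\theta;i_1,i_2}=\begin{pmatrix}x_1^{i_1+\theta,i_2}-x_1^{i_1,i_2}&x_2^{i_1+\theta,i_2}-x_2^{i_1,i_2}\\ x_1^{i_1,i_2+\theta}-x_1^{i_1,i_2}&x_2^{i_1,i_2+\theta}-x_2^{i_1,i_2}\end{pmatrix},$$ $$B_{\theta;i_1,i_2}=\begin{pmatrix}x_1^{i_1+\theta,i_2}-x_1^{i_1+\theta,i_2+\theta}&x_2^{i_1+\theta,i_2}-x_2^{i_1+\theta,i_2+\theta}\\ x_1^{i_1,i_2+\theta}-x_1^{i_1+\theta,i_2+\theta}&x_2^{i_1,i_2+\theta}-x_2^{i_1+\theta,i_2+\theta}\end{pmatrix},$$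 which are invertible for all sufficiently large $n$; write $A_{\theta;i_1,i_2}^{-1}=(\alpha^{j,l}_{\theta;i_1,i_2})_{j,l=1,2}$, $B_{\theta;i_1,i_2}^{-1}=(\beta^{j,l}_{\theta;i_1,i_2})_{j,l=1,2}$. For $\ell\in\{1,2\}$ define $$\bar\nabla_{\theta,\ell}X_{i_1,i_2}=\beta^{\ell,1}_{\theta;i_1,i_2}(X_{i_1+\theta,i_2}-X_{i_1+\theta,i_2+\theta})+\beta^{\ell,2}_{\theta;i_1,i_2}(X_{i_1,i_2+\theta}-X_{i_1+\theta,i_2+\theta})-\alpha^{\ell,1}_{\theta;i_1,i_2}(X_{i_1+\theta,i_2}-X_{i_1,i_2})-\alpha^{\ell,2}_{\theta;i_1,i_2}(X_{i_1,i_2+\theta}-X_{i_1,i_2}),$$ and let $c^{k_1,k_2}_{\theta,\ell;i_1,i_2}$, $0\le k_1,k_2\le1$, be the resulting coefficients: $\bar\nabla_{\theta,\ell}X_{i_1,i_2}=\sum_{0\le k_1,k_2\le1}c^{k_1,k_2}_{\theta,\ell;i_1,i_2}X_{i_1+\theta k_1,i_2+\theta k_2}$. Define $$\bar V_{\theta,\ell}=\sum_{1\le i_1,i_2\le n-\theta}(\bar\nabla_{\theta,\ell}X_{i_1,i_2})^2,$$ $$\bar f_{\theta,\ell}(\nu^* )=\beta_{\nu^*}^*\sum_{1\le i_1,i_2\le n-\theta}\ \sum_{\substack{0\le k_1,l_1,k_2,l_2\le1\\(k_1,k_2)\ne(l_1,l_2)}}c^{k_1,k_2}_{\theta,\ell;i_1,i_2}c^{l_1,l_2}_{\theta,\ell;i_1,i_2}G_{\nu^*}(\|\mathbf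 x^{i_1+\theta k_1,i_2+\theta k_2}-\mathbf x^{i_1+\theta l_1,i_2+\theta l_2}\|),\quad\nu^*\in(0,2),$$ with $\beta^*_{\nu^*}$ a nonzero constant. The function $\bar F_{\ell,n}:[0,2]\to[0,\infty)$ is $\bar F_{\ell,n}(\nu^* )=\bar f_{2,\ell}(\nu^* )/\bar f_{1,\ell}(\nu^* )$ for $\nu^*\in(0,2)$ (the constant $\beta^*_{\nu^*}$ cancels), $\bar F_{\ell,n}(0)=\lim_{\delta\to0+}\bar F_{\ell,n}(\delta)$, $\bar F_{\ell,n}(2)=\lim_{\delta\to0+}\bar F_{\ell,n}(2-\delta)$. The function $\mathcal J_{\nu,\ell}:[0,1]^2\to\mathbb R$ is (all derivatives evaluated at $(u,v)$; $\ell^c=2$ if $\ell=1$, $\ell^c=1$ if $\ell=2$) $$\mathcal J_{\nu,\ell}(u,v)=\frac{\{\varphi_{\ell^c}^{(0,1)}-\varphi_{\ell^c}^{(1,0)}\}^2}{\{\varphi_1^{(1,0)}\varphi_2^{(0,1)}-\varphi_1^{(0,1)}\varphi_2^{(1,0)}\}^2}\Bigl\{-2G_\nu\Bigl(\Bigl[\sum_{j=1}^2(\varphi_j^{(0,1)})^2\Bigr]^{1/2}\Bigr)-2G_\nu\Bigl(\Bigl[\sum_{j=1}^2(\varphi_j^{(1,0)})^2\Bigr]^{1/2}\Bigr)$$ $$\qquad+G_\nu\Bigl(\Bigl[\sum_{j=1}^2\{\varphi_j^{(1,0)}+\varphi_j^{(0,1)}\}^2\Bigr]^{1/2}\Bigr)+G_\nu\Bigl(\Bigl[\sum_{j=1}^2\{\varphi_j^{(0,1)}-\varphi_j^{(1,0)}\}^2\Bigr]^{1/2}\Bigr)\Bigr\}.$$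 For all $n$ the observations come from the same realization of $X$. *)

(* Defs.v *)
From HB Require Import structures.
From mathcomp Require Import all_boot all_order all_algebra.
From mathcomp Require Import all_classical all_reals all_analysis.
From mathcomp Require Import ring.

Set Implicit Arguments.
Unset Strict Implicit.
Unset Printing Implicit Defensive.

Import Order.TTheory GRing.Theory Num.Theory.
Import numFieldNormedType.Exports.

Local Open Scope classical_set_scope.
Local Open Scope ring_scope.

(* Points of the plane are row vectors 'rV[R]_2 and the
   coordinate index j = 1, 2 is the 0-based ordinal 0, 1 : 'I_2. *)

Section Plane.
Context {R : realType}.

(* The library norm on 'rV[R]_2 is the sup norm. *)
Definition enorm (x : 'rV[R]_2) : R := Num.sqrt (\sum_(j < 2) x 0 j ^+ 2).

Definition plane_pt (u v : R) : 'rV[R]_2 :=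
  \row_(j < 2) (if j == 0 then u else v).

Definition unit_square : set 'rV[R]_2 :=
  [set x | forall j, 0 <= x 0 j <= 1].

Definition partial (j : 'I_2) (f : 'rV[R]_2 -> R) : 'rV[R]_2 -> R :=
  fun x => 'D_(delta_mx 0 j) f x.

Definition partials (a1 a2 : nat) (f : 'rV[R]_2 -> R) : 'rV[R]_2 -> R :=
  iter a1 (partial 0) (iter a2 (partial 1) f).

(* 'D_v is a total function, so the existence of every derivative occurring in
   [partials a1 a2 f] has to be required separately. *)
Definition partials_exist (U : set 'rV[R]_2) (a1 a2 : nat)
    (f : 'rV[R]_2 -> R) : Prop :=
  forall x, U x ->
    (forall i, (i < a2)%N ->
       derivable (iter i (partial 1) f) x (delta_mx 0 1)) /\
    (forall i, (i < a1)%N ->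
       derivable (iter i (partial 0) (iter a2 (partial 1) f)) x
         (delta_mx 0 0)).

Definition partials_continuous (U : set 'rV[R]_2) (a1 a2 : nat)
    (f : 'rV[R]_2 -> R) : Prop :=
  [/\ open U, partials_exist U a1 a2 f & {in U, continuous (partials a1 a2 f)}].

Definition component (f : 'rV[R]_2 -> 'rV[R]_2) (k : 'I_2) : 'rV[R]_2 -> R :=
  fun x => f x 0 k.

Definition continuous_first_partials (U : set 'rV[R]_2)
    (f : 'rV[R]_2 -> 'rV[R]_2) : Prop :=
  forall k, partials_continuous U 1 0 (component f k) /\
            partials_continuous U 0 1 (component f k).

(* The inverse is any psi that inverts phi on Omega; its values outside the
   range are irrelevant because the range is open.  Openness is part of
   [partials_continuous]; for a continuous injection of an open set of the
   plane it holds automatically (invariance of domain). *)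
Definition C1_diffeo (Omega : set 'rV[R]_2) (phi : 'rV[R]_2 -> 'rV[R]_2) :
    Prop :=
  [/\ {in Omega, continuous phi},
      continuous_first_partials Omega phi &
      exists psi : 'rV[R]_2 -> 'rV[R]_2,
        {in Omega, cancel phi psi} /\
        continuous_first_partials (phi @` Omega) psi].

(* Only the mixed derivatives d^2/du dv and d^2/dv du are required; a map all of
   whose second-order partial derivatives are continuous qualifies a fortiori. *)
Definition C2_diffeo (Omega : set 'rV[R]_2) (phi : 'rV[R]_2 -> 'rV[R]_2) :
    Prop :=
  C1_diffeo Omega phi /\
  forall k (i j : 'I_2), i != j ->
    (forall x, Omega x ->
       derivable (partial j (component phi k)) x (delta_mx 0 i)) /\
    {in Omega, continuous (partial i (partial j (component phi k)))}.

End Plane.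

Section GaussianField.
Context {d : measure_display} {T : measurableType d} {R : realType}
  {P : probability T R}.

(* A Gaussian law may be degenerate; the library's [normal_prob m 0] is not the
   Dirac mass at m, hence the case distinction. *)
Definition gaussian_law (Y : T -> R) : Prop :=
  exists m s : R, forall A : set R, measurable A ->
    P (Y @^-1` A) = if s == 0 then \d_m A else normal_prob m s A.

Definition gaussian_field (X : 'rV[R]_2 -> {RV P >-> R}) : Prop :=
  forall (m : nat) (a : 'I_m -> R) (t : 'I_m -> 'rV[R]_2),
    gaussian_law (fun w => \sum_(i < m) a i * X (t i) w).

Definition isotropic (Kt : 'rV[R]_2 -> R) : Prop :=
  forall h h', enorm h = enorm h' -> Kt h = Kt h'.

(* For a Gaussian field, stationarity and isotropy are the invariance of the
   mean function and of the covariance function. *)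
Definition stationary_isotropic (X : 'rV[R]_2 -> {RV P >-> R}) (mu : R)
    (Kt : 'rV[R]_2 -> R) : Prop :=
  [/\ forall x, ('E_P[X x] = mu%:E)%E,
      forall x y, covariance P (X x) (X y) = (Kt (x - y))%:E &
      isotropic Kt].

End GaussianField.

Section CovarianceModel.
Context {R : realType}.

Definition Gfun (nu s : R) : R :=
  if s == 0 then 0
  else if nu \is a Num.int then s `^ (2 * nu) * ln s
  else s `^ (2 * nu).

(* The case x = y is included: the bound forces r x x = 0, which excludes a
   jump of the covariance function at the origin. *)
Definition bigO_diag (r : 'rV[R]_2 -> 'rV[R]_2 -> R) (e : R) : Prop :=
  exists C delta : R, 0 < delta /\
    forall x y, enorm (x - y) < delta -> `|r x y| <= C * enorm (x - y) `^ e.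

Definition covariance_model (Kt : 'rV[R]_2 -> R) (nu : R) (beta : nat -> R)
    (betastar : R) (r : 'rV[R]_2 -> 'rV[R]_2 -> R) : Prop :=
  forall x y, Kt (x - y) =
    \sum_(j < (Num.truncn nu).+1) beta j * enorm (x - y) ^+ (2 * j)
    + betastar * Gfun nu (enorm (x - y)) + r x y.

End CovarianceModel.

Section QuadraticVariation.
Context {R : realType} (phi : 'rV[R]_2 -> 'rV[R]_2) (n : nat).

Definition site (i1 i2 : nat) : 'rV[R]_2 :=
  phi (plane_pt (i1%:R / n%:R) (i2%:R / n%:R)).

Definition Amx (th i1 i2 : nat) : 'M[R]_2 :=
  col_mx (site (i1 + th) i2 - site i1 i2) (site i1 (i2 + th) - site i1 i2).

Definition Bmx (th i1 i2 : nat) : 'M[R]_2 :=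
  col_mx (site (i1 + th) i2 - site (i1 + th) (i2 + th))
         (site i1 (i2 + th) - site (i1 + th) (i2 + th)).

Definition alphac (th i1 i2 : nat) (j l : 'I_2) : R := invmx (Amx th i1 i2) j l.
Definition betac (th i1 i2 : nat) (j l : 'I_2) : R := invmx (Bmx th i1 i2) j l.

Definition nabla (th : nat) (ell : 'I_2) (Y : nat -> nat -> R) (i1 i2 : nat) :
    R :=
    betac th i1 i2 ell 0 * (Y (i1 + th)%N i2 - Y (i1 + th)%N (i2 + th)%N)
  + betac th i1 i2 ell 1 * (Y i1 (i2 + th)%N - Y (i1 + th)%N (i2 + th)%N)
  - alphac th i1 i2 ell 0 * (Y (i1 + th)%N i2 - Y i1 i2)
  - alphac th i1 i2 ell 1 * (Y i1 (i2 + th)%N - Y i1 i2).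

Definition coef (th : nat) (ell : 'I_2) (i1 i2 : nat) (k : bool * bool) : R :=
  match k with
  | (false, false) => alphac th i1 i2 ell 0 + alphac th i1 i2 ell 1
  | (true, false) => betac th i1 i2 ell 0 - alphac th i1 i2 ell 0
  | (false, true) => betac th i1 i2 ell 1 - alphac th i1 i2 ell 1
  | (true, true) => - (betac th i1 i2 ell 0 + betac th i1 i2 ell 1)
  end.

Lemma nabla_coef th ell Y i1 i2 :
  nabla th ell Y i1 i2 =
  \sum_(k : bool * bool)
     coef th ell i1 i2 k * Y (i1 + th * k.1)%N (i2 + th * k.2)%N.
Proof.
transitivity (\sum_(k1 : bool) \sum_(k2 : bool)
    coef th ell i1 i2 (k1, k2) * Y (i1 + th * k1)%N (i2 + th * k2)%N); last first.
  by rewrite pair_bigA; apply: eq_bigr => -[].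
rewrite !big_bool /= !muln1 !muln0 !addn0.
by rewrite /nabla; ring.
Qed.

Definition Vbar (th : nat) (ell : 'I_2) (Y : nat -> nat -> R) : R :=
  \sum_(1 <= i1 < (n - th).+1) \sum_(1 <= i2 < (n - th).+1)
    nabla th ell Y i1 i2 ^+ 2.

Definition fbar (betastar : R -> R) (th : nat) (ell : 'I_2) (t : R) : R :=
  betastar t *
  \sum_(1 <= i1 < (n - th).+1) \sum_(1 <= i2 < (n - th).+1)
    \sum_(k : bool * bool) \sum_(l : bool * bool | k != l)
      coef th ell i1 i2 k * coef th ell i1 i2 l *
      Gfun t (enorm (site (i1 + th * k.1) (i2 + th * k.2)
                  - site (i1 + th * l.1) (i2 + th * l.2))).

Definition fratio (betastar : R -> R) (ell : 'I_2) (t : R) : R :=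
  fbar betastar 2 ell t / fbar betastar 1 ell t.

Definition Fbar (betastar : R -> R) (ell : 'I_2) (t : R) : R :=
  if t == 0 then lim (fratio betastar ell delta @[delta --> 0^'+])
  else if t == 2 then lim (fratio betastar ell (2 - delta) @[delta --> 0^'+])
  else fratio betastar ell t.

Definition criterion (betastar : R -> R) (ell : 'I_2) (Y : nat -> nat -> R)
    (t : R) : R :=
  (Vbar 1 ell Y * Fbar betastar ell t / Vbar 2 ell Y - 1) ^+ 2.

Definition is_estimate (betastar : R -> R) (ell : 'I_2) (Y : nat -> nat -> R)
    (t : R) : Prop :=
  0 <= t <= 2 /\
  forall t', 0 <= t' <= 2 ->
    criterion betastar ell Y t <= criterion betastar ell Y t'.

End QuadraticVariation.

Section Limit.
Context {R : realType} (phi : 'rV[R]_2 -> 'rV[R]_2).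

Definition phi_u (x : 'rV[R]_2) : 'rV[R]_2 :=
  \row_(j < 2) partials 1 0 (component phi j) x.
Definition phi_v (x : 'rV[R]_2) : 'rV[R]_2 :=
  \row_(j < 2) partials 0 1 (component phi j) x.

(* [rev_ord ell] is the other coordinate index. *)
Definition Jfun (nu : R) (ell : 'I_2) (u v : R) : R :=
  let a := phi_u (plane_pt u v) in
  let b := phi_v (plane_pt u v) in
  (b 0 (rev_ord ell) - a 0 (rev_ord ell)) ^+ 2
  / (a 0 0 * b 0 1 - b 0 0 * a 0 1) ^+ 2
  * (- 2 * Gfun nu (enorm b) - 2 * Gfun nu (enorm a)
     + Gfun nu (enorm (a + b)) + Gfun nu (enorm (b - a))).

End Limit.

(* Main.v *)
Require Import Defs.
From HB Require Import structures.
From mathcomp Require Import all_boot all_order all_algebra.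
From mathcomp Require Import all_classical all_reals all_analysis.
From mathcomp Require Import measurable_realfun ring lra zify.

Set Implicit Arguments.
Unset Strict Implicit.
Unset Printing Implicit Defensive.

Import Order.TTheory GRing.Theory Num.Theory.
Import numFieldNormedType.Exports.

Local Open Scope classical_set_scope.
Local Open Scope ring_scope.

(** The estimator matches the observed ratio of quadratic variations at the
    two spacings with the ratio [Fbar] that a field of smoothness [t] would
    produce, and both ratios converge to explicit powers of two: [Fbar] at
    [t] to 2^(2t-2), uniformly for t in [0,2], and the observed ratio
    V_2 / V_1 to 2^(2 nu - 2).  Hence the contrast vanishes in the limit at
    [nu], so it also vanishes along any sequence of minimisers, and then
    2^(2 nuhat) must converge to 2^(2 nu); this last step is
    [minimum_contrast_consistency].

    The deterministic half rests on one function, kappa t x = (x^t - x)/(t-1),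
    extended by x ln x at t = 1.  In the variable x = s^2 the function [Gfun t]
    is a multiple of [kappa t] plus a multiple of s^2, and the coefficients of
    the operator nabla are exactly such that constants and quadratic terms
    disappear (they sum to zero and annihilate the four sites).  Up to a
    factor that depends only on [t] and the mesh, every sum over the grid is
    therefore a sum of values of [stencil_form] at the sites rescaled by the
    mesh, which makes sense for all t in [0,2], end points and t = 1 included.
    As the mesh shrinks, the stencil at a point converges, uniformly on the
    square, to the parallelogram spanned by the two partial derivatives of
    the diffeomorphism, whatever the spacing ([stencil_sum_close]).  The limit
    is a nonnegative weight times
    kappa(|a+b|^2) + kappa(|a-b|^2) - 2 kappa(|a|^2) - 2 kappa(|b|^2), which is
    positive ([kappa_parallelogram]); the weight is positive on an open set
    because [Jfun] does not vanish identically.  So the sums grow like n^2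
    with the same leading term for both spacings, and the powers of two come
    only from the powers of the mesh ([Fbar_uniform], [variance_sum_ratio]).

    The probabilistic half shows that V / E V tends to 1 almost surely
    ([quadratic_variation_ae_cvg]).  The summands are squares of jointly
    Gaussian variables.  Gaussian integration by parts bounds a high even
    moment of V / E V - 1 by a power of rho / E V, where rho is the largest
    absolute row sum of the covariance matrix; once this ratio decays like a
    power of n, a moment of large order is summable and Borel-Cantelli type
    reasoning applies.  For the row sums ([row_sum_bound]), sites at distance
    less than n^(-1/2) are few and are handled by the Cauchy-Schwarz
    inequality; for the others, the covariance of two stencils is a difference
    of order four of the covariance function, controlled by its fourth
    derivatives ([far_covariance]).  This is where both assumptions on those
    derivatives enter, first extended from the differences of points of the
    domain to a neighbourhood of them ([derivative_neighbourhood]). *)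

(** * Moments of the normal law *)

Section normal_moments.
Context {R : realType}.
Local Notation leb := (@lebesgue_measure R).

(** The normal law is defined in terms of its density, so Radon-Nikodym turns
    integrals against it into Lebesgue integrals, where integration by parts
    is available. *)
Lemma Radon_Nikodym_normal_prob (m s : R) :
  ae_eq leb setT
    (Radon_Nikodym (charge_of_finite_measure (normal_prob m s)) leb)
    (fun x => (normal_pdf m s x)%:E).
Proof.
rewrite Radon_NikodymE; first exact: normal_prob_dominates.
move=> dom; case: cid => /= h [h1 h2 h3].
apply: integral_ae_eq => //.
  by apply/measurable_EFinP; exact: measurable_normal_pdf.
by move=> E _ mE; rewrite -h3.
Qed.

Lemma ge0_integral_normal_prob (m s : R) (f : R -> R) :
  measurable_fun setT f -> (forall x, 0 <= f x) ->
  (\int[normal_prob m s]_x (f x)%:E =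
   \int[leb]_x (f x * normal_pdf m s x)%:E)%E.
Proof.
move=> mf f0.
have dom := @normal_prob_dominates R m s.
rewrite -(Radon_Nikodym_SigmaFinite.change_of_variables dom) //; last first.
  exact/measurable_EFinP.
under [RHS]eq_integral do rewrite EFinM.
have mf' : measurable_fun setT (fun x => (f x)%:E) by exact/measurable_EFinP.
apply: ae_eq_integral => //.
- apply: emeasurable_funM => //.
  exact: measurable_int (Radon_Nikodym_SigmaFinite.f_integrable dom).
- apply: emeasurable_funM => //.
  by apply/measurable_EFinP; exact: measurable_normal_pdf.
- apply: ae_eqe_mul2l.
  apply: ae_eq_trans (Radon_Nikodym_normal_prob m s).
  exact: ae_eq_Radon_Nikodym_SigmaFinite.
Qed.

Lemma integral_normal_prob (m s : R) (f : R -> R) :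
  (normal_prob m s).-integrable setT (EFin \o f) ->
  (\int[normal_prob m s]_x (f x)%:E =
   \int[leb]_x (f x * normal_pdf m s x)%:E)%E.
Proof.
move=> fi; have dom := @normal_prob_dominates R m s.
rewrite -(Radon_Nikodym_change_of_variables dom) //.
under [RHS]eq_integral do rewrite EFinM.
have mf := measurable_int _ fi.
apply: ae_eq_integral => //.
- apply: emeasurable_funM => //.
- apply: emeasurable_funM => //.
  by apply/measurable_EFinP; exact: measurable_normal_pdf.
- by apply: ae_eqe_mul2l; exact: Radon_Nikodym_normal_prob.
Qed.

(** The exponential series dominates each of its terms; the summand 1 in the
    constant takes care of y < 1, where the power of order k exceeds the one
    of order k + 1. *)
Lemma exp_dominates_power (k : nat) (c : R) : 0 < c ->
  exists2 C, 0 < C & forall y, 0 <= y -> y ^+ k <= C * expR (c * y).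
Proof.
move=> c0; exists (k.+1`!%:R / c ^+ k.+1 + 1).
  by rewrite addr_gt0// divr_gt0 ?exprn_gt0// ltr0n fact_gt0.
move=> y y0; have cy0 : 0 <= c * y by rewrite mulr_ge0// ltW.
have h := expR_ge1Dxn k cy0.
have e1 : 1 <= expR (c * y) by rewrite (le_trans _ (expR_ge1Dx _))// lerDl.
have h2 : y ^+ k.+1 <= k.+1`!%:R / c ^+ k.+1 * expR (c * y).
  have h' : (c * y) ^+ k.+1 / k.+1`!%:R <= expR (c * y).
    by apply: le_trans h; rewrite lerDr.
  rewrite ler_pdivrMr ?ltr0n ?fact_gt0// in h'.
  by rewrite mulrAC ler_pdivlMr ?exprn_gt0// -exprMn mulrC mulrC [y * c]mulrC [leRHS]mulrC.
have [y1|/ltW y1] := leP y 1.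
  apply: (@le_trans _ _ 1); first by rewrite exprn_ile1.
  rewrite mulrDl mul1r; apply: le_trans e1 _; rewrite lerDr.
  by rewrite mulr_ge0 ?expR_ge0// divr_ge0// ?exprn_ge0// ltW.
apply: (@le_trans _ _ (y ^+ k.+1)); first by rewrite ler_weXn2l.
apply: le_trans h2 _; rewrite ler_wpM2r ?expR_ge0//; lra.
Qed.

(** Doubling the standard deviation leaves an exponential of a multiple of
    (x - m)^2 to spare, which absorbs any power. *)
Lemma power_normal_fun_bound (m s : R) (k : nat) : s != 0 ->
  exists2 C, 0 < C & forall x,
    `|(x - m) ^+ k| * normal_fun m s x <= C * normal_fun m (2 * s) x.
Proof.
move=> s0; have s2 : 0 < s ^+ 2 by rewrite exprn_even_gt0.
have c0 : 0 < 3 / (8 * s ^+ 2) by rewrite divr_gt0// mulr_gt0.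
have [C C0 hC] := exp_dominates_power k c0.
have [C' C'0 hC'] := exp_dominates_power 0 c0.
exists (C + C'); first exact: addr_gt0.
move=> x; rewrite /normal_fun.
have -> : - (x - m) ^+ 2 / (s ^+ 2 *+ 2) =
   - (x - m) ^+ 2 / ((2 * s) ^+ 2 *+ 2) - 3 / (8 * s ^+ 2) * (x - m) ^+ 2.
  by field.
rewrite expRD expRN mulrCA [leRHS]mulrC ler_wpM2l ?expR_ge0//.
rewrite ler_pdivrMr ?expR_gt0//.
have h := hC' _ (sqr_ge0 (x - m)).
have hk := hC _ (sqr_ge0 (x - m)).
apply: (@le_trans _ _ (1 + ((x - m) ^+ 2) ^+ k)).
  rewrite exprAC -real_normK ?num_real//.
  by have := sqr_ge0 (`|(x - m) ^+ k| - 1); have := normr_ge0 ((x - m) ^+ k); nra.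
by rewrite expr0 in h; rewrite mulrDl addrC lerD.
Qed.

Lemma integrable_power_normal (m s : R) (k : nat) : s != 0 ->
  leb.-integrable setT (fun x => ((x - m) ^+ k * normal_pdf m s x)%:E).
Proof.
move=> s0; have [C C0 hC] := power_normal_fun_bound m k s0.
have s20 : 2 * s != 0 by rewrite mulf_neq0.
pose c := normal_peak s * C / normal_peak (2 * s).
apply: (@le_integrable _ (measurableTypeR R) R leb _ measurableT _
  (fun x => (c%:E * (normal_pdf m (2 * s) x)%:E)%E)).
- apply/measurable_EFinP; apply: measurable_funM.
    by apply: measurable_funX; apply: measurable_funB.
  exact: measurable_normal_pdf.
- move=> x _; rewrite -EFinM !abse_EFin lee_fin !normal_pdfE// /c.
  have := hC x; set f1 := normal_fun m s x; set f2 := normal_fun m (2 * s) x.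
  have f10 : 0 <= f1 by exact: normal_fun_ge0.
  have f20 : 0 <= f2 by exact: normal_fun_ge0.
  have := normal_peak_gt0 s20; have := normal_peak_gt0 s0.
  set p1 := normal_peak s; set p2 := normal_peak (2 * s) => p10 p20 h.
  have -> : p1 * C / p2 * (p2 * f2) = p1 * (C * f2) by field; rewrite gt_eqF.
  rewrite normrM (ger0_norm (mulr_ge0 (ltW p10) f10)).
  rewrite [leRHS]ger0_norm ?(mulr_ge0 (ltW p10)) ?(mulr_ge0 (ltW C0))//.
  by rewrite [leLHS]mulrCA ler_pM2l.
- apply: integrableZl => //; exact: integrable_normal_pdf.
Qed.

End normal_moments.

Section normal_recursion.
Context {R : realType}.
Local Notation leb := (@lebesgue_measure R).

Lemma is_derive_normal_fun (m s x : R) : s != 0 ->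
  is_derive x 1 (normal_fun m s) (- ((x - m) / s ^+ 2) * normal_fun m s x).
Proof.
move=> s0; rewrite /normal_fun.
apply: is_derive_eq; rewrite /GRing.scale /=; by field.
Qed.

(** The fundamental theorem of calculus on [-n, n], then dominated
    convergence; it is enough that the difference of the two end values
    tends to 0. *)
Lemma integral_derivative_vanishing (F f : R -> R) :
  (forall x : R, is_derive x 1 F (f x)) -> continuous f ->
  leb.-integrable setT (EFin \o f) ->
  (F n%:R - F (- n%:R)) @[n --> \oo] --> (0 : R) ->
  (\int[leb]_x (f x)%:E = 0)%E.
Proof.
move=> dF cf fi F0.
have mf : measurable_fun setT f by exact: continuous_measurable_fun.
pose I (n : nat) : set R := `[- n%:R, n%:R]%classic.
have mI n : measurable (I n) by exact: measurable_itv.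
pose f_ n x : \bar R := ((EFin \o f) \_ (I n)) x.
have [||||| _ _ h] := @dominated_convergence _ (measurableTypeR R) R leb setT measurableT f_
  (EFin \o f) (fun x => `|f x|%:E).
- move=> n; apply/(measurable_restrictT _ (mI n)).
  apply: measurable_funTS; exact/measurable_EFinP.
- exact/measurable_EFinP.
- apply: aeW => x _; apply: cvg_near_cst.
  near=> n; rewrite /f_ patchE mem_set//= /I/= in_itv/= -ler_norml.
  by apply: ltW; near: n; exact: nbhs_infty_gtr.
- exact: (integrable_abse fi).
- apply: aeW => x n _; rewrite /f_ patchE.
  case: ifPn => _ /=; first by []. by rewrite normr0 lee_fin.
apply: (cvg_unique _ h) => //.
suff : (F n%:R - F (- n%:R))%:E @[n --> \oo] --> 0%E.
  apply: cvg_trans; apply: near_eq_cvg; near=> n.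
  rewrite /=; have -> : (\int[leb]_x f_ n x = \int[leb]_(x in I n) (f x)%:E)%E.
    by rewrite [RHS]integral_mkcond.
  
  have n0 : (0 < n)%N by near: n; exact: nbhs_infty_gt.
  rewrite (@continuous_FTC2 R f F) -?EFinB//.
  - by rewrite gtrN// ltr0n.
  - exact: continuous_subspaceT.
  - have cF x : {for x, continuous F}.
      by apply: differentiable_continuous; apply/derivable1_diffP; apply: ex_derive.
    split; first by move=> x _; apply: ex_derive.
      by apply: cvg_at_right_filter; exact: cF.
    by apply: cvg_at_left_filter; exact: cF.
  - by move=> x _; rewrite derive1E; apply: derive_val.
by apply: cvg_EFin => //; apply: nearW.
Unshelve. all: end_near. Qed.

(** Integration by parts: the density satisfies (x - m) p = - s^2 p', so both
    sides differ by the integral of the derivative of s^2 (x - m)^j p, which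
    vanishes at infinity.  At j = 0 the right-hand side is 0 whatever the value
    of the predecessor. *)
Lemma normal_moment_recursion (m s : R) (j : nat) : s != 0 ->
  (\int[leb]_x ((x - m) ^+ j.+1 * normal_pdf m s x)%:E =
   (j%:R * s ^+ 2)%:E *
   \int[leb]_x ((x - m) ^+ j.-1 * normal_pdf m s x)%:E)%E.
Proof.
move=> s0.
(* The primitive s^2 (x - m)^j p of the difference of the two integrands. *)
pose F x := (x - m) ^+ j * (normal_peak s * normal_fun m s x) * s ^+ 2.
pose f x := j%:R * s ^+ 2 * ((x - m) ^+ j.-1 * normal_pdf m s x)
            - (x - m) ^+ j.+1 * normal_pdf m s x.
have i1 := @integrable_power_normal R m s j.+1 s0.
have i2 := @integrable_power_normal R m s j.-1 s0.
have i3 : leb.-integrable setT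
    (fun x => (j%:R * s ^+ 2)%:E * ((x - m) ^+ j.-1 * normal_pdf m s x)%:E)%E.
  exact: integrableZl.
have fi : leb.-integrable setT (EFin \o f).
  apply: eq_integrable (integrableB measurableT i3 i1) => //.
suff : (\int[leb]_x (f x)%:E = 0)%E.
  under eq_integral do rewrite /f EFinB EFinM.
  rewrite integralB//= integralZl//=.
  have := integrable_fin_num measurableT i1.
  have := integrable_fin_num measurableT i2.
  move: (integral _ _ _) (integral _ _ _) => [a||]// [b||]// _ _ /=.
  by rewrite -EFinM -EFinB => -[] /eqP; rewrite subr_eq0 => /eqP ->.
apply: (@integral_derivative_vanishing F) => //.
- move=> x.
  have dn := is_derive_normal_fun m x s0.
  have dX : is_derive x 1 ((fun y : R => y - m) ^+ j) (j%:R * (x - m) ^+ j.-1).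
    have dB : is_derive x 1 (fun y : R => y - m) 1 by apply: is_derive_eq; rewrite subr0.
    by have := is_deriveX j dB; rewrite /GRing.scale /= mulr1.
  have -> : F = (fun y : R => y - m) ^+ j * normal_fun m s * cst (normal_peak s * s ^+ 2).
    apply/funext => y; rewrite /F !fctE. ring.
  rewrite /f normal_pdfE//; apply: is_derive_eq; rewrite /GRing.scale /= !fctE.
  rewrite /GRing.scale /= !exprS; field.
  by [].
- have c1 : continuous (fun y : R => y - m) by move=> y; apply: cvgB => //; exact: cvg_cst.
  have c2 i : continuous (fun y : R => (y - m) ^+ i * normal_pdf m s y).
    move=> y; apply: cvgM; last exact: continuous_normal_pdf.
    by apply: (@continuous_comp _ _ _ (fun y : R => y - m) (fun z : R => z ^+ i)); [exact: c1|exact: exprn_continuous].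
  by move=> y; apply: cvgB; [apply: cvgM; [exact: cvg_cst|exact: c2]|exact: c2].
- have [C C0 hC] := power_normal_fun_bound m j.+1 s0.
  have hF x : x != m -> `|F x| <= normal_peak s * s ^+ 2 * C / `|x - m|.
    move=> xm; have xm0 : 0 < `|x - m| by rewrite normr_gt0 subr_eq0.
    rewrite ler_pdivlMr//.
    have -> : `|F x| * `|x - m| = normal_peak s * s ^+ 2 *
        (`|(x - m) ^+ j.+1| * normal_fun m s x).
      rewrite /F 3!normrM !(ger0_norm (normal_fun_ge0 _ _ _)) (ger0_norm (sqr_ge0 s)).
      by rewrite (ger0_norm (normal_peak_ge0 s)) !normrX [_ ^+ j.+1]exprS; ring.
    apply: ler_wpM2l; first exact: mulr_ge0 (normal_peak_ge0 _) (sqr_ge0 _).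
    apply: le_trans (hC x) _; rewrite ler_piMr ?(ltW C0)//.
    by rewrite /normal_fun -[leRHS]expR0 ler_expR mulNr oppr_le0 divr_ge0 ?sqr_ge0// mulrn_wge0 ?sqr_ge0.
  set D := normal_peak s * s ^+ 2 * C in hF.
  have D0 : 0 < D by apply: mulr_gt0 => //; apply: mulr_gt0; rewrite ?normal_peak_gt0 ?exprn_even_gt0.
  clearbody D; apply/cvgrPdist_le => e e0; near=> n.
  have nm : `|m| + 2 * D / e < n%:R by near: n; exact: nbhs_infty_gtr.
  have De : 0 < 2 * D / e by rewrite divr_gt0// mulr_gt0.
  have bound y : 2 * D / e <= `|y - m| -> `|F y| <= e / 2.
    move=> hy; have ym : 0 < `|y - m| by exact: lt_le_trans hy.
    apply: le_trans (hF _ _) _; first by rewrite -subr_eq0 -normr_gt0.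
    rewrite ler_pdivrMr//; rewrite ler_pdivrMr// in hy; lra.
  rewrite sub0r normrN [e](splitr e); apply: le_trans (ler_normB _ _) _.
  apply: lerD; apply: bound.
    apply: le_trans (ler_norm _); have := ler_norm m; lra.
  by rewrite -normrN; apply: le_trans (ler_norm _); have := ler_norm (- m); rewrite normrN; lra.
Unshelve. all: end_near. Qed.
End normal_recursion.

(** * Random variables with moments of all orders *)

Section moment_class.
Context {d : measure_display} {T : measurableType d} {R : realType}
  (P : probability T R).
Implicit Types F G : T -> R.

(** Integrability of all absolute moments is stable under sums and products,
    so inside this class every identity between expectations can be computed
    termwise without further integrability conditions. *)
Definition finite_moments (F : T -> R) : Prop :=
  measurable_fun setT F /\
  forall k, P.-integrable setT (fun w => (`|F w| ^+ k)%:E).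

Lemma finite_moments_dominated F (B : nat -> T -> R) :
  measurable_fun setT F ->
  (forall k, P.-integrable setT (fun w => (B k w)%:E)) ->
  (forall k w, `|F w| ^+ k <= B k w) -> finite_moments F.
Proof.
move=> mF iB FB; split=> // k.
apply: (le_integrable measurableT _ _ (iB k)).
  apply/measurable_EFinP; apply: measurable_funX.
  exact: measurableT_comp.
move=> w _; rewrite !abse_EFin lee_fin ger0_norm ?exprn_ge0//.
by apply: le_trans (FB k w) (ler_norm _).
Qed.

Lemma finite_moments_integrable F :
  finite_moments F -> P.-integrable setT (fun w => (F w)%:E).
Proof.
move=> [mF iF]; apply: (le_integrable measurableT _ _ (iF 1%N)).
  exact/measurable_EFinP.
by move=> w _; rewrite !abse_EFin lee_fin expr1 normr_id.
Qed.

Lemma finite_moments_cst (c : R) : finite_moments (fun=> c).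
Proof.
by split=> // k; apply: finite_measure_integrable_cst.
Qed.

Lemma finite_momentsM F G : finite_moments F -> finite_moments G ->
  finite_moments (fun w => F w * G w).
Proof.
move=> [mF iF] [mG iG].
apply: (@finite_moments_dominated _ (fun k w => `|F w| ^+ (k + k) + `|G w| ^+ (k + k))).
- exact: measurable_funM.
- by move=> k; under eq_fun do rewrite EFinD; exact: integrableD.
move=> k w; rewrite normrM exprMn !exprD.
have := sqr_ge0 (`|F w| ^+ k - `|G w| ^+ k).
have := exprn_ge0 k (normr_ge0 (F w)); have := exprn_ge0 k (normr_ge0 (G w)).
nra.
Qed.

Lemma finite_momentsD F G : finite_moments F -> finite_moments G ->
  finite_moments (fun w => F w + G w).
Proof.
move=> [mF iF] [mG iG].
apply: (@finite_moments_dominated _ (fun k w => 2 ^+ k * (`|F w| ^+ k + `|G w| ^+ k))).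
- exact: measurable_funD.
- move=> k; under eq_fun do rewrite EFinM EFinD.
  by apply: integrableZl => //; exact: integrableD.
move=> k w; have aF := normr_ge0 (F w); have aG := normr_ge0 (G w).
apply: (@le_trans _ _ ((2 * Num.max `|F w| `|G w|) ^+ k)).
  rewrite lerXn2r ?nnegrE ?mulr_ge0// ?le_max ?aF//.
  apply: le_trans (ler_normD _ _) _; rewrite mulr2n mulrDl mul1r.
  by apply: lerD; rewrite le_max lexx ?orbT.
rewrite exprMn ler_wpM2l ?exprn_ge0//.
have [h|h] := leP `|F w| `|G w|; first by rewrite lerDr exprn_ge0.
by rewrite lerDl exprn_ge0.
Qed.

Lemma finite_momentsZ (c : R) F : finite_moments F ->
  finite_moments (fun w => c * F w).
Proof. by move=> h; apply: finite_momentsM => //; exact: finite_moments_cst. Qed.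

Lemma finite_momentsN F : finite_moments F -> finite_moments (fun w => - F w).
Proof.
move=> hF; under eq_fun do rewrite -mulN1r; exact: finite_momentsZ.
Qed.

Lemma finite_momentsX F k : finite_moments F -> finite_moments (fun w => F w ^+ k).
Proof.
move=> hF; elim: k => [|k ih]; first exact: finite_moments_cst.
under eq_fun do rewrite exprS; exact: finite_momentsM.
Qed.

Lemma finite_moments_sum (I : Type) (r : seq I) (F : I -> T -> R) :
  (forall i, finite_moments (F i)) -> finite_moments (fun w => \sum_(i <- r) F i w).
Proof.
move=> hF; elim: r => [|i r ih].
  by under eq_fun do rewrite big_nil; exact: finite_moments_cst.
under eq_fun do rewrite big_cons; exact: finite_momentsD.
Qed.

Lemma RintegralMl_moments (c : R) F : finite_moments F ->
  \int[P]_w (c * F w) = c * \int[P]_w F w.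
Proof. by move=> /finite_moments_integrable hF; exact: RintegralZl. Qed.

Lemma RintegralD_moments F G : finite_moments F -> finite_moments G ->
  \int[P]_w (F w + G w) = \int[P]_w F w + \int[P]_w G w.
Proof.
by move=> /finite_moments_integrable hF /finite_moments_integrable hG; exact: RintegralD.
Qed.

Lemma RintegralB_moments F G : finite_moments F -> finite_moments G ->
  \int[P]_w (F w - G w) = \int[P]_w F w - \int[P]_w G w.
Proof.
by move=> /finite_moments_integrable hF /finite_moments_integrable hG; exact: RintegralB.
Qed.

Lemma Rintegral_cst_prob (c : R) : \int[P]_w c = c.
Proof. by rewrite (Rintegral_cst P measurableT) /= probability_setT mulr1. Qed.

Lemma Rintegral_mul1l F : \int[P]_t (1 * F t) = \int[P]_t F t.
Proof. by apply: eq_Rintegral => t _; rewrite mul1r. Qed.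

Lemma Rintegral_sum_moments (I : Type) (r : seq I) (F : I -> T -> R) :
  (forall i, finite_moments (F i)) ->
  \int[P]_w (\sum_(i <- r) F i w) = \sum_(i <- r) \int[P]_w F i w.
Proof.
move=> hF; elim: r => [|i r ih].
  by rewrite big_nil; under eq_Rintegral do rewrite big_nil; exact: Rintegral_cst_prob.
rewrite big_cons -ih; under eq_Rintegral do rewrite big_cons.
by rewrite RintegralD_moments//; exact: finite_moments_sum.
Qed.

Lemma le_Rintegral_moments F G : finite_moments F -> finite_moments G ->
  (forall w, F w <= G w) -> \int[P]_w F w <= \int[P]_w G w.
Proof.
move=> /finite_moments_integrable hF /finite_moments_integrable hG FG.
by apply: le_Rintegral => //= w _.
Qed.

End moment_class.

Ltac solve_moments :=
  repeat first
    [ exact: finite_moments_cst | assumption | apply: finite_momentsX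
    | apply: finite_momentsD | apply: finite_momentsN | apply: finite_momentsM
    | (apply: finite_moments_sum => ?) ].

(** * Gaussian integration by parts *)

Section stein.
Context {d : measure_display} {T : measurableType d} {R : realType}
  (P : probability T R).
Implicit Types F D : T -> R.
Local Notation fm := (finite_moments P).

(** All that is needed of a centred Gaussian law is the recursion between its
    moments, which also covers the degenerate case of variance 0. *)
Definition centered_gaussian (z : T -> R) : Prop :=
  [/\ fm z, \int[P]_t z t = 0 &
      forall k, \int[P]_t z t ^+ k.+2 =
        k.+1%:R * \int[P]_t z t ^+ 2 * \int[P]_t z t ^+ k].

(** Closure under combinations is the polarisation device: the one-variable
    moment recursion applied along all lines z + a w determines the mixed
    moments. *)
Definition gaussian_space (G : set (T -> R)) : Prop :=
  (forall z, G z -> centered_gaussian z) /\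
  (forall z w (a : R), G z -> G w -> G (fun t => z t + a * w t)).

(** The expectation of F (z + a w)^k as a polynomial in a; comparing
    coefficients of degree one is the derivative at a = 0 and avoids any
    differentiation under the integral sign. *)
Definition line_poly F (z w : T -> R) k : {poly R} :=
  \poly_(i < k.+1) ('C(k, i)%:R * \int[P]_t (F t * (z t ^+ (k - i) * w t ^+ i))).

Lemma horner_line_poly F (z w : T -> R) k (a : R) : fm F -> fm z -> fm w ->
  (line_poly F z w k).[a] = \int[P]_t (F t * (z t + a * w t) ^+ k).
Proof.
move=> hF hz hw; rewrite /line_poly horner_poly.
transitivity (\int[P]_t (\sum_(i < k.+1)
    ('C(k, i)%:R * a ^+ i) * (F t * (z t ^+ (k - i) * w t ^+ i)))).
  rewrite Rintegral_sum_moments; last by move=> i; solve_moments.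
  apply: eq_bigr => i _; rewrite RintegralMl_moments; last by solve_moments.
  by ring.
apply: eq_Rintegral => t _; rewrite exprDn mulr_sumr; apply: eq_bigr => i _.
by rewrite exprMn -mulr_natl; ring.
Qed.

Lemma horner0_line_poly F z w k :
  (line_poly F z w k).[0] = \int[P]_t (F t * z t ^+ k).
Proof.
rewrite horner_coef0 /line_poly coef_poly /= bin0 mul1r subn0.
by apply: eq_Rintegral => t _; rewrite expr0 mulr1.
Qed.

Lemma deriv0_line_poly F z w k :
  (line_poly F z w k)^`().[0] = k%:R * \int[P]_t (F t * (z t ^+ k.-1 * w t)).
Proof.
rewrite horner_coef0 coef_deriv /line_poly coef_poly mulr1n.
case: k => [|k] /=; first by rewrite mul0r.
by rewrite bin1 subn1 /=; congr (_ * _); apply: eq_Rintegral => t _; rewrite expr1.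
Qed.

Lemma eq_deriv_horner (p q : {poly R}) (x : R) :
  (forall a, p.[a] = q.[a]) -> p^`().[x] = q^`().[x].
Proof.
move=> pq; have : horner p = horner q by apply/funext.
by move=> e; rewrite !derivE e.
Qed.

Variable (G : set (T -> R)).
Hypothesis GG : gaussian_space G.

Let cg z (Gz : G z) : centered_gaussian z. Proof. exact: GG.1. Qed.
Let lin z w (a : R) (Gz : G z) (Gw : G w) : G (fun t => z t + a * w t).
Proof. exact: GG.2. Qed.
Let gm z : G z -> fm z. Proof. by move=> /cg[]. Qed.

(** Polarisation of the moment recursion of z + a y: the coefficient of a on
    both sides gives a recursion for the mixed moments, solved by strong
    induction. *)
Lemma gaussian_mixed_moment y z k : G y -> G z ->
  \int[P]_t (y t * z t ^+ k.+1) =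
  k.+1%:R * \int[P]_t (y t * z t) * \int[P]_t (z t ^+ k).
Proof.
move=> Gy Gz; have my := gm Gy; have mz := gm Gz.
have [_ y0 _] := cg Gy; have [_ z0 zk] := cg Gz.
have m1 : fm (fun=> 1) by exact: finite_moments_cst.
pose p j := line_poly (fun=> 1) z y j.
(* Comparison of the coefficients of degree one of p_(j+2) and (j+1) p_2 p_j. *)
have key j : j.+2%:R * \int[P]_t (y t * z t ^+ j.+1) =
    j.+1%:R * (2 * \int[P]_t (y t * z t) * \int[P]_t (z t ^+ j) +
      \int[P]_t (z t ^+ 2) * (j%:R * \int[P]_t (y t * z t ^+ j.-1))).
  have /(eq_deriv_horner 0) : forall a, (p j.+2).[a] = (j.+1%:R%:P * p 2%N * p j).[a].
    move=> a; have [_ _ h] := cg (lin a Gz Gy).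
    rewrite !hornerM hornerC !horner_line_poly//.
    by rewrite !Rintegral_mul1l; exact: h.
  rewrite !derivM derivC mul0r add0r !hornerD !hornerM !hornerC.
  rewrite !deriv0_line_poly !horner0_line_poly /= => h.
  have e1 i : \int[P]_t (1 * (z t ^+ i * y t)) = \int[P]_t (y t * z t ^+ i).
    by apply: eq_Rintegral => t _; rewrite mul1r mulrC.
  rewrite !e1 !Rintegral_mul1l in h; rewrite h.
  have -> : \int[P]_t (y t * z t ^+ 1) = \int[P]_t (y t * z t) by [].
  ring.
have nz (n : nat) : n.+1%:R != 0 :> R by rewrite pnatr_eq0.
elim/ltn_ind: k => -[|[|k]] ih.
- apply: (mulfI (nz 1%N)); rewrite key.
  have -> : \int[P]_t (z t ^+ 0) = 1.
    by under eq_Rintegral do rewrite expr0; exact: Rintegral_cst_prob.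
  by ring.
- apply: (mulfI (nz 2%N)); rewrite key.
  have -> : \int[P]_t (y t * z t ^+ 1.-1) = 0.
    by under eq_Rintegral do rewrite expr0 mulr1.
  have -> : \int[P]_t (z t ^+ 1) = 0 by under eq_Rintegral do rewrite expr1.
  ring.
- apply: (mulfI (nz k.+3)); rewrite key (ih k)// (zk k).
  by rewrite -[k.+4%:R]natr1 -[k.+3%:R]natr1 -[k.+2%:R]natr1 -[k.+1%:R]natr1; ring.
Qed.

(** The pair (F, D) satisfies the integration by parts formula of Stein for y,
    D playing the role of the derivative of F in the direction of y.  The test
    powers of z are part of the definition to make it stable under
    multiplication of F by a Gaussian variable. *)
Definition stein_pair y F D : Prop :=
  [/\ fm F, fm D & forall z k, G z ->
    \int[P]_t (y t * F t * z t ^+ k) = \int[P]_t (D t * z t ^+ k) +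
      k%:R * \int[P]_t (y t * z t) * \int[P]_t (F t * z t ^+ k.-1)].

Lemma stein_pair1 y : G y -> stein_pair y (fun=> 1) (fun=> 0).
Proof.
move=> Gy; split; try exact: finite_moments_cst.
move=> z k Gz; under eq_Rintegral do rewrite mulr1.
have -> : \int[P]_t (0 * z t ^+ k) = 0.
  by under eq_Rintegral do rewrite mul0r; exact: Rintegral_cst_prob.
rewrite Rintegral_mul1l.
case: k => [|k]; last by rewrite gaussian_mixed_moment// add0r.
rewrite mul0r mul0r addr0; under eq_Rintegral do rewrite expr0 mulr1.
by have [] := cg Gy.
Qed.

(** The product rule: again the coefficient of degree one in the identity along
    the line z + a w. *)
Lemma stein_pairM y F D w : G y -> G w -> stein_pair y F D ->
  stein_pair y (fun t => F t * w t)
    (fun t => D t * w t + \int[P]_t (y t * w t) * F t).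
Proof.
move=> Gy Gw [mF mD h]; have my := gm Gy; have mw := gm Gw.
split; [by solve_moments|by solve_moments|move=> z k Gz; have mz := gm Gz].
set c := \int[P]_t (y t * w t).
have m2 : fm (fun t => y t * F t) by solve_moments.
(* The covariance of y with z + a w, as a polynomial in a. *)
pose q : {poly R} := (\int[P]_t (y t * z t))%:P + c%:P * 'X.
have /(eq_deriv_horner 0) : forall a, (line_poly (fun t => y t * F t) z w k.+1).[a] =
    (line_poly D z w k.+1 + k.+1%:R%:P * q * line_poly F z w k).[a].
  move=> a; rewrite hornerD 2!hornerM !horner_line_poly// hornerC /q hornerD hornerM !hornerC hornerX.
  rewrite (h _ _ (lin a Gz Gw)) /=; congr (_ + _ * _ * _).
  rewrite mulrC /c -RintegralMl_moments -?RintegralD_moments; try by solve_moments.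
  by apply: eq_Rintegral => t _; ring.
rewrite derivD !derivM derivC mul0r add0r /q derivD derivC add0r derivM derivC derivX.
rewrite !(hornerD, hornerM, hornerC, hornerX) !deriv0_line_poly !horner0_line_poly /=.
rewrite !mulr0 ?addr0 ?add0r mulr1 => e.
have nz : k.+1%:R != 0 :> R by rewrite pnatr_eq0.
apply: (mulfI nz).
have -> : \int[P]_t (y t * (F t * w t) * z t ^+ k) =
  \int[P]_t (y t * F t * (z t ^+ k * w t)) by apply: eq_Rintegral => t _; ring.
rewrite e.
have -> : \int[P]_t ((D t * w t + c * F t) * z t ^+ k) =
   \int[P]_t (D t * (z t ^+ k * w t)) + c * \int[P]_t (F t * z t ^+ k).
  rewrite -RintegralMl_moments -?RintegralD_moments; try by solve_moments.
  by apply: eq_Rintegral => t _; ring.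
have -> : \int[P]_t (F t * w t * z t ^+ k.-1) = \int[P]_t (F t * (z t ^+ k.-1 * w t)).
  by apply: eq_Rintegral => t _; ring.
by ring.
Qed.

Lemma stein_pairD y F1 D1 F2 D2 : G y -> stein_pair y F1 D1 -> stein_pair y F2 D2 ->
  stein_pair y (fun t => F1 t + F2 t) (fun t => D1 t + D2 t).
Proof.
move=> Gy [mF1 mD1 h1] [mF2 mD2 h2]; have my := gm Gy.
split; [by solve_moments|by solve_moments|move=> z k Gz; have mz := gm Gz].
transitivity (\int[P]_t (y t * F1 t * z t ^+ k) + \int[P]_t (y t * F2 t * z t ^+ k)).
  rewrite -RintegralD_moments; try by solve_moments.
  by apply: eq_Rintegral => t _; ring.
rewrite h1// h2//.
have e (A B : T -> R) j : fm A -> fm B -> \int[P]_t ((A t + B t) * z t ^+ j) =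
    \int[P]_t (A t * z t ^+ j) + \int[P]_t (B t * z t ^+ j).
  move=> mA mB; rewrite -RintegralD_moments; try by solve_moments.
  by apply: eq_Rintegral => t _; ring.
by rewrite !e//; ring.
Qed.

Lemma stein_pairZ y F D a : G y -> stein_pair y F D ->
  stein_pair y (fun t => a * F t) (fun t => a * D t).
Proof.
move=> Gy [mF mD h]; have my := gm Gy.
split; [by solve_moments|by solve_moments|move=> z k Gz; have mz := gm Gz].
have e (A : T -> R) j : fm A -> \int[P]_t (a * A t * z t ^+ j) =
    a * \int[P]_t (A t * z t ^+ j).
  move=> mA; rewrite -RintegralMl_moments; try by solve_moments.
  by apply: eq_Rintegral => t _; ring.
rewrite !e// -[LHS](_ : a * \int[P]_t (y t * F t * z t ^+ k) = _); last first.
  rewrite -RintegralMl_moments; try by solve_moments.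
  by apply: eq_Rintegral => t _; ring.
by rewrite h//; ring.
Qed.

(** Multiplication by a quadratic form, whose derivative in the direction of y
    is twice the sum of Cov(y, Y_i) Y_i. *)
Lemma stein_pair_sumM (I : Type) (r : seq I) (Y : I -> T -> R) y F D :
  G y -> (forall i, G (Y i)) -> stein_pair y F D ->
  stein_pair y (fun t => F t * \sum_(i <- r) Y i t ^+ 2)
    (fun t => D t * (\sum_(i <- r) Y i t ^+ 2) +
       2 * F t * \sum_(i <- r) \int[P]_t (y t * Y i t) * Y i t).
Proof.
move=> Gy GY h; elim: r => [|i r ih].
  have e1 : (fun t => F t * \sum_(i <- [::]) Y i t ^+ 2) = (fun t => 0 * F t).
    by apply/funext => t; rewrite big_nil; ring.
  have e2 : (fun t => D t * (\sum_(i <- [::]) Y i t ^+ 2) +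
      2 * F t * \sum_(i <- [::]) \int[P]_t (y t * Y i t) * Y i t) = (fun t => 0 * D t).
    by apply/funext => t; rewrite !big_nil; ring.
  by rewrite e1 e2; exact: stein_pairZ.
have h2 := stein_pairD Gy (stein_pairM Gy (GY i) (stein_pairM Gy (GY i) h)) ih.
move: h2; congr stein_pair; apply/funext => t; rewrite !big_cons; ring.
Qed.

Lemma stein_pairX (I : Type) (r : seq I) (Y : I -> T -> R) (c : R) y p :
  G y -> (forall i, G (Y i)) ->
  stein_pair y (fun t => (\sum_(i <- r) Y i t ^+ 2 - c) ^+ p)
    (fun t => 2 * p%:R * (\sum_(i <- r) Y i t ^+ 2 - c) ^+ p.-1 *
       \sum_(i <- r) \int[P]_t (y t * Y i t) * Y i t).
Proof.
move=> Gy GY; elim: p => [|p ih].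
  move: (stein_pair1 Gy); congr stein_pair; apply/funext => t; by ring.
have h := stein_pairD Gy (stein_pair_sumM r Gy GY ih) (stein_pairZ (- c) Gy ih).
move: h; congr stein_pair; apply/funext => t; first by rewrite exprS; ring.
case: p {ih} => [|p] /=; first by ring.
by rewrite -[p.+2%:R]natr1 exprS; ring.
Qed.

Definition sum_sqr (I : Type) (r : seq I) (Y : I -> T -> R) (t : T) : R :=
  \sum_(i <- r) Y i t ^+ 2.

(** With V the sum of squares, integrate by parts in each factor Y_i of
    Y_i (Y_i (V - E V)^p): the derivative of the first factor gives E Y_i^2,
    which the centring cancels, and that of the power gives the quadratic form
    of the covariance matrix. *)
Lemma gaussian_quadratic_recursion (I : Type) (r : seq I) (Y : I -> T -> R) p :
  (forall i, G (Y i)) ->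
  \int[P]_t ((sum_sqr r Y t - \int[P]_t' sum_sqr r Y t') ^+ p.+1) =
  2 * p%:R * \int[P]_t ((sum_sqr r Y t - \int[P]_t' sum_sqr r Y t') ^+ p.-1 *
    \sum_(i <- r) \sum_(j <- r) \int[P]_t (Y i t * Y j t) * (Y i t * Y j t)).
Proof.
move=> GY; set V := sum_sqr r Y; set c := \int[P]_t V t; have mY i : fm (Y i) by exact: gm.
have mV : fm V by rewrite /V /sum_sqr; solve_moments.
have mVc k : fm (fun t => (V t - c) ^+ k) by solve_moments.
have key i : \int[P]_t (Y i t ^+ 2 * (V t - c) ^+ p) =
    2 * p%:R * \int[P]_t ((V t - c) ^+ p.-1 *
      \sum_(j <- r) \int[P]_t (Y i t * Y j t) * (Y i t * Y j t)) +
    \int[P]_t (Y i t ^+ 2) * \int[P]_t ((V t - c) ^+ p).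
  have [_ _ h] := stein_pairM (GY i) (GY i) (stein_pairX r c p (GY i) GY).
  have := h _ 0%N (GY i); rewrite !mul0r addr0 => {}h.
  transitivity (\int[P]_t (Y i t * ((V t - c) ^+ p * Y i t) * Y i t ^+ 0)).
    by apply: eq_Rintegral => t _; ring.
  rewrite h -!RintegralMl_moments -?RintegralD_moments; try by solve_moments.
    apply: eq_Rintegral => t _; rewrite -/(V t) expr0 mulr1 mulrC; congr (_ + _).
      have -> : \sum_(j <- r) \int[P]_t0 (Y i t0 * Y j t0) * (Y i t * Y j t) =
          (\sum_(j <- r) \int[P]_t0 (Y i t0 * Y j t0) * Y j t) * Y i t.
        by rewrite mulr_suml; apply: eq_bigr => j _; ring.
      by ring.
transitivity (\sum_(i <- r) \int[P]_t (Y i t ^+ 2 * (V t - c) ^+ p)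
              - c * \int[P]_t ((V t - c) ^+ p)).
  rewrite -Rintegral_sum_moments; last by move=> i; solve_moments.
  rewrite -RintegralMl_moments// -RintegralB_moments; try by solve_moments.
  by apply: eq_Rintegral => t _; rewrite exprS mulrBl /V /sum_sqr mulr_suml.
under eq_bigr do rewrite key.
rewrite big_split /= -mulr_suml -mulr_sumr /c.
rewrite -(@Rintegral_sum_moments _ _ _ P I r (fun i t => Y i t ^+ 2)); last by move=> i; solve_moments.
rewrite -/V addrK; congr (_ * _).
rewrite -Rintegral_sum_moments; last by move=> i; solve_moments.
by apply: eq_Rintegral => t _; rewrite mulr_sumr.
Qed.

(** The quadratic form of a symmetric matrix is bounded by its largest absolute
    row sum (Schur test, from 2 |xy| <= x^2 + y^2). *)
Lemma gaussian_quadratic_moment_step (I : Type) (r : seq I) (Y : I -> T -> R) (rho : R) p :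
  (forall i, G (Y i)) ->
  (forall i, \sum_(j <- r) `|\int[P]_t (Y i t * Y j t)| <= rho) ->
  \int[P]_t ((sum_sqr r Y t - \int[P]_t' sum_sqr r Y t') ^+ p.*2.+2) <=
  2 * p.*2.+1%:R * rho *
  \int[P]_t ((sum_sqr r Y t - \int[P]_t' sum_sqr r Y t') ^+ p.*2 * sum_sqr r Y t).
Proof.
move=> GY hrho; set V := sum_sqr r Y; set c := \int[P]_t V t; have mY i : fm (Y i) by exact: gm.
have mV : fm V by rewrite /V /sum_sqr; solve_moments.
rewrite (gaussian_quadratic_recursion r p.*2.+1 GY) -/V -/c /= -[leRHS]mulrA ler_wpM2l//.
rewrite -RintegralMl_moments; last by solve_moments.
apply: le_Rintegral_moments; try by solve_moments.
move=> t; rewrite mulrCA ler_wpM2l//; first by rewrite -mul2n exprM exprn_ge0 ?sqr_ge0.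
pose C i j : R := `|\int[P]_t (Y i t * Y j t)|.
have Csym i j : C i j = C j i.
  by rewrite /C; congr `|_|; apply: eq_Rintegral => t' _; rewrite mulrC.
apply: (@le_trans _ _ (\sum_(i <- r) \sum_(j <- r) (C i j * (Y i t ^+ 2 / 2) + C j i * (Y j t ^+ 2 / 2)))).
  apply: ler_sum => i _; apply: ler_sum => j _; rewrite (Csym j i) -mulrDr.
  apply: le_trans (ler_norm _) _; rewrite normrM -/(C i j).
  rewrite ler_wpM2l ?normr_ge0// normrM.
  rewrite -(real_normK (num_real (Y i t))) -(real_normK (num_real (Y j t))).
  by have := sqr_ge0 (`|Y i t| - `|Y j t|); nra.
under eq_bigr do rewrite big_split /=.
rewrite big_split /= [X in _ + X]exchange_big /= -mulr2n -[leLHS]mulr_natl.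
have -> : \sum_(i <- r) \sum_(j <- r) C i j * (Y i t ^+ 2 / 2) =
    \sum_(i <- r) (\sum_(j <- r) C i j) * (Y i t ^+ 2 / 2).
  by apply: eq_bigr => i _; rewrite mulr_suml.
rewrite /V /sum_sqr !mulr_sumr; apply: ler_sum => i _.
have := hrho i; rewrite -/(C i _); have := sqr_ge0 (Y i t).
by rewrite -/(C i _); set s := \sum_(j <- r) _; nra.
Qed.

End stein.

(** * Almost sure convergence from moment bounds *)

Section almost_sure.
Context {d : measure_display} {T : measurableType d} {R : realType}
  (P : probability T R).
Local Notation fm := (finite_moments P).

(** Telescoping comparison of 1/n^2 with 1/(n - 1) - 1/n. *)
Lemma sum_inverse_squares_le (N : nat) :
  \sum_(0 <= n < N) (n.+1%:R ^+ 2)^-1 <= 2 :> R.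
Proof.
suff : \sum_(0 <= n < N.+1) (n.+1%:R ^+ 2)^-1 <= 2 - N.+1%:R^-1 :> R.
  rewrite big_nat_recr//= => h.
  have h1 : 0 <= (N.+1%:R ^+ 2)^-1 :> R by rewrite invr_ge0 exprn_ge0.
  have h2 : 0 <= N.+1%:R^-1 :> R by rewrite invr_ge0.
  move: h h1 h2; move: (N.+1%:R ^- 2) (N.+1%:R^-1) => a b.
  by move: (\sum_(0 <= i < N) _) => s; lra.
elim: N => [|N ih]; first by rewrite big_nat1 expr1n invr1; lra.
rewrite big_nat_recr//=; apply: le_trans (lerD ih (lexx _)) _.
have n0 : 0 < N.+1%:R :> R by rewrite ltr0n.
rewrite -[N.+2%:R]natr1; set x := N.+1%:R in n0 *.
have -> : 2 - x^-1 + ((x + 1) ^+ 2)^-1 = 2 - (x + 1)^-1 - (x * (x + 1) ^+ 2)^-1.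
  by field; rewrite !gt_eqF// addr_gt0.
by rewrite gerBl invr_ge0 mulr_ge0 ?exprn_ge0 ?addr_ge0 ?ltW.
Qed.

(** By monotone convergence the series of the g_n is integrable, hence almost
    surely finite, and the terms of a convergent series tend to 0. *)
Lemma ae_cvg0_of_summable_integrals (g : nat -> T -> R) (B : R) :
  (forall n, fm (g n)) -> (forall n t, 0 <= g n t) ->
  (forall n, \int[P]_t g n t <= B / n.+1%:R ^+ 2) ->
  {ae P, forall t, g n t @[n --> \oo] --> 0}.
Proof.
move=> mg g0 gB.
have B0 : 0 <= B.
  have := gB 0%N; rewrite expr1n divr1; apply: le_trans; exact: Rintegral_ge0.
have mge n : measurable_fun setT (fun t => (g n t)%:E).
  by apply/measurable_EFinP; case: (mg n).
pose S t := (\sum_(0 <= n <oo) (g n t)%:E)%E.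
have S0 t : (0 <= S t)%E by apply: nneseries_ge0 => n _; rewrite lee_fin.
have mS : measurable_fun setT S.
  by apply: ge0_emeasurable_sum => // n t _ _; rewrite lee_fin.
have iS : P.-integrable setT S.
  apply/integrableP; split => //.
  under eq_integral do rewrite gee0_abs//.
  rewrite /S integral_nneseries//; last by move=> n t _; rewrite lee_fin.
  apply: (@le_lt_trans _ _ (B * 2)%:E); last exact: ltry.
  apply: lime_le.
    by apply: is_cvg_nneseries => n _ _; apply: integral_ge0 => t _; rewrite lee_fin.
  apply: nearW => N.
  apply: (@le_trans _ _ (\sum_(0 <= n < N) (B / n.+1%:R ^+ 2)%:E)%E).
    apply: lee_sum => n _.
    rewrite -[leLHS]fineK; last exact/integrable_fin_num/finite_moments_integrable.
    by rewrite lee_fin; exact: gB.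
  rewrite sumEFin lee_fin -mulr_sumr ler_wpM2l//; exact: sum_inverse_squares_le.
have := integrable_ae measurableT iS; apply: filterS => t /(_ I) St.
apply: cvg_series_cvg_0; apply: nondecreasing_is_cvgn.
  apply/nondecreasing_seqP => n; rewrite /series /= big_nat_recr//= lerDl; exact: g0.
exists (fine (S t)) => _ [N _ <-].
rewrite -lee_fin fineK// /series /= -sumEFin.
by apply: nneseries_lim_ge => k _; rewrite lee_fin.
Qed.

Lemma ae_cvg0_of_moments (W : nat -> T -> R) (B : R) (k N : nat) :
  (0 < k)%N -> (forall n, fm (W n)) ->
  (forall n, (N <= n)%N -> \int[P]_t (W n t ^+ k.*2) <= B / n%:R ^+ 2) ->
  {ae P, forall t, W n t @[n --> \oo] --> 0}.
Proof.
move=> k0 mW hB.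
have e2 (x : R) : x ^+ k.*2 = (x ^+ 2) ^+ k by rewrite -exprM mul2n.
have := @ae_cvg0_of_summable_integrals (fun n t => W (n + N.+1)%N t ^+ k.*2) B.
move=> /(_ _ _ _)/wrap[].
- by move=> n; exact: finite_momentsX.
- by move=> n t; rewrite e2 exprn_ge0// sqr_ge0.
- move=> n; apply: le_trans (hB _ _) _; first by rewrite addnS ltnW// ltnS leq_addl.
  have B0 : 0 <= B.
    have := hB (maxn N 1)%N (leq_maxl _ _).
    have m0 : 0 < (maxn N 1)%:R ^+ 2 :> R by rewrite exprn_gt0// ltr0n leq_max orbT.
    move=> h; have : 0 <= B / (maxn N 1)%:R ^+ 2.
      by apply: le_trans h; apply: Rintegral_ge0 => t _; rewrite e2 exprn_ge0// sqr_ge0.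
    by rewrite pmulr_lge0// invr_gt0.
  rewrite ler_wpM2l// lef_pV2 ?posrE ?exprn_gt0 ?ltr0n ?addnS//.
  by rewrite lerXn2r ?nnegrE// ler_nat ltnS leq_addr.
apply: filterS => t /cvgrPdist_lt h.
rewrite -(cvg_shiftn N.+1); apply/cvgrPdist_lt => e e0.
have ek0 : 0 < e ^+ k.*2 by rewrite exprn_gt0.
move: (h _ ek0); apply: filterS => n.
rewrite !sub0r !normrN normrX ltr_pXn2r ?nnegrE ?double_gt0// ?normr_ge0//; exact: ltW.
Qed.

Variable (G : set (T -> R)).
Hypothesis GG : gaussian_space P G.

(** Induction on the order with the recursion above.  There V = (V - c) + c
    raises the order by one, and the bound
    V <= (V - c)^2 / (2 c) + 3 c / 2 moves the excess to the left-hand side,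
    where it is absorbed when rho is small compared with c. *)
Lemma gaussian_quadratic_moment_bound (I : Type) (r : seq I) (Y : I -> T -> R)
    (rho : R) k :
  (forall i, G (Y i)) ->
  (forall i, \sum_(j <- r) `|\int[P]_t (Y i t * Y j t)| <= rho) ->
  0 <= rho -> 0 < \int[P]_t sum_sqr r Y t ->
  2 * k.*2.+1%:R * rho <= \int[P]_t sum_sqr r Y t ->
  \int[P]_t ((sum_sqr r Y t - \int[P]_t' sum_sqr r Y t') ^+ k.*2) <=
  (6 * k.*2.+1%:R * rho * \int[P]_t sum_sqr r Y t) ^+ k.
Proof.
move=> GY hrho rho0; set V := sum_sqr r Y; set c := \int[P]_t V t => c0 hk.
have mY i : fm (Y i) by case: (GG.1 (Y i) (GY i)).
have mV : fm V by rewrite /V /sum_sqr; solve_moments.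
pose a j := \int[P]_t ((V t - c) ^+ j.*2).
set K : R := 6 * k.*2.+1%:R * rho * c.
have K0 : 0 <= K by rewrite !mulr_ge0// ltW.
have sq (x : R) j : 0 <= x ^+ j.*2 by rewrite -mul2n exprM exprn_ge0// sqr_ge0.
suff : forall j, (j <= k)%N -> a j <= K ^+ j by move=> /(_ k (leqnn _)).
elim=> [|j ih] jk.
  by rewrite /a expr0; under eq_Rintegral do rewrite expr0; rewrite Rintegral_cst_prob.
have aj0 : 0 <= a j by apply: Rintegral_ge0 => t _.
have step := @gaussian_quadratic_moment_step _ _ _ P G GG I r Y rho j GY hrho.
rewrite -/V -/c in step.
(* The inequality V <= (V - c)^2 / (2c) + 3c/2 is (V - 2c)^2 >= 0. *)
have amgm : \int[P]_t ((V t - c) ^+ j.*2 * V t) <= a j.+1 / (2 * c) + 3 / 2 * c * a j.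
  apply: (@le_trans _ _ (\int[P]_t ((2 * c)^-1 * (V t - c) ^+ j.+1.*2 +
      3 / 2 * c * (V t - c) ^+ j.*2))).
    apply: le_Rintegral_moments; [by solve_moments|by solve_moments|].
    move=> t; have := sq (V t - c) j; set u := _ ^+ j.*2 => u0.
    have -> : (V t - c) ^+ j.+1.*2 = u * (V t - c) ^+ 2 by rewrite -exprD addn2.
    set x := V t - c; have -> : V t = x + c by rewrite /x subrK.
    have -> : (2 * c)^-1 * (u * x ^+ 2) + 3 / 2 * c * u =
       u * (x + c) + u * ((2 * c)^-1 * (x - c) ^+ 2).
      by field; rewrite gt_eqF.
    have ic : 0 <= (2 * c)^-1 by rewrite invr_ge0; lra.
    by rewrite lerDl; apply: mulr_ge0 => //; apply: mulr_ge0 => //; exact: sqr_ge0.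
  rewrite RintegralD_moments ?RintegralMl_moments; try by solve_moments.
  by rewrite mulrC.
have jk1 : j.*2.+1%:R <= k.*2.+1%:R :> R by rewrite ler_nat ltnS leq_double ltnW.
have jj0 : 0 <= j.*2.+1%:R :> R by [].
have qr0 : 0 <= 2 * j.*2.+1%:R * rho by rewrite !mulr_ge0.
have {}step := le_trans step (ler_wpM2l qr0 amgm).
rewrite -[X in X <= _]/(a j.+1) in step.
have ak0 : 0 <= a j.+1 by apply: Rintegral_ge0 => t _.
set q : R := j.*2.+1%:R in jk1 jj0 step; set Q : R := k.*2.+1%:R in jk1 hk K K0 ih *.
have h1 : q * rho <= c / 2.
  have : q * rho <= Q * rho by rewrite ler_wpM2r.
  by move: hk; rewrite -mulrA; lra.
have e1 : 2 * q * rho * (a j.+1 / (2 * c) + 3 / 2 * c * a j) =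
    q * rho / c * a j.+1 + 3 * (q * rho) * c * a j by field; rewrite gt_eqF.
rewrite e1 in step.
have h2 : q * rho / c * a j.+1 <= 1 / 2 * a j.+1.
  rewrite ler_wpM2r// ler_pdivrMr//; lra.
have h3 : a j.+1 <= 6 * (q * rho) * c * a j by lra.
apply: le_trans h3 _; rewrite exprS.
apply: ler_pM => //; last exact: ih (ltnW jk).
  by rewrite !mulr_ge0// ltW.
rewrite /K -[X in _ <= X * c]mulrA; apply: ler_wpM2r; first exact: ltW.
by apply: ler_wpM2l => //; apply: ler_wpM2r.
Qed.

End almost_sure.

(** * Quadratic variations of Gaussian arrays *)

Section quadratic_variation_ae.
Context {d : measure_display} {T : measurableType d} {R : realType}
  (P : probability T R) (G : set (T -> R)).
Hypothesis GG : gaussian_space P G.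

Lemma powR_nat_decay (kappa e : R) : 0 < kappa -> 0 < e ->
  \forall n \near \oo, n%:R `^ (- kappa) < e :> R.
Proof.
move=> k0 e0; near=> n.
have n0 : 0 < n%:R :> R by rewrite ltr0n; near: n; exact: nbhs_infty_gt.
have hn : (e^-1) `^ (kappa^-1) < n%:R by near: n; exact: nbhs_infty_gtr.
rewrite powRN invf_plt ?posrE ?powR_gt0//.
have := @gt0_ltr_powR R kappa k0 _ _ _ _ hn.
rewrite -powRrM mulVf ?gt_eqF// powRr1 ?invr_ge0 ?ltW//.
by apply; rewrite nnegrE ?powR_ge0 ?ltW.
Unshelve. all: end_near. Qed.

(** The moment of order 2k of V / E V - 1 is at most a constant times the k-th
    power of rho / E V; with k kappa >= 2 it is summable over n. *)
Lemma quadratic_variation_ae_cvg (I : Type) (r : nat -> seq I) (Y : nat -> I -> T -> R)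
    (rho : nat -> R) (A kappa : R) :
  (forall n i, G (Y n i)) ->
  0 < A -> 0 < kappa ->
  (\forall n \near \oo,
     [/\ 0 < \int[P]_t sum_sqr (r n) (Y n) t, 0 <= rho n,
        forall i, \sum_(j <- r n) `|\int[P]_t (Y n i t * Y n j t)| <= rho n &
        rho n <= A * n%:R `^ (- kappa) * \int[P]_t sum_sqr (r n) (Y n) t]) ->
  {ae P, forall t, sum_sqr (r n) (Y n) t / \int[P]_t' sum_sqr (r n) (Y n) t'
                     @[n --> \oo] --> (1 : R)}.
Proof.
move=> GY A0 k0 H.
pose c n := \int[P]_t sum_sqr (r n) (Y n) t.
pose W n t := (c n)^-1 * (sum_sqr (r n) (Y n) t - c n).
have [k kk] : exists k : nat, 2 <= k%:R * kappa.
  exists (Num.truncn (2 / kappa)).+1; rewrite -ler_pdivrMr//.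
  by rewrite ltW// truncnS_gt.
have kpos : (0 < k)%N by case: k kk => //; rewrite mul0r; lra.
have mW n : finite_moments P (W n).
  have mY i : finite_moments P (Y n i) by case: (GG.1 (Y n i) (GY n i)).
  by rewrite /W /sum_sqr; solve_moments.
(* Here 6 (2k + 1) is the constant of the moment bound. *)
pose K : R := 6 * k.*2.+1%:R * A.
have K0 : 0 < K by rewrite !mulr_gt0.
have small : \forall n \near \oo, n%:R `^ (- kappa) < (2 * k.*2.+1%:R * A)^-1 :> R.
  by apply: powR_nat_decay => //; rewrite invr_gt0 !mulr_gt0.
have [N _ hN] : \forall n \near \oo, \int[P]_t (W n t ^+ k.*2) <= K ^+ k / n%:R ^+ 2.
  near=> n.
  have [cn rn hr rc] : [/\ 0 < c n, 0 <= rho n,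
        forall i, \sum_(j <- r n) `|\int[P]_t (Y n i t * Y n j t)| <= rho n &
        rho n <= A * n%:R `^ (- kappa) * c n] by near: n.
  have sn : n%:R `^ (- kappa) < (2 * k.*2.+1%:R * A)^-1 :> R by near: n.
  have n1 : 1 <= n%:R :> R by near: n; exact: nbhs_infty_ger.
  have n0 : 0 < n%:R :> R by lra.
  set x := n%:R `^ (- kappa) in rc sn.
  have x0 : 0 < x by rewrite powR_gt0.
  have Q0 : 0 < k.*2.+1%:R :> R by [].
  have h1 : 2 * k.*2.+1%:R * rho n <= c n.
    apply: (@le_trans _ _ (2 * k.*2.+1%:R * (A * x * c n))).
      by rewrite ler_wpM2l// mulr_ge0.
    have : x * (2 * k.*2.+1%:R * A) <= 1.
      by rewrite -ler_pdivlMr ?mulr_gt0// div1r ltW.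
    move=> h; have := ler_wpM2r (ltW cn) h; rewrite mul1r; apply: le_trans.
    by rewrite le_eqVlt; apply/orP; left; apply/eqP; ring.
  have := gaussian_quadratic_moment_bound GG (k := k) (GY n) hr rn cn h1.
  rewrite -/(c n) => hm.
  have -> : \int[P]_t (W n t ^+ k.*2) =
      (c n) ^- k.*2 * \int[P]_t ((sum_sqr (r n) (Y n) t - c n) ^+ k.*2).
    have mY i : finite_moments P (Y n i) by case: (GG.1 (Y n i) (GY n i)).
    rewrite -RintegralMl_moments; last by rewrite /sum_sqr; solve_moments.
    by apply: eq_Rintegral => t _; rewrite /W exprMn exprVn.
  apply: (@le_trans _ _ ((K * x) ^+ k)).
    rewrite ler_pdivrMl ?exprn_gt0//; apply: le_trans hm _.
    have -> : c n ^+ k.*2 = (c n ^+ 2) ^+ k by rewrite -exprM mul2n.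
    rewrite -exprMn lerXn2r ?nnegrE//.
    - by rewrite !mulr_ge0// ltW.
    - by rewrite mulr_ge0 ?exprn_ge0 ?mulr_ge0 ?ltW.
    - have := ler_wpM2l (mulr_ge0 (mulr_ge0 (ler0n R 6) (ltW Q0)) (ltW cn)) rc.
      have -> : 6 * k.*2.+1%:R * rho n * c n = 6 * k.*2.+1%:R * c n * rho n by ring.
      by have -> : c n ^+ 2 * (K * x) = 6 * k.*2.+1%:R * c n * (A * x * c n)
        by rewrite /K; ring.
  rewrite exprMn ler_wpM2l ?exprn_ge0 ?(ltW K0)//.
  rewrite /x -powR_mulrn ?powR_ge0// -powRrM mulNr powRN lef_pV2 ?posrE ?powR_gt0 ?exprn_gt0//.
  rewrite -powR_mulrn ?ler0n//; apply: ler_powR => //.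
  by rewrite mulrC.
have := ae_cvg0_of_moments kpos mW (N := N) (B := K ^+ k) hN.
apply: filterS => t W0.
have : W n t + 1 @[n --> \oo] --> 0 + (1 : R) by apply: cvgD => //; exact: cvg_cst.
rewrite add0r; apply: cvg_trans; apply: near_eq_cvg; near=> n.
have [cn _ _ _] : [/\ 0 < c n, 0 <= rho n,
        forall i, \sum_(j <- r n) `|\int[P]_t (Y n i t * Y n j t)| <= rho n &
        rho n <= A * n%:R `^ (- kappa) * c n] by near: n.
by rewrite /W -/(c n); field; rewrite gt_eqF.
Unshelve. all: end_near. Qed.

End quadratic_variation_ae.

(** * Gaussian laws and increments of a Gaussian field *)

Section gaussian_law_moments.
Context {d : measure_display} {T : measurableType d} {R : realType}
  (P : probability T R).

(** Moments depend on the law only, through the image measure. *)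
Lemma transfer_moments (nu : probability (measurableTypeR R) R) (Y : T -> R) (m : R) :
  measurable_fun setT Y ->
  (forall A : set R, measurable A -> P (Y @^-1` A) = nu A) ->
  (forall k, nu.-integrable setT (fun x : R => ((x - m) ^+ k)%:E)) ->
  finite_moments P Y /\
  forall k, \int[P]_t ((Y t - m) ^+ k) = fine (\int[nu]_x ((x - m) ^+ k)%:E).
Proof.
move=> mY PY inu.
have mpow k : measurable_fun setT (fun x : R => (x - m) ^+ k).
  by apply: measurable_funX; exact: measurable_funB.
pose Ym : {mfun T >-> measurableTypeR R} :=
  MeasurableFun.Pack (MeasurableFun.Class (isMeasurableFun.Build _ _ T (measurableTypeR R) Y mY)).
have ige (f : R -> \bar R) : measurable_fun setT f -> (forall x, (0 <= f x)%E) ->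
    (\int[P]_t f (Y t) = \int[nu]_x f x)%E.
  move=> mf f0; rewrite -(@eq_measure_integral _ _ R setT nu (distribution P Ym)).
    by rewrite ge0_integral_distribution.
  by move=> A mA _; exact: PY.
have fY : finite_moments P (fun t => Y t - m).
  split; first exact: measurable_funB.
  move=> k; apply/integrableP; split.
    apply/measurable_EFinP; apply: measurable_funX; apply: measurableT_comp => //.
    exact: measurable_funB.
  rewrite (ige (fun x : R => `|(`|x - m| ^+ k)%:E|%E)) //; last first.
    apply: measurableT_comp => //; apply/measurable_EFinP; apply: measurable_funX.
    by apply: measurableT_comp => //; exact: measurable_funB.
  have /integrableP[_] := inu k; apply: le_lt_trans.
  rewrite le_eqVlt; apply/orP; left; apply/eqP; apply: eq_integral => x _.
  by rewrite !abse_EFin !normrX normr_id.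
split.
  have -> : Y = (fun t => (Y t - m) + m) by apply/funext => t; rewrite subrK.
  by apply: finite_momentsD => //; exact: finite_moments_cst.
move=> k; congr fine.
rewrite -(@eq_measure_integral _ _ R setT nu (distribution P Ym)); last first.
  by move=> A mA _; exact: PY.
rewrite integral_distribution//.
  by apply/measurable_EFinP; exact: mpow.
by apply: finite_moments_integrable; exact: finite_momentsX.
Qed.

(** Both the Dirac mass and the normal law satisfy the recursion of
    [centered_gaussian] around their mean. *)
Lemma gaussian_law_moments (Y : T -> R) :
  measurable_fun setT Y -> gaussian_law (P := P) Y ->
  exists m s : R, [/\ finite_moments P Y, \int[P]_t Y t = m &
    forall k, \int[P]_t ((Y t - m) ^+ k.+2) =
      k.+1%:R * s ^+ 2 * \int[P]_t ((Y t - m) ^+ k)].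
Proof.
move=> mY [m [s h]]; exists m, s.
have mpow k : measurable_fun setT (fun x : R => (x - m) ^+ k).
  by apply: measurable_funX; exact: measurable_funB.
have mEpow k : measurable_fun setT (fun x : R => ((x - m) ^+ k)%:E).
  exact/measurable_EFinP.
suff [nu [PY inu m1 mk]] : exists nu : probability (measurableTypeR R) R,
  [/\ forall A : set R, measurable A -> P (Y @^-1` A) = nu A,
     forall k, nu.-integrable setT (fun x : R => ((x - m) ^+ k)%:E),
     (\int[nu]_x ((x - m) ^+ 1)%:E = 0)%E &
     forall k, fine (\int[nu]_x ((x - m) ^+ k.+2)%:E) =
       k.+1%:R * s ^+ 2 * fine (\int[nu]_x ((x - m) ^+ k)%:E)].
  have [fY mom] := transfer_moments mY PY inu.
  split => //; last by move=> k; rewrite !mom mk.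
  have := mom 1%N; rewrite m1 /=.
  under eq_Rintegral do rewrite expr1.
  rewrite RintegralB_moments//; last exact: finite_moments_cst.
  by rewrite Rintegral_cst_prob => /eqP; rewrite subr_eq0 => /eqP.
have [s0|s0] := eqVneq s 0.
  have dE k : (\int[@dirac _ (measurableTypeR R) m R]_x ((x - m) ^+ k.+1)%:E = 0)%E.
    rewrite integral_dirac//; last exact: mEpow.
    by rewrite diracT mul1e subrr exprS mul0r.
  exists (@dirac _ (measurableTypeR R) m R); split => //.
  - by move=> A mA; rewrite h// s0 eqxx.
  - move=> k; apply/integrableP; split; first exact: mEpow.
    rewrite integral_dirac//=; last first.
      by apply/measurable_EFinP; apply: measurableT_comp => //; exact: mpow.
    by rewrite diracT mul1e ltry.
  - by move=> k; rewrite dE s0 expr0n /= mulr0 mul0r.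
have ileb := @integrable_power_normal R m s ^~ s0.
have inu k : (normal_prob m s).-integrable setT (fun x : R => ((x - m) ^+ k)%:E).
  apply/integrableP; split; first exact: mEpow.
  under eq_integral do rewrite abse_EFin.
  rewrite ge0_integral_normal_prob//; last exact: measurableT_comp.
  have /integrableP[_] := ileb k.
  apply: le_lt_trans; apply: ge0_le_integral => //.
  - by move=> x _; rewrite lee_fin mulr_ge0// normal_pdf_ge0.
  - apply/measurable_EFinP; apply: measurable_funM; last exact: measurable_normal_pdf.
    by apply: measurableT_comp => //; exact: mpow.
  - apply: measurableT_comp => //; apply/measurable_EFinP; apply: measurable_funM.
      exact: mpow.
    exact: measurable_normal_pdf.
  - by move=> x _; rewrite abse_EFin normrM lee_fin [X in _ <= _ * X]ger0_norm// normal_pdf_ge0.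
exists (normal_prob m s); split => //.
- by move=> A mA; rewrite h// (negbTE s0).
- rewrite integral_normal_prob; last exact: (inu 1%N).
  by rewrite (normal_moment_recursion m 0 s0) mul0r mul0e.
- move=> k; rewrite !integral_normal_prob; [|exact: inu|exact: inu].
  rewrite (normal_moment_recursion m k.+1 s0) fineM//=.
  exact: integrable_fin_num (ileb k).
Qed.
End gaussian_law_moments.

Section gaussian_increments.
Context {d : measure_display} {T : measurableType d} {R : realType}
  {P : probability T R}.
Variable X : 'rV[R]_2 -> {RV P >-> R}.

(** Weights that sum to zero make the combinations centred, whatever the
    constant mean of the field; the coefficients of nabla have this
    property. *)
Definition increment_space : set (T -> R) :=
  [set z | exists m (a : 'I_m -> R) (t : 'I_m -> 'rV[R]_2),
     \sum_i a i = 0 /\ z = (fun w => \sum_i a i * X (t i) w)].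

Lemma increment_spaceD z w (c : R) : increment_space z -> increment_space w ->
  increment_space (fun t => z t + c * w t).
Proof.
move=> [m [a [s [a0 ->]]]] [n [b [u [b0 ->]]]].
exists (m + n)%N, (fun i => match fintype.split i with inl j => a j | inr j => c * b j end),
  (fun i => match fintype.split i with inl j => s j | inr j => u j end).
split.
  rewrite big_split_ord /=.
  under eq_bigr => i _ do rewrite (unsplitK (inl i : 'I_m + 'I_n)%type).
  under [X in _ + X]eq_bigr => i _ do rewrite (unsplitK (inr i : 'I_m + 'I_n)%type).
  by rewrite -mulr_sumr a0 b0 mulr0 addr0.
apply/funext => t; rewrite big_split_ord /=; congr (_ + _).
  by apply: eq_bigr => i _; rewrite (unsplitK (inl i : 'I_m + 'I_n)%type).
rewrite mulr_sumr; apply: eq_bigr => i _.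
by rewrite (unsplitK (inr i : 'I_m + 'I_n)%type) mulrA.
Qed.

Lemma increment_spaceB s u : increment_space (fun w => X s w - X u w).
Proof.
exists 2%N, (fun i => if i == ord0 then 1 else -1), (fun i => if i == ord0 then s else u).
split; first by rewrite !big_ord_recl big_ord0 /= addr0 subrr.
by apply/funext => w; rewrite !big_ord_recl big_ord0 /= addr0 mul1r mulN1r.
Qed.

Lemma increment_space0 : increment_space (fun=> 0).
Proof.
exists 0%N, (fun=> 0), (fun=> 0); split; first by rewrite big_ord0.
by apply/funext => w; rewrite big_ord0.
Qed.

Hypothesis gX : gaussian_field X.

Lemma gaussian_field_moments s : finite_moments P (X s).
Proof.
have gXs : gaussian_law (P := P) (X s).
  have := gX (fun _ : 'I_1 => 1) (fun=> s); congr gaussian_law.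
  by apply/funext => w; rewrite big_ord1 mul1r.
by have [m [v []]] := gaussian_law_moments (measurable_funPT (X s)) gXs.
Qed.

Variable mu : R.
Hypothesis EX : forall x, ('E_P[X x] = mu%:E)%E.

Lemma gaussian_field_mean s : \int[P]_t X s t = mu.
Proof. by have := EX s; rewrite unlock /Rintegral => ->. Qed.

Lemma increment_space_gaussian : gaussian_space P increment_space.
Proof.
split; last by move=> z w a; exact: increment_spaceD.
move=> z [m [a [s [a0 zE]]]].
have mz : measurable_fun setT z.
  rewrite zE; apply: measurable_sum => i; apply: measurable_funM => //.
have Ez : \int[P]_t z t = 0.
  rewrite zE Rintegral_sum_moments; last first.
    by move=> i; apply: finite_momentsZ; exact: gaussian_field_moments.
  rewrite (eq_bigr (fun i => a i * mu)) => [|i _]; first by rewrite -mulr_suml a0 mul0r.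
  by rewrite RintegralMl_moments ?gaussian_field_mean//; exact: gaussian_field_moments.
have gz : gaussian_law (P := P) z by rewrite zE; exact: gX.
have [m' [v [fz Em mom]]] := gaussian_law_moments mz gz.
rewrite Ez in Em; rewrite -{}Em in mom.
have mom' k : \int[P]_t z t ^+ k.+2 = k.+1%:R * v ^+ 2 * \int[P]_t z t ^+ k.
  have e j : \int[P]_t (z t - 0) ^+ j = \int[P]_t z t ^+ j.
    by apply: eq_Rintegral => t _; rewrite subr0.
  by have := mom k; rewrite !e.
split => // k; rewrite mom'; congr (_ * _ * _).
rewrite mom' mul1r; under eq_Rintegral do rewrite expr0.
by rewrite Rintegral_cst_prob mulr1.
Qed.

Variable Kt : 'rV[R]_2 -> R.
Hypothesis covX : forall x y, covariance P (X x) (X y) = (Kt (x - y))%:E.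

Lemma gaussian_field_product x y :
  \int[P]_t (X x t * X y t) = Kt (x - y) + mu ^+ 2.
Proof.
have fX := gaussian_field_moments.
have := covX x y; rewrite unlock.
rewrite !EX /= unlock => h.
have : \int[P]_t ((X x t - mu) * (X y t - mu)) = Kt (x - y) by rewrite /Rintegral h.
have -> : \int[P]_t ((X x t - mu) * (X y t - mu)) =
   \int[P]_t (X x t * X y t) + (- mu) * \int[P]_t X x t + (- mu) * \int[P]_t X y t + mu ^+ 2.
  rewrite -[X in _ = _ + X](Rintegral_cst_prob P (mu ^+ 2)) -!RintegralMl_moments//.
  rewrite -!RintegralD_moments; try by solve_moments.
  by apply: eq_Rintegral => t _; ring.
by rewrite !gaussian_field_mean => <-; ring.
Qed.

End gaussian_increments.

(** * Compactness and Taylor estimates *)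

Section compactness.
Context {R : realType}.

(** Continuity at the points of a compact set is uniform, even when the second
    point lies outside of the set. *)
Lemma compact_uniform (M : pseudoMetricType R) (f : M -> R) (K : set M) (e : R) :
  compact K -> (forall x, K x -> {for x, continuous f}) -> 0 < e ->
  exists2 eta, 0 < eta & forall x y, K x -> ball x eta y -> `|f x - f y| < e.
Proof.
move=> /compact_near_coveringP cK cf e0.
have e2 : 0 < e / 2 by rewrite divr_gt0.
have H : forall x, K x -> \forall x' \near x & eta \near (0^'+ : set_system R),
    forall y, ball x' eta y -> `|f x' - f y| < e.
  move=> x Kx; have /cvgrPdist_lt /(_ _ e2) := cf x Kx.
  move=> /nbhs_ballP[d /= d0 hd].
  have d2 : 0 < d / 2 by rewrite divr_gt0.
  exists (ball x (d / 2), [set eta : R | eta < d / 2]).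
    split => /=; first exact: nbhsx_ballx.
    by apply: nbhs_right_lt.
  move=> [x' eta] /= [bx' le] y by'.
  have h1 := hd x' (le_ball _ bx').
  have h2 : `|f x - f y| < e / 2.
    apply: hd; rewrite [d](splitr d); apply: (ball_triangle bx').
    by apply: le_ball by'; exact: ltW.
  have -> : f x' - f y = (f x - f y) - (f x - f x') by ring.
  rewrite [e](splitr e); apply: le_lt_trans (ler_normB _ _) _.
  apply: ltrD => //; apply: h1; lra.
have := cK R (0^'+ : set_system R) (fun eta x => forall y, ball x eta y -> `|f x - f y| < e) _ H.
move=> near_eta.
have : \forall eta \near (0^'+ : set_system R), 0 < eta /\ K `<=` [set x | forall y, ball x eta y -> `|f x - f y| < e].
  near=> eta; split; first by near: eta; exact: nbhs_right_gt.
  near: eta; exact: near_eta.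
move=> /filter_ex[eta [eta0 h]]; exists eta => // x y Kx bxy; exact: h.
Unshelve. all: end_near. Qed.

(** Uniform continuity of the indicator function of the open set, which is
    locally constant at each of its points. *)
Lemma compact_open_margin (M : pseudoMetricType R) (U K : set M) :
  compact K -> open U -> K `<=` U ->
  exists2 eta, 0 < eta & forall x y, K x -> ball x eta y -> U y.
Proof.
move=> cK oU KU.
pose f (x : M) : R := (x \in U)%:R.
have cf x : K x -> {for x, continuous f}.
  move=> /KU Ux; apply: cvg_near_cst.
  have : \forall y \near x, U y by exact: open_nbhs_nbhs.
  by apply: filterS => y Uy; rewrite /f !mem_set.
have [eta eta0 h] := compact_uniform cK cf (ltr01 : 0 < 1 :> R).
exists eta => // x y Kx bxy; have := h x y Kx bxy; rewrite /f (mem_set (KU _ Kx)).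
by case: (boolP (y \in U)) => [/set_mem//|_]; rewrite subr0 normr1 ltxx.
Qed.

Lemma compact_bounded_above (M : topologicalType) (f : M -> R) (K : set M) :
  compact K -> (forall x, K x -> {for x, continuous f}) ->
  exists C, forall x, K x -> `|f x| <= C.
Proof.
move=> cK cf.
have := cK; move/compact_near_coveringP.
move=> /(_ R (+oo : set_system R) (fun C x => `|f x| <= C) _) h.
have : \forall C \near (+oo : set_system R), K `<=` [set x | `|f x| <= C].
  apply: h => x Kx; have /cvgrPdist_lt /(_ _ ltr01) := cf x Kx => near1.
  exists ([set x' | `|f x - f x'| < 1], [set C | `|f x| + 1 <= C]).
    by split => //=; exact: nbhs_pinfty_ge.
  move=> [x' C] /= [h1 h2].
  have -> : f x' = f x - (f x - f x') by ring.
  by apply: le_trans (ler_normB _ _) _; lra.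
by move=> /filter_ex[C hC]; exists C => x Kx; exact: hC.
Qed.

Lemma compact_positive_min (M : topologicalType) (f : M -> R) (K : set M) :
  compact K -> (forall x, K x -> {for x, continuous f}) ->
  (forall x, K x -> 0 < f x) ->
  exists2 c, 0 < c & forall x, K x -> c <= f x.
Proof.
move=> cK cf f0.
have [C hC] : exists C, forall x, K x -> `|(f x)^-1| <= C.
  apply: compact_bounded_above => // x Kx; apply: cvgV; first by rewrite gt_eqF ?f0.
  exact: cf.
have C0 : 0 < `|C| + 1 by rewrite ltr_pwDr.
exists (`|C| + 1)^-1; first by rewrite invr_gt0.
move=> x Kx; have fx := f0 x Kx.
rewrite -[f x]invrK lef_pV2 ?posrE ?invr_gt0//.
apply: le_trans (ler_norm _) _; apply: le_trans (hC x Kx) _.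
by have := ler_norm C; lra.
Qed.

End compactness.

Section taylor.
Context {R : realType}.

(** The sign of t is arbitrary, hence the symmetric interval. *)
Lemma mean_value_bound (f df : R -> R) (a t B : R) :
  (forall s, `|s| <= `|t| -> is_derive (a + s) 1 f (df (a + s))) ->
  (forall s, `|s| <= `|t| -> `|df (a + s)| <= B) ->
  `|f (a + t) - f a| <= B * `|t|.
Proof.
move=> df1 dfB.
have der x : `|x - a| <= `|t| -> is_derive x 1 f (df x).
  by move=> h; have := df1 _ h; rewrite addrC subrK.
have bnd x : `|x - a| <= `|t| -> `|df x| <= B.
  by move=> h; have := dfB _ h; rewrite addrC subrK.
have key (x y : R) : x < y -> (forall z, x <= z <= y -> `|z - a| <= `|t|) ->
    `|f y - f x| <= B * (y - x).
  move=> xy hz.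
  have [z| |z] := @MVT R f df x y xy.
  - move=> zxy; apply: der; apply: hz; move: zxy; rewrite in_itv/= => /andP[/ltW-> /ltW->//].
  - apply: derivable_within_continuous => z; rewrite in_itv/= => zxy.
    by have := der z (hz z zxy) => ?; apply: ex_derive.
  - rewrite in_itv/= => /andP[xz zy] ->; rewrite normrM [X in _ * X]gtr0_norm ?subr_gt0//.
    by rewrite ler_wpM2r ?subr_ge0 ?(ltW xy)//; apply: bnd; apply: hz; rewrite !ltW.
have [->|t0] := eqVneq t 0; first by rewrite addr0 subrr normr0 mulr0.
case: (ltgtP 0 t) t0 => // t0 _.
  have := key a (a + t); rewrite ltrDl addrAC subrr add0r => h.
  rewrite [X in _ * X]gtr0_norm//; apply: h => // z /andP[az za].
  by rewrite ger0_norm ?subr_ge0// gtr0_norm//; lra.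
have := key (a + t) a; rewrite gtrDl distrC opprD addrA subrr sub0r => h.
rewrite [X in _ * X]ltr0_norm//; apply: h => // z /andP[az za].
by rewrite ler0_norm ?subr_le0// ltr0_norm//; lra.
Qed.

(** The family g lists a function with its successive derivatives.  The
    remainder of order k + 1 vanishes at a and its derivative is the remainder
    of order k of the derivative, so the mean value inequality applies. *)
Lemma taylor_bound (k : nat) (g : nat -> R -> R) (a t B : R) :
  (forall i s, (i < k)%N -> `|s| <= `|t| -> is_derive (a + s) 1 (g i) (g i.+1 (a + s))) ->
  (forall s, `|s| <= `|t| -> `|g k (a + s)| <= B) ->
  `|g 0%N (a + t) - \sum_(i < k) g i a * (t ^+ i / i`!%:R)| <= B * `|t| ^+ k.
Proof.
elim: k g t => [|k ih] g t dg gB.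
  by rewrite big_ord0 subr0 expr0 mulr1; exact: gB.
pose h s := g 0%N s - \sum_(i < k.+1) g i a * ((s - a) ^+ i / i`!%:R).
pose dh s := g 1%N s - \sum_(i < k) g i.+1 a * ((s - a) ^+ i / i`!%:R).
have ha : h a = 0.
  rewrite /h big_ord_recl subrr expr0 fact0 divr1 mulr1 big1 ?addr0 ?subrr// => i _.
  by rewrite exprS mul0r mul0r mulr0.
have -> : g 0%N (a + t) - \sum_(i < k.+1) g i a * (t ^+ i / i`!%:R) = h (a + t) - h a.
  by rewrite ha subr0 /h addrAC subrr add0r.
rewrite exprSr mulrA; apply: (@mean_value_bound h dh).
- move=> s st; have d0 := dg 0%N s (ltn0Sn k) st.
  have dp (i : 'I_k.+1) : is_derive (a + s) 1 (fun x : R => g i a * ((x - a) ^+ i / i`!%:R))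
     (g i a * (i%:R * s ^+ i.-1 / i`!%:R)).
    have dB : is_derive (a + s) 1 (fun y : R => y - a) 1 by apply: is_derive_eq; rewrite subr0.
    have dX := is_deriveX i dB.
    have -> : (fun x : R => g i a * ((x - a) ^+ i / i`!%:R)) =
        (g i a / i`!%:R) \*: ((fun y : R => y - a) ^+ i : R -> R).
      by apply/funext => x; rewrite /= exprfctE /GRing.scale /=; ring.
    apply: is_derive_eq; rewrite /GRing.scale /= addrAC subrr add0r; ring.
  have dS := @is_derive_sum R R R k.+1 (fun i : 'I_k.+1 => fun x : R => g i a * ((x - a) ^+ i / i`!%:R)) (a + s) 1 _ dp.
  have -> : h = g 0%N - \sum_(i < k.+1) (fun x : R => g i a * ((x - a) ^+ i / i`!%:R)).
    by apply/funext => x; rewrite /h /= fct_sumE.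
  apply: is_derive_eq; rewrite /dh big_ord_recl /= !mul0r mulr0 add0r; congr (_ - _).
  apply: eq_bigr => i _; rewrite addrAC subrr add0r /bump /= add1n add0n factS natrM.
  by rewrite -mulf_div divff ?mul1r ?pnatr_eq0.
- move=> s st.
  have := ih (fun i => g i.+1) s; rewrite /dh addrAC subrr add0r => hh.
  apply: le_trans (hh _ _) _.
  + by move=> i s' ik s's; apply: dg => //; apply: le_trans st.
  + by move=> s' s's; apply: gB; apply: le_trans st.
  + have B0 : 0 <= B by apply: le_trans (gB 0 _); rewrite ?normr0.
    by rewrite ler_wpM2l// lerXn2r ?nnegrE.
Qed.

End taylor.

(** * Fourth order differences in the plane *)

Section plane.
Context {R : realType}.
Implicit Types v x y : 'rV[R]_2.

Lemma ord2_cases (j : 'I_2) : j = 0 \/ j = 1.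
Proof. by case: j => -[|[|//]] p; [left|right]; exact: val_inj. Qed.

Lemma coord_le_norm v (j : 'I_2) : `|v 0 j| <= `|v|.
Proof. by rewrite [leRHS]mx_normrE; apply: le_trans (le_bigmax _ _ (0, j)). Qed.

Lemma norm_le_coord v (e : R) : 0 <= e -> (forall j, `|v 0 j| <= e) -> `|v| <= e.
Proof.
move=> e0 h; rewrite [leLHS]mx_normrE; apply: bigmax_le => // -[i j] _ /=.
by rewrite ord1; exact: h.
Qed.

Lemma enorm_sqr v : enorm v ^+ 2 = v 0 0 ^+ 2 + v 0 1 ^+ 2.
Proof.
rewrite /enorm sqr_sqrtr; first by rewrite !big_ord_recl big_ord0 addr0; congr (v 0 _ ^+ 2 + v 0 _ ^+ 2); exact: val_inj.
by apply: sumr_ge0 => j _; exact: sqr_ge0.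
Qed.

Lemma enorm_ge0 v : 0 <= enorm v. Proof. exact: sqrtr_ge0. Qed.

Lemma norm_le_enorm v : `|v| <= enorm v.
Proof.
apply: norm_le_coord => [|j]; first exact: enorm_ge0.
rewrite -(ler_pXn2r (n := 2)) ?nnegrE ?enorm_ge0// enorm_sqr real_normK ?num_real//.
have := sqr_ge0 (v 0 0); have := sqr_ge0 (v 0 1).
by case: (ord2_cases j) => ->; lra.
Qed.

Lemma enorm_le_norm v : enorm v <= 2 * `|v|.
Proof.
rewrite -(ler_pXn2r (n := 2)) ?nnegrE ?enorm_ge0 ?mulr_ge0// enorm_sqr.
rewrite -(real_normK (num_real (v 0 0))) -(real_normK (num_real (v 0 1))).
have := coord_le_norm v 0; have := coord_le_norm v 1.
by have := normr_ge0 (v 0 0); have := normr_ge0 (v 0 1); have := normr_ge0 v; nra.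
Qed.

Lemma row2_decomp v : v = v 0 0 *: delta_mx 0 0 + v 0 1 *: delta_mx 0 1.
Proof.
apply/rowP => j; rewrite !mxE /=.
by case: (ord2_cases j) => -> /=; rewrite !mulr1 mulr0 ?addr0 ?add0r.
Qed.

Lemma is_derive_line (W : normedModType R) (F : 'rV[R]_2 -> W) (p v : 'rV[R]_2) (t : R) :
  derivable F (p + t *: v) v ->
  is_derive t 1 (fun s : R => F (p + s *: v)) ('D_v F (p + t *: v)).
Proof.
move=> dF.
have E : (fun h : R => h^-1 *: (((fun s : R => F (p + s *: v)) \o shift t) (h *: 1) - F (p + t *: v)))
  = (fun h : R => h^-1 *: ((F \o shift (p + t *: v)) (h *: v) - F (p + t *: v))).
  apply/funext => h /=; congr (_ *: (F _ - _)).
  have -> : h *: (1 : R) = h by rewrite /GRing.scale /= mulr1.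
  by rewrite scalerDl addrCA addrA.
by apply: DeriveDef; rewrite /derivable /derive /= E.
Qed.

End plane.

Section fourth_difference.
Context {R : realType}.
Local Notation e0 := (delta_mx 0 0 : 'rV[R]_2).
Local Notation e1 := (delta_mx 0 1 : 'rV[R]_2).

(** The available derivatives are iterated first along one axis and then along
    the other, in a fixed order.  The expansion is therefore done in the second
    coordinate first, and each of its four coefficients is then expanded in the
    first coordinate; five remainders of order four occur. *)
Lemma plane_taylor_bound (f : 'rV[R]_2 -> R) (h : 'rV[R]_2) (rad B : R) :
  (forall a1 a2 s t, (a1 + a2 = 4)%N -> `|s| <= rad -> `|t| <= rad ->
    partials_exist [set h + s *: e0 + t *: e1] a1 a2 f /\
    `|partials a1 a2 f (h + s *: e0 + t *: e1)| <= B) ->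
  forall s t, `|s| <= rad -> `|t| <= rad ->
  `|f (h + s *: e0 + t *: e1) - \sum_(j < 4) \sum_(i < 4 - j)
      partials i j f h * (s ^+ i / i`!%:R * (t ^+ j / j`!%:R))| <= 5 * B * rad ^+ 4.
Proof.
move=> H s t sr tr.
have rad0 : 0 <= rad by exact: le_trans sr.
have B0 : 0 <= B.
  have [_] := H 4%N 0%N s t erefl sr tr; exact: le_trans.
have z0 : `|0 : R| <= rad by rewrite normr0.
have step1 : `|f (h + s *: e0 + t *: e1) -
    \sum_(j < 4) partials 0 j f (h + s *: e0) * (t ^+ j / j`!%:R)| <= B * rad ^+ 4.
  have := @taylor_bound R 4 (fun j u => partials 0 j f (h + s *: e0 + u *: e1)) 0 t B.
  rewrite add0r scale0r addr0 => T.
  apply: le_trans (T _ _) _.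
  - move=> j u j4 ut; rewrite add0r.
    have [E _] := H 0%N 4%N s u erefl sr (le_trans ut tr).
    by have [/(_ j j4) dj _] := E _ erefl; exact: is_derive_line.
  - move=> u ut; rewrite add0r.
    by have [_] := H 0%N 4%N s u erefl sr (le_trans ut tr).
  - by rewrite ler_wpM2l// lerXn2r ?nnegrE.
have step2 (j : 'I_4) : `|partials 0 j f (h + s *: e0) -
    \sum_(i < 4 - j) partials i j f h * (s ^+ i / i`!%:R)| <= B * rad ^+ (4 - j).
  have := @taylor_bound R (4 - j) (fun i u => partials i j f (h + u *: e0)) 0 s B.
  rewrite add0r scale0r addr0 => T.
  have j4 : (4 - j + j = 4)%N by rewrite subnK// ltnW.
  apply: le_trans (T _ _) _.
  - move=> i u ij us; rewrite add0r.
    have [E _] := H (4 - j)%N j u 0 j4 (le_trans us sr) z0.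
    have [_ /(_ i ij)] := E _ erefl; rewrite scale0r addr0; exact: is_derive_line.
  - move=> u us; rewrite add0r.
    have := (H (4 - j)%N j u 0 j4 (le_trans us sr) _).2; rewrite scale0r addr0; exact.
  - by rewrite ler_wpM2l// lerXn2r ?nnegrE.
set S := \sum_(j < 4) \sum_(i < 4 - j) _.
have -> : f (h + s *: e0 + t *: e1) - S = (f (h + s *: e0 + t *: e1) -
    \sum_(j < 4) partials 0 j f (h + s *: e0) * (t ^+ j / j`!%:R)) +
   \sum_(j < 4) (partials 0 j f (h + s *: e0) -
    \sum_(i < 4 - j) partials i j f h * (s ^+ i / i`!%:R)) * (t ^+ j / j`!%:R).
  under [X in _ = _ + X]eq_bigr do rewrite mulrBl mulr_suml.
  rewrite sumrB addrA subrK; congr (_ - _).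
  by rewrite /S; apply: eq_bigr => j _; apply: eq_bigr => i _; ring.
have -> : 5 * B * rad ^+ 4 = B * rad ^+ 4 + \sum_(j < 4) B * rad ^+ 4.
  by rewrite sumr_const card_ord -mulr_natl; ring.
apply: le_trans (ler_normD _ _) _; apply: lerD => //.
apply: le_trans (ler_norm_sum _ _ _) _; apply: ler_sum => j _.
rewrite normrM.
have -> : B * rad ^+ 4 = B * rad ^+ (4 - j) * rad ^+ j.
  by rewrite -mulrA -exprD subnK// ltnW.
apply: ler_pM => //.
rewrite normrM normfV (ger0_norm (ler0n R _)) ler_pdivrMr ?ltr0n ?fact_gt0//.
apply: (@le_trans _ _ (rad ^+ j)); first by rewrite normrX lerXn2r ?nnegrE.
by rewrite ler_peMr ?exprn_ge0// ler1n fact_gt0.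
Qed.

(** In the binomial expansion of a monomial of total degree at most 3, each
    term has degree at most 1 in the p or at most 1 in the q, and the
    corresponding weights annihilate polynomials of degree 1. *)
Lemma affine_null_cubic (I J : finType) (c : I -> R) (c' : J -> R)
    (p0 p1 : I -> R) (q0 q1 : J -> R) (i j : nat) :
  \sum_k c k = 0 -> \sum_k c k * p0 k = 0 -> \sum_k c k * p1 k = 0 ->
  \sum_l c' l = 0 -> \sum_l c' l * q0 l = 0 -> \sum_l c' l * q1 l = 0 ->
  (i + j < 4)%N ->
  \sum_k \sum_l c k * c' l * ((p0 k - q0 l) ^+ i * (p1 k - q1 l) ^+ j) = 0.
Proof.
move=> h h0 h1 h' h0' h1' ij.
have nul (K : finType) (d r0 r1 : K -> R) u v : \sum_k d k = 0 -> \sum_k d k * r0 k = 0 ->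
    \sum_k d k * r1 k = 0 -> (u + v <= 1)%N -> \sum_k d k * (r0 k ^+ u * r1 k ^+ v) = 0.
  move=> g g0 g1; case: u => [|[|//]]; case: v => [|[|//]] // _.
  - by under eq_bigr do rewrite !expr0 !mulr1.
  - by under eq_bigr do rewrite expr0 expr1 mul1r.
  - by under eq_bigr do rewrite expr0 expr1 mulr1.
transitivity (\sum_(a < i.+1) \sum_(b < j.+1)
   ((-1) ^+ a * (-1) ^+ b * 'C(i, a)%:R * 'C(j, b)%:R) *
   ((\sum_k c k * (p0 k ^+ (i - a) * p1 k ^+ (j - b))) *
    (\sum_l c' l * (q0 l ^+ a * q1 l ^+ b)))).
  have E k l : c k * c' l * ((p0 k - q0 l) ^+ i * (p1 k - q1 l) ^+ j) =
      \sum_(a < i.+1) \sum_(b < j.+1)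
      ((-1) ^+ a * (-1) ^+ b * 'C(i, a)%:R * 'C(j, b)%:R) *
      ((c k * (p0 k ^+ (i - a) * p1 k ^+ (j - b))) * (c' l * (q0 l ^+ a * q1 l ^+ b))).
    rewrite !exprBn mulr_suml mulr_sumr; apply: eq_bigr => a _.
    rewrite !mulr_sumr; apply: eq_bigr => b _.
    rewrite -(mulr_natl _ 'C(i, a)) -(mulr_natl _ 'C(j, b)).
    move: ((-1) ^+ a) ((-1) ^+ b) ('C(i, a)%:R) ('C(j, b)%:R) => x1 x2 x3 x4.
    move: (p0 k ^+ _) (p1 k ^+ _) (q0 l ^+ _) (q1 l ^+ _) => y1 y2 y3 y4; ring.
  under eq_bigr do under eq_bigr do rewrite E.
  under eq_bigr do rewrite exchange_big /=.
  rewrite exchange_big /=; apply: eq_bigr => a _.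
  under eq_bigr do rewrite exchange_big /=.
  rewrite exchange_big /=; apply: eq_bigr => b _.
  under eq_bigr do rewrite -mulr_sumr.
  rewrite -mulr_sumr; congr (_ * _).
  by rewrite mulr_suml; apply: eq_bigr => k _; rewrite mulr_sumr.
rewrite big1// => a _; rewrite big1// => b _.
have [small|big] := leqP (a + b) 1.
  by rewrite (nul J c' q0 q1 a b)// !mulr0.
rewrite (nul I c p0 p1 (i - a)%N (j - b)%N)// ?mul0r ?mulr0//.
have := ltn_ord a; have := ltn_ord b; lia.
Qed.

(** Both families of weights annihilate affine functions, so together they
    annihilate the Taylor polynomial of degree 3 in the difference of the
    points and only the remainder is left. *)
Lemma fourth_difference_bound (I J : finType) (c : I -> R) (c' : J -> R)
    (p : I -> 'rV[R]_2) (q : J -> 'rV[R]_2) (f : 'rV[R]_2 -> R) (h : 'rV[R]_2) (rad B C : R) :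
  \sum_k c k = 0 -> \sum_k c k *: p k = 0 ->
  \sum_l c' l = 0 -> \sum_l c' l *: q l = 0 ->
  (forall k, `|c k| <= C) -> (forall l, `|c' l| <= C) ->
  (forall k l, `|p k - q l| <= rad) ->
  (forall a1 a2 s t, (a1 + a2 = 4)%N -> `|s| <= rad -> `|t| <= rad ->
    partials_exist [set h + s *: e0 + t *: e1] a1 a2 f /\
    `|partials a1 a2 f (h + s *: e0 + t *: e1)| <= B) ->
  `|\sum_k \sum_l c k * c' l * f (h + (p k - q l))| <=
    (#|I| * #|J|)%:R * (C ^+ 2 * (5 * B * rad ^+ 4)).
Proof.
move=> hc hp hc' hq cC cC' pq H.
pose Tay s t := \sum_(j < 4) \sum_(i < 4 - j)
      partials i j f h * (s ^+ i / i`!%:R * (t ^+ j / j`!%:R)).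
have coordE (K : finType) (d : K -> R) (r : K -> 'rV[R]_2) (j : 'I_2) :
    \sum_k d k *: r k = 0 -> \sum_k d k * r k 0 j = 0.
  move=> /(congr1 (fun M : 'rV[R]_2 => M 0 j)); rewrite summxE [X in _ = X]mxE => E.
  rewrite -[RHS]E.
  by apply: eq_bigr => k _; rewrite mxE.
have Tay0 : \sum_k \sum_l c k * c' l * Tay ((p k - q l) 0 0) ((p k - q l) 0 1) = 0.
  transitivity (\sum_(j < 4) \sum_(i < 4 - j) partials i j f h / (i`!%:R * j`!%:R) *
     \sum_k \sum_l c k * c' l * ((p k 0 0 - q l 0 0) ^+ i * (p k 0 1 - q l 0 1) ^+ j)).
    under eq_bigr do under eq_bigr do rewrite /Tay mulr_sumr.
    under eq_bigr do rewrite exchange_big /=.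
    rewrite exchange_big /=; apply: eq_bigr => j _.
    under eq_bigr do under eq_bigr do rewrite mulr_sumr.
    under eq_bigr do rewrite exchange_big /=.
    rewrite exchange_big /=; apply: eq_bigr => i _.
    rewrite mulr_sumr; apply: eq_bigr => k _; rewrite mulr_sumr; apply: eq_bigr => l _.
    by rewrite !mxE invfM; ring.
  rewrite big1// => j _; rewrite big1// => i _.
  rewrite affine_null_cubic ?mulr0//; try exact: coordE.
  by have := ltn_ord i; have := ltn_ord j; lia.
have -> : \sum_k \sum_l c k * c' l * f (h + (p k - q l)) =
   \sum_k \sum_l c k * c' l * (f (h + (p k - q l)) - Tay ((p k - q l) 0 0) ((p k - q l) 0 1)).
  rewrite -[LHS]subr0 -[X in _ - X = _]Tay0 -sumrB; apply: eq_bigr => k _.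
  by rewrite -sumrB; apply: eq_bigr => l _; rewrite mulrBr.
have bnd k l : `|c k * c' l * (f (h + (p k - q l)) - Tay ((p k - q l) 0 0) ((p k - q l) 0 1))|
    <= C ^+ 2 * (5 * B * rad ^+ 4).
  rewrite !normrM expr2; apply: ler_pM; rewrite ?mulr_ge0//; first exact: ler_pM.
  rewrite [X in f (h + X)]row2_decomp addrA.
  apply: plane_taylor_bound => //; apply: le_trans (pq k l); exact: coord_le_norm.
apply: le_trans (ler_norm_sum _ _ _) _.
apply: (@le_trans _ _ (\sum_(k : I) \sum_(l : J) C ^+ 2 * (5 * B * rad ^+ 4))).
  apply: ler_sum => k _; apply: le_trans (ler_norm_sum _ _ _) _; exact: ler_sum.
by rewrite !sumr_const -mulrnA -[leLHS]mulr_natl mulnC.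
Qed.

End fourth_difference.

(** * Geometry of the diffeomorphism *)

Section first_order.
Context {R : realType}.
Implicit Types (x y p v : 'rV[R]_2) (Omega K : set 'rV[R]_2).
Local Notation e0 := (delta_mx 0 0 : 'rV[R]_2).
Local Notation e1 := (delta_mx 0 1 : 'rV[R]_2).

Lemma ballrV x (e : R) y : ball x e y = (`|x - y| < e) :> Prop.
Proof. by rewrite -ball_normE. Qed.

Lemma norm_unit_vector (j : 'I_2) : `|delta_mx 0 j : 'rV[R]_2| <= 1.
Proof.
apply: norm_le_coord => // i; rewrite mxE /=.
by case: (_ == _); rewrite ?normr1 ?normr0.
Qed.

Lemma continuous_rV (M : topologicalType) (F : M -> 'rV[R]_2) (m : M) :
  (forall j, {for m, continuous (fun t => F t 0 j)}) -> {for m, continuous F}.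
Proof.
move=> h; apply/cvgrPdist_le => e e_gt0.
have hj (j : 'I_2) : \forall t \near m, `|F m 0 j - F t 0 j| <= e.
  by have /cvgrPdist_le := h j; apply.
near=> t; apply: norm_le_coord => [|j]; first exact: ltW.
by rewrite !mxE; case: (ord2_cases j) => ->; near: t; exact: hj.
Unshelve. all: end_near. Qed.

Lemma continuous_rV_coord (M : topologicalType) (F : M -> 'rV[R]_2) (m : M) (j : 'I_2) :
  {for m, continuous F} -> {for m, continuous (fun t => F t 0 j)}.
Proof.
move=> /cvgrPdist_lt h; apply/cvgrPdist_lt => e e_gt0; move: (h e e_gt0).
apply: filterS => t; apply: le_lt_trans.
by have := coord_le_norm (F m - F t) j; rewrite !mxE.
Qed.

Lemma line_mean_value (F : 'rV[R]_2 -> R) v y (l c B : R) :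
  (forall s : R, `|s| <= `|l| -> derivable F (y + s *: v) v) ->
  (forall s : R, `|s| <= `|l| -> `|'D_v F (y + s *: v) - c| <= B) ->
  `|F (y + l *: v) - F y - l * c| <= B * `|l|.
Proof.
move=> dF hB.
have := @mean_value_bound R (fun s => F (y + s *: v) - s * c)
  (fun s => 'D_v F (y + s *: v) - c) 0 l B.
rewrite add0r scale0r addr0 mul0r subr0 [X in _ -> _ -> `|X| <= _]addrAC; apply.
  move=> s sl; rewrite add0r; have dl := is_derive_line (dF s sl).
  by apply: is_derive_eq; rewrite /GRing.scale /= mulr0 add0r mulr1.
by move=> s sl; rewrite add0r; exact: hB.
Qed.

(** The increment of F along an axis is the partial derivative at a point
    nearby, which is uniformly close to its value at p. *)
Lemma uniform_first_order Omega K (F : 'rV[R]_2 -> R) (j : 'I_2) (e : R) :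
  open Omega -> compact K -> K `<=` Omega ->
  (forall x, Omega x -> derivable F x (delta_mx 0 j)) ->
  (forall x, Omega x -> {for x, continuous (partial j F)}) -> 0 < e ->
  exists2 eta, 0 < eta & forall p y (l : R), K p -> `|p - y| + `|l| < eta ->
    `|F (y + l *: delta_mx 0 j) - F y - l * partial j F p| <= e * `|l|.
Proof.
move=> oO cK KO dF cF e_gt0.
have [eta1 eta10 h1] := @compact_open_margin R 'rV[R]_2 _ _ cK oO KO.
have [eta2 eta20 h2] := @compact_uniform R 'rV[R]_2 _ _ _ cK (fun x Kx => cF x (KO x Kx)) e_gt0.
exists (Num.min eta1 eta2); first by rewrite lt_min eta10.
move=> p y l Kp hl.
have close (s : R) : `|s| <= `|l| -> `|p - (y + s *: delta_mx 0 j)| < Num.min eta1 eta2.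
  move=> sl; apply: le_lt_trans hl; rewrite opprD addrA.
  apply: le_trans (ler_normB _ _) _; rewrite lerD2l normrZ.
  apply: le_trans sl; rewrite ler_piMr//; exact: norm_unit_vector.
apply: line_mean_value => s /close; rewrite lt_min => /andP[s1 s2].
  by apply: dF; apply: h1 Kp _; rewrite ballrV.
by rewrite distrC ltW//; apply: h2 => //; rewrite ballrV.
Qed.

(** One step along each axis; the partial derivatives are bounded on the
    compact set. *)
Lemma local_lipschitz Omega K (F : 'rV[R]_2 -> R) :
  open Omega -> compact K -> K `<=` Omega ->
  (forall x j, Omega x -> derivable F x (delta_mx 0 j)) ->
  (forall x j, Omega x -> {for x, continuous (partial j F)}) ->
  exists L, exists2 eta, 0 < eta & forall p y, K p -> `|p - y| < eta ->
    `|F y - F p| <= L * `|y - p|.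
Proof.
move=> oO cK KO dF cF.
have [C0 hC0] := compact_bounded_above cK (fun x Kx => cF x 0 (KO x Kx)).
have [C1 hC1] := compact_bounded_above cK (fun x Kx => cF x 1 (KO x Kx)).
have [eta0 eta00 h0] := uniform_first_order oO cK KO (fun x => dF x 0) (fun x => cF x 0) ltr01.
have [eta1 eta10 h1] := uniform_first_order oO cK KO (fun x => dF x 1) (fun x => cF x 1) ltr01.
pose C := C0 + C1 + 2.
exists C, (Num.min eta0 eta1 / 2); first by rewrite divr_gt0// lt_min eta00.
move=> p y Kp; rewrite distrC => py.
set v := y - p in py *; set N := `|v| in py *.
have v0 : `|v 0 0| <= N by exact: coord_le_norm.
have v1 : `|v 0 1| <= N by exact: coord_le_norm.
have yE : y = p + v 0 0 *: e0 + v 0 1 *: e1 by rewrite -addrA -row2_decomp addrC subrK.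
have N0 : 0 <= N by exact: normr_ge0.
have m0 : Num.min eta0 eta1 <= eta0 by rewrite ge_min lexx.
have m1 : Num.min eta0 eta1 <= eta1 by rewrite ge_min lexx orbT.
have H0 : `|F (p + v 0 0 *: e0) - F p - v 0 0 * partial 0 F p| <= 1 * `|v 0 0|.
  by apply: h0 => //; rewrite subrr normr0 add0r; lra.
have H1 : `|F (p + v 0 0 *: e0 + v 0 1 *: e1) - F (p + v 0 0 *: e0) - v 0 1 * partial 1 F p| <= 1 * `|v 0 1|.
  apply: h1 => //; rewrite opprD addrA subrr sub0r normrN normrZ.
  have : `|v 0 0| * `|e0| <= `|v 0 0| by rewrite ler_piMr// norm_unit_vector.
  by move: (`|v 0 0| * `|e0|) => z; lra.
rewrite yE.
have -> : F (p + v 0 0 *: e0 + v 0 1 *: e1) - F p =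
  (F (p + v 0 0 *: e0) - F p - v 0 0 * partial 0 F p) +
  (F (p + v 0 0 *: e0 + v 0 1 *: e1) - F (p + v 0 0 *: e0) - v 0 1 * partial 1 F p) +
  (v 0 0 * partial 0 F p + v 0 1 * partial 1 F p) by ring.
have D0 : `|v 0 0 * partial 0 F p| <= N * C0 by rewrite normrM; apply: ler_pM => //; exact: hC0.
have D1 : `|v 0 1 * partial 1 F p| <= N * C1 by rewrite normrM; apply: ler_pM => //; exact: hC1.
apply: le_trans (ler_normD _ _) _.
apply: le_trans (lerD (ler_normD _ _) (ler_normD _ _)) _.
apply: le_trans (lerD (lerD H0 H1) (lerD D0 D1)) _.
have -> : C * N = N + N + (N * C0 + N * C1) by rewrite /C; ring.
by rewrite !mul1r lerD2r lerD.
Qed.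

End first_order.

Section diffeo.
Context {R : realType}.
Implicit Types (x y p v : 'rV[R]_2).
Local Notation e0 := (delta_mx 0 0 : 'rV[R]_2).
Local Notation e1 := (delta_mx 0 1 : 'rV[R]_2).
Local Notation sq := (@unit_square R).

Lemma unit_square_compact : compact sq.
Proof.
have := @rV_compact R 2 (fun=> `[0, 1]%classic) (fun=> @segment_compact R 0 1).
by congr compact; apply/seteqP; split => x /= h j; have := h j; rewrite in_itv.
Qed.

Variables (Omega : set 'rV[R]_2) (phi : 'rV[R]_2 -> 'rV[R]_2).
Hypothesis sqO : sq `<=` Omega.
Hypothesis C1 : C1_diffeo Omega phi.

Let oO : open Omega.
Proof. by case: C1 => _ /(_ 0)[[]]. Qed.

Lemma diffeo_partials (k j : 'I_2) x : Omega x ->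
  derivable (component phi k) x (delta_mx 0 j) /\
  {for x, continuous (partial j (component phi k))}.
Proof.
move=> Ox; case: C1 => _ /(_ k)[[_ p0 c0] [_ p1 c1]] _.
case: (ord2_cases j) => ->; split.
- by have [_ /(_ 0%N (ltn0Sn _))] := p0 x Ox.
- by apply: c0; rewrite inE.
- by have [/(_ 0%N (ltn0Sn _))] := p1 x Ox.
- by apply: c1; rewrite inE.
Qed.

Lemma continuous_phi_u x : Omega x -> {for x, continuous (phi_u phi)}.
Proof.
move=> Ox; apply: continuous_rV => j.
have [_] := diffeo_partials j 0 Ox; congr (continuous_at x _).
by apply/funext => y; rewrite mxE.
Qed.

Lemma continuous_phi_v x : Omega x -> {for x, continuous (phi_v phi)}.
Proof.
move=> Ox; apply: continuous_rV => j.
have [_] := diffeo_partials j 1 Ox; congr (continuous_at x _).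
by apply/funext => y; rewrite mxE.
Qed.

(** Base points y near the square are allowed, because the diagonal step is
    taken as two axis-parallel steps and the first may leave the square. *)
Lemma phi_uniform_first_order (e : R) : 0 < e ->
  exists2 eta, 0 < eta & forall p y (l : R), sq p -> `|p - y| + `|l| < eta ->
    `|phi (y + l *: e0) - phi y - l *: phi_u phi p| <= e * `|l| /\
    `|phi (y + l *: e1) - phi y - l *: phi_v phi p| <= e * `|l|.
Proof.
move=> e_gt0.
have U k j := @uniform_first_order R Omega sq (component phi k) j e oO
  unit_square_compact sqO (fun x Ox => (diffeo_partials k j Ox).1)
  (fun x Ox => (diffeo_partials k j Ox).2) e_gt0.
have [n00 n00p h00] := U 0 0; have [n01 n01p h01] := U 0 1.
have [n10 n10p h10] := U 1 0; have [n11 n11p h11] := U 1 1.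
exists (Num.min (Num.min n00 n01) (Num.min n10 n11)).
  by rewrite !lt_min n00p n01p n10p n11p.
move=> p y l sp; rewrite !lt_min => /andP[/andP[l00 l01] /andP[l10 l11]].
have el0 : 0 <= e * `|l| by rewrite mulr_ge0// ltW.
split; apply: norm_le_coord => // j; rewrite !mxE.
  by case: (ord2_cases j) => ->; [exact: h00|exact: h10].
by case: (ord2_cases j) => ->; [exact: h01|exact: h11].
Qed.

Lemma phi_first_order (e : R) : 0 < e ->
  exists2 eta, 0 < eta & forall p (l : R), sq p -> 0 < l < eta ->
  [/\ `|l^-1 *: (phi (p + l *: e0) - phi p) - phi_u phi p| <= e,
      `|l^-1 *: (phi (p + l *: e1) - phi p) - phi_v phi p| <= e &
      `|l^-1 *: (phi (p + l *: e0 + l *: e1) - phi p) - (phi_u phi p + phi_v phi p)| <= e].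
Proof.
move=> e_gt0; have e2 : 0 < e / 2 by rewrite divr_gt0.
have [eta eta0 h] := phi_uniform_first_order e2.
exists (eta / 2); first by rewrite divr_gt0.
move=> p l sp /andP[l0 leta].
have scale (A B : 'rV[R]_2) c : `|A - l *: B| <= c * l -> `|l^-1 *: A - B| <= c.
  move=> hA; rewrite -[B]scale1r -(@mulVf _ l) ?gt_eqF// -scalerA -scalerBr normrZ.
  by rewrite normfV (gtr0_norm l0) mulrC ler_pdivrMr.
have [|h0 h1] := h p p l sp; first by rewrite subrr normr0 add0r gtr0_norm//; lra.
rewrite (gtr0_norm l0) in h0 h1.
have [|_ h2] := h p (p + l *: e0) l sp.
  rewrite opprD addrA subrr sub0r normrN normrZ (gtr0_norm l0).
  have : l * `|e0| <= l by rewrite ler_piMr ?(ltW l0)// norm_unit_vector.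
  move=> z; apply: le_lt_trans (lerD z (lexx l)) _.
  by rewrite -mulr2n -mulr_natr -ltr_pdivlMr.
rewrite (gtr0_norm l0) in h2.
have eh : e / 2 <= e by rewrite ler_pdivrMr// ler_peMr ?(ltW e_gt0)// ler1n.
split; [exact: le_trans (scale _ _ _ h0) eh|exact: le_trans (scale _ _ _ h1) eh|].
apply: scale.
have -> : phi (p + l *: e0 + l *: e1) - phi p - l *: (phi_u phi p + phi_v phi p) =
  (phi (p + l *: e0) - phi p - l *: phi_u phi p) +
  (phi (p + l *: e0 + l *: e1) - phi (p + l *: e0) - l *: phi_v phi p).
  move: (phi_u phi p) (phi_v phi p) => A B.
  move: (phi (p + l *: e0 + l *: e1)) (phi (p + l *: e0)) (phi p) => x1 x2 x3.
  by apply/rowP => j; rewrite !mxE; ring.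
apply: le_trans (ler_normD _ _) _; apply: le_trans (lerD h0 h2) _.
by rewrite -mulrDl -splitr.
Qed.

(** The inverse has continuous first partial derivatives on the open range, so
    it is Lipschitz near the compact image of the square. *)
Lemma phi_inverse_local_lipschitz : exists2 L, 0 < L & exists2 eta, 0 < eta &
  forall p q, sq p -> Omega q -> `|phi p - phi q| < eta -> `|q - p| <= L * `|phi q - phi p|.
Proof.
have [cphi _ [psi [psiK psi1]]] := C1.
have cD : compact (phi @` sq).
  apply: continuous_compact; last exact: unit_square_compact.
  apply: continuous_in_subspaceT => x; rewrite inE => sx.
  by apply: cphi; rewrite inE; exact: sqO.
have oD : open (phi @` Omega) by have [[]] := psi1 0.
have DO : phi @` sq `<=` phi @` Omega by move=> _ [x sx <-]; exists x => //; exact: sqO.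
have dpsi k x j : (phi @` Omega) x -> derivable (component psi k) x (delta_mx 0 j) /\
    {for x, continuous (partial j (component psi k))}.
  move=> Ox; have [[_ p0 c0] [_ p1 c1]] := psi1 k.
  case: (ord2_cases j) => ->; split.
  - by have [_ /(_ 0%N (ltn0Sn _))] := p0 x Ox.
  - by apply: c0; rewrite inE.
  - by have [/(_ 0%N (ltn0Sn _))] := p1 x Ox.
  - by apply: c1; rewrite inE.
have LL k := @local_lipschitz R _ _ (component psi k) oD cD DO
  (fun x j Ox => (dpsi k x j Ox).1) (fun x j Ox => (dpsi k x j Ox).2).
have [L0 [n0 n0p h0]] := LL 0; have [L1 [n1 n1p h1]] := LL 1.
exists (`|L0| + `|L1| + 1); first by rewrite ltr_pwDr// addr_ge0.
exists (Num.min n0 n1); first by rewrite lt_min n0p.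
move=> p q sp Oq; rewrite lt_min => /andP[l0 l1].
have pD : (phi @` sq) (phi p) by exists p.
have := h1 _ _ pD l1; have := h0 _ _ pD l0; rewrite /component.
rewrite !psiK ?inE//; last exact: sqO.
move=> c0 c1; apply: norm_le_coord => [|j].
  by rewrite mulr_ge0// !addr_ge0.
set N := `|phi q - phi p| in c0 c1 *.
have N0 : 0 <= N by exact: normr_ge0.
have : L0 * N <= `|L0| * N by rewrite ler_wpM2r// ler_norm.
have : L1 * N <= `|L1| * N by rewrite ler_wpM2r// ler_norm.
have : 0 <= `|L0| * N by rewrite mulr_ge0.
have : 0 <= `|L1| * N by rewrite mulr_ge0.
by rewrite !mxE; case: (ord2_cases j) => ->; lra.
Qed.

(** Distances between images that are bounded below are compared with the
    diameter of the square. *)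
Lemma phi_inverse_lipschitz : exists2 L, 0 < L &
  forall p q, sq p -> sq q -> `|q - p| <= L * `|phi q - phi p|.
Proof.
have [L L0 [eta eta0 h]] := phi_inverse_local_lipschitz.
exists (L + eta^-1); first by rewrite addr_gt0// invr_gt0.
move=> p q sp sq'; rewrite mulrDl; have N0 := normr_ge0 (phi q - phi p).
have [near|far] := ltP `|phi p - phi q| eta.
  apply: le_trans (h p q sp (sqO sq') near) _.
  by rewrite lerDl mulr_ge0// invr_ge0 ltW.
apply: (@le_trans _ _ 1).
  apply: norm_le_coord => // j; rewrite !mxE ler_norml.
  by have := sp j; have := sq' j => /andP[? ?] /andP[? ?]; apply/andP; split; lra.
have : 1 <= eta^-1 * `|phi q - phi p| by rewrite ler_pdivlMl// mulr1 distrC.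
have := mulr_ge0 (ltW L0) N0; lra.
Qed.

(** A vector almost annihilated by the differential would, after scaling, be a
    displacement that the diffeomorphism contracts by more than its inverse
    permits.  The factor 4 L leaves half of the Lipschitz bound to absorb the
    linearisation error. *)
Lemma phi_jacobian_lower p : sq p -> exists2 L, 0 < L &
  forall w : 'rV[R]_2, `|w| <= L * `|w 0 0 *: phi_u phi p + w 0 1 *: phi_v phi p|.
Proof.
move=> sp.
have [L L0 [eta eta0 h]] := phi_inverse_local_lipschitz.
exists (2 * L); first by rewrite mulr_gt0.
move=> w; have [->|w0] := eqVneq w 0; first by rewrite normr0 mulr_ge0// mulr_ge0// ltW.
have wN : 0 < `|w| by rewrite normr_gt0.
set J := w 0 0 *: phi_u phi p + w 0 1 *: phi_v phi p.
pose e := (4 * L)^-1.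
have e_gt0 : 0 < e by rewrite invr_gt0 mulr_gt0.
have [n1 n10 h1] := phi_uniform_first_order e_gt0.
have [n2 n20 h2] := compact_open_margin unit_square_compact oO sqO.
(* A step s w so small that linearisation, membership in the domain and the
   local Lipschitz bound are all available. *)
have [s [s0 s1 s2 s3]] : exists s, [/\ 0 < s, s * (3 * `|w|) <= n1,
    s * (3 * `|w|) <= n2 & s * (`|J| + 2 * e * `|w| + 1) <= eta].
  have S0 : 0 < `|J| + 2 * e * `|w| + 1 by rewrite ltr_pwDr// addr_ge0 ?mulr_ge0// ltW.
  exists (Num.min (Num.min (n1 / (3 * `|w|)) (n2 / (3 * `|w|))) (eta / (`|J| + 2 * e * `|w| + 1))).
  split.
  - by rewrite !lt_min !divr_gt0 ?mulr_gt0.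
  - by rewrite -ler_pdivlMr ?mulr_gt0// !ge_min lexx.
  - by rewrite -ler_pdivlMr ?mulr_gt0// !ge_min lexx orbT.
  - by rewrite -ler_pdivlMr// !ge_min lexx !orbT.
have c0 := coord_le_norm w 0; have c1 := coord_le_norm w 1.
pose q := p + (s * w 0 0) *: e0 + (s * w 0 1) *: e1.
have qE : q - p = s *: w.
  have -> : s *: w = (s * w 0 0) *: e0 + (s * w 0 1) *: e1.
    by rewrite -!scalerA -scalerDr -row2_decomp.
  by apply/eqP; rewrite subr_eq /q [X in _ == X]addrC addrA.
have sw : `|s *: w| = s * `|w| by rewrite normrZ gtr0_norm.
have swp : 0 < s * `|w| by rewrite mulr_gt0.
have [w1 w2] : 2 * (s * `|w|) < n1 /\ s * `|w| < n2.
  by clear -swp s1 s2; split; lra.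
have Oq : Omega q by apply: h2 sp _; rewrite ballrV distrC qE sw.
have z0 : `|s * w 0 0| <= s * `|w| by rewrite normrM (gtr0_norm s0) ler_wpM2l ?(ltW s0).
have z1 : `|s * w 0 1| <= s * `|w| by rewrite normrM (gtr0_norm s0) ler_wpM2l ?(ltW s0).
have [|f0 _] := h1 p p (s * w 0 0) sp.
  rewrite subrr normr0 add0r; apply: le_lt_trans z0 _; apply: le_lt_trans w1.
  by rewrite ler_peMl ?(ltW swp)// ler1n.
have [|_ f1] := h1 p (p + (s * w 0 0) *: e0) (s * w 0 1) sp.
  rewrite opprD addrA subrr sub0r normrN normrZ; apply: le_lt_trans w1.
  rewrite mulr_natl mulr2n; apply: lerD => //.
  by apply: le_trans z0; rewrite ler_piMr// norm_unit_vector.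
have D : `|phi q - phi p| <= s * (`|J| + 2 * e * `|w|).
  have -> : phi q - phi p = s *: J + ((phi (p + (s * w 0 0) *: e0) - phi p - (s * w 0 0) *: phi_u phi p) +
    (phi q - phi (p + (s * w 0 0) *: e0) - (s * w 0 1) *: phi_v phi p)).
    rewrite /J; move: (phi_u phi p) (phi_v phi p) (phi q) (phi p) (phi _) => A B x1 x2 x3.
    by apply/rowP => j; rewrite !mxE; ring.
  apply: le_trans (ler_normD _ _) _; rewrite normrZ (gtr0_norm s0).
  apply: le_trans (lerD (lexx _) (le_trans (ler_normD _ _) (lerD f0 f1))) _.
  have -> : s * (`|J| + 2 * e * `|w|) = s * `|J| + (e * (s * `|w|) + e * (s * `|w|)) by ring.
  by rewrite lerD2l lerD// ler_wpM2l ?(ltW e_gt0).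
have := h p q sp Oq.
rewrite distrC qE sw => H.
have {}H : s * `|w| <= L * (s * (`|J| + 2 * e * `|w|)).
  apply: le_trans (H _) _; last by rewrite ler_wpM2l// ltW.
  apply: le_lt_trans D _; apply: lt_le_trans s3.
  by rewrite ltr_pM2l// ltrDl.
rewrite mulrCA ler_pM2l// in H.
have : L * (2 * e * `|w|) = `|w| / 2 by rewrite /e; field; rewrite gt_eqF.
move: H; rewrite mulrDr => H1 H2; rewrite H2 in H1.
by clear -H1; move: H1; move: (`|w|) => x; rewrite -mulrA; move: (L * _) => y; lra.
Qed.

Lemma phi_jacobian_neq0 p : sq p ->
  phi_u phi p 0 0 * phi_v phi p 0 1 - phi_v phi p 0 0 * phi_u phi p 0 1 != 0.
Proof.
move=> /phi_jacobian_lower[L L0 h]; apply/eqP.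
move: h; move: (phi_u phi p) (phi_v phi p) => a b h det0.
have null (x y : R) : x *: a + y *: b = 0 -> x = 0 /\ y = 0.
  move=> xy; have := h (plane_pt x y); rewrite !mxE /= xy normr0 mulr0 => N0.
  have := le_trans (coord_le_norm (plane_pt x y) 0) N0.
  have := le_trans (coord_le_norm (plane_pt x y) 1) N0.
  by rewrite !mxE /= !normr_le0 => /eqP-> /eqP->.
have [b1 a1] : b 0 1 = 0 /\ - a 0 1 = 0.
  apply: null; apply/rowP => j; rewrite !mxE; case: (ord2_cases j) => ->; last by ring.
  by rewrite -[RHS]det0; ring.
have [b0 a0] : b 0 0 = 0 /\ - a 0 0 = 0.
  apply: null; apply/rowP => j; rewrite !mxE; case: (ord2_cases j) => ->; first by ring.
  by rewrite -[RHS]oppr0 -det0; ring.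
have [/eqP] : (1 : R) = 0 /\ (0 : R) = 0; last by rewrite oner_eq0.
apply: null; rewrite scale0r addr0 scale1r; apply/rowP => j; rewrite mxE.
by case: (ord2_cases j) => ->; apply/eqP; rewrite -oppr_eq0; apply/eqP.
Qed.

(** The range is open and the inverse is Lipschitz, so points near the image of
    the centre come from points within 1/2 of the centre. *)
Lemma phi_range_ball : exists x0, exists2 e, 0 < e &
  forall h, `|h| < e -> (phi @` sq) (x0 + h).
Proof.
have [L L0 [eta eta0 hL]] := phi_inverse_local_lipschitz.
pose m : 'rV[R]_2 := plane_pt 2^-1 2^-1.
have mE j : m 0 j = 2^-1 by rewrite mxE; case: ifP.
have sm : sq m by move=> j; rewrite mE; apply/andP; split; lra.
have [_ _ [psi [_ /(_ 0)[[oD _ _] _]]]] := C1.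
have [|r r0 hr] := @compact_open_margin R 'rV[R]_2 _ _ (@compact_set1 _ (phi m)) oD.
  by move=> _ ->; exists m => //; exact: sqO.
exists (phi m), (Num.min r (Num.min eta (2 * L)^-1)).
  by rewrite !lt_min r0 eta0 invr_gt0 mulr_gt0.
move=> h; rewrite !lt_min => /and3P[hr1 heta hL1].
have [||q Oq qE] := hr (phi m) (phi m + h).
    by [].
  by rewrite ballrV opprD addrA subrr sub0r normrN.
have := hL m q sm Oq; rewrite qE opprD addrA subrr sub0r normrN => /(_ heta).
have -> : phi m + h - phi m = h by rewrite addrAC subrr add0r.
move=> qm; exists q => // j.
have : `|(q - m) 0 j| <= 2^-1.
  apply: le_trans (coord_le_norm _ _) _; apply: le_trans qm _.
  have := ler_wpM2l (ltW L0) (ltW hL1).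
  have -> : L * (2 * L)^-1 = 2^-1 by field; rewrite gt_eqF.
  by [].
rewrite !mxE (_ : (if _ then _ else _) = 2^-1); last by case: ifP.
by rewrite ler_norml => /andP[? ?]; apply/andP; split; lra.
Qed.

End diffeo.

(** * The logarithmic deformation of powers *)

Section kappa.
Context {R : realType}.

(** The slope of the exponential between 0 and y, continuous at 0.  It makes
    [kappa] jointly continuous through the exponent 1, where the formula
    with a quotient breaks down. *)
Definition exp_slope (y : R) : R := if y == 0 then 1 else (expR y - 1) / y.

Lemma exp_slopeE (y : R) : y * exp_slope y = expR y - 1.
Proof.
rewrite /exp_slope; case: eqVneq => [->|y0]; first by rewrite expR0 mul0r subrr.
by rewrite mulrC divfK.
Qed.

Lemma expR_tangent (y z : R) : expR y * (1 + (z - y)) <= expR z.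
Proof.
have -> : expR z = expR y * expR (z - y) by rewrite -expRD addrC subrK.
by rewrite ler_wpM2l ?expR_ge0// expR_ge1Dx.
Qed.

Lemma exp_slope_near0 (y : R) : `|y| <= 2^-1 -> `|exp_slope y - 1| <= 2 * `|y|.
Proof.
move=> y12; rewrite /exp_slope; case: eqVneq => [->|y0].
  by rewrite subrr normr0 mulr0.
have h1 := expR_ge1Dx y; have h2 := expR_tangent y 0; rewrite expR0 sub0r in h2.
have -> : (expR y - 1) / y - 1 = (expR y - 1 - y) / y by field.
rewrite normrM normfV ler_pdivrMr ?normr_gt0// ger0_norm; last by lra.
rewrite -mulrA -expr2 real_normK ?num_real//.
move: y12; rewrite ler_norml => /andP[ya yb]; nra.
Qed.

Lemma exp_slope_continuous : continuous exp_slope.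
Proof.
move=> y; have [->|y0] := eqVneq y 0.
  apply/cvgrPdist_lt => e e0; near=> z.
  have -> : exp_slope 0 = 1 by rewrite /exp_slope eqxx.
  have z1 : `|0 - z| <= 2^-1 by near: z; apply: cvgr_dist_le => //; rewrite invr_gt0.
  have z2 : `|0 - z| < e / 2 by near: z; apply: cvgr_dist_lt => //; rewrite divr_gt0.
  rewrite sub0r normrN in z1 z2; rewrite distrC.
  apply: le_lt_trans (exp_slope_near0 z1) _; lra.
have : (expR z - 1) / z @[z --> y] --> exp_slope y.
  rewrite /exp_slope (negbTE y0); apply: cvgM; last exact: cvgV.
  by apply: cvgB; [exact: continuous_expR|exact: cvg_cst].
apply: cvg_trans; apply: near_eq_cvg; near=> z.
have yz : `|y - z| < `|y| by near: z; apply: cvgr_dist_lt => //; rewrite normr_gt0.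
have z0 : z != 0 by apply: contraTneq yz => ->; rewrite subr0 ltxx.
by rewrite /exp_slope (negbTE z0).
Unshelve. all: end_near. Qed.

(** The function (x^t - x) / (t - 1) and its limit x ln x at t = 1, in one
    continuous formula. *)
Definition kappa (t x : R) : R := x * (ln x * exp_slope ((t - 1) * ln x)).

Lemma kappa_neq1 (t x : R) : 0 < x -> (t - 1) * kappa t x = x `^ t - x.
Proof.
move=> x0; rewrite /kappa mulrCA (mulrA (t - 1)) exp_slopeE mulrBr mulr1.
rewrite /powR gt_eqF// -{1}(lnK (x := x)) ?posrE// -expRD; congr (expR _ - _); ring.
Qed.

Lemma kappa1 (x : R) : kappa 1 x = x * ln x.
Proof. by rewrite /kappa subrr mul0r /exp_slope eqxx mulr1. Qed.

(** The logarithmic term of the exponent 1 is hidden in the second summand,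
    which is linear in x and hence annihilated by the stencil. *)
Lemma kappaM (t l x : R) : 0 < l -> 0 < x ->
  kappa t (l * x) = l `^ t * kappa t x + x * kappa t l.
Proof.
move=> l0 x0; have [->|t1] := eqVneq t 1.
  by rewrite !kappa1 powRr1 ?ltW// lnM ?posrE//; ring.
have t10 : t - 1 != 0 by rewrite subr_eq0.
apply: (mulfI t10).
have -> : (t - 1) * (l `^ t * kappa t x + x * kappa t l) =
  l `^ t * ((t - 1) * kappa t x) + x * ((t - 1) * kappa t l) by ring.
rewrite !kappa_neq1 ?mulr_gt0//.
by rewrite powRM ?ltW//; ring.
Qed.

Lemma kappa_continuous (M : topologicalType) (F G : M -> R) (m : M) :
  {for m, continuous F} -> {for m, continuous G} -> 0 < G m ->
  {for m, continuous (fun z => kappa (F z) (G z))}.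
Proof.
move=> cF cG G0.
have cL : {for m, continuous (fun z => ln (G z))}.
  by apply: continuous_comp => //; exact: continuous_ln.
apply: cvgM => //; apply: cvgM => //.
apply: (@continuous_comp _ _ _ (fun z => (F z - 1) * ln (G z)) exp_slope).
  by apply: cvgM => //; apply: cvgB => //; exact: cvg_cst.
exact: exp_slope_continuous.
Qed.

(** The function [kappa t] is convex with tangent x - 1 at x = 1; the proof
    combines tangent lines of the exponential at t ln x or at ln x. *)
Lemma kappa_ge_tangent (t x : R) : 0 <= t -> 0 < x -> x - 1 <= kappa t x.
Proof.
move=> t0 x0; set L := ln x.
have xE : x = expR L by rewrite /L lnK.
have [t1|t1|->] := ltgtP t 1.
- have t10 : 0 < 1 - t by lra.
  rewrite -(ler_pM2l t10) -[leRHS]opprK -mulNr opprB kappa_neq1//.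
  rewrite /powR gt_eqF// -/L.
  have h1 := expR_tangent (t * L) L; have h2 := expR_tangent (t * L) 0.
  rewrite -xE in h1; rewrite expR0 in h2.
  have a1 := ler_wpM2l t0 h1; have a2 := ler_wpM2l (ltW t10) h2.
  move: a1 a2; set E := expR (t * L) => a1 a2.
  have : E <= t * x + (1 - t) * 1.
    apply: le_trans (lerD a1 a2); rewrite le_eqVlt; apply/orP; left; apply/eqP; ring.
  lra.
- have t10 : 0 < t - 1 by lra.
  rewrite -(ler_pM2l t10) kappa_neq1//.
  rewrite /powR gt_eqF// -/L.
  have h1 := expR_tangent L (t * L); have h2 := expR_tangent L 0.
  rewrite -xE in h1 h2; rewrite expR0 in h2.
  have a2 := ler_wpM2l (ltW t10) h2.
  move: h1 a2; set E := expR (t * L) => h1 a2.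
  have : t * x <= E + (t - 1) * 1.
    apply: le_trans (lerD h1 a2); rewrite le_eqVlt; apply/orP; left; apply/eqP; ring.
  lra.
- rewrite kappa1 -/L; have := expR_tangent L 0; rewrite expR0 -xE; lra.
Qed.

(** The quotient of [kappa t x] by x is increasing in x. *)
Lemma kappa_superadditive (t x y : R) : 0 < x -> 0 < y ->
  kappa t x + kappa t y < kappa t (x + y).
Proof.
move=> x0 y0; have xy0 : 0 < x + y by exact: addr_gt0.
have split_pow z : 0 < z -> z `^ t = z * z `^ (t - 1).
  move=> z0; rewrite -{2}[z]powRr1 ?ltW// -powRD; first by congr (_ `^ _); ring.
  by rewrite (gt_eqF z0) implybT.
have [t1|t1|->] := ltgtP t 1.
- have t10 : 0 < 1 - t by lra.
  rewrite -(ltr_pM2l t10) mulrDr.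
  have e z : (1 - t) * kappa t z = - ((t - 1) * kappa t z) by ring.
  rewrite !e !kappa_neq1// !split_pow//.
  have mono u v : 0 < u -> u < v -> v `^ (t - 1) < u `^ (t - 1).
    move=> u0 uv; rewrite -(opprB 1 t) !powRN ltf_pV2 ?posrE ?powR_gt0 ?(lt_trans u0 uv)//.
    by apply: gt0_ltr_powR => //; rewrite nnegrE ltW// (lt_trans u0).
  have h1 := mono x (x + y) x0; rewrite ltrDl in h1.
  have h2 := mono y (x + y) y0; rewrite ltrDr in h2.
  have {}h1 := h1 y0; have {}h2 := h2 x0.
  by rewrite -(ltr_pM2l x0) in h1; rewrite -(ltr_pM2l y0) in h2; lra.
- have t10 : 0 < t - 1 by lra.
  rewrite -(ltr_pM2l t10) mulrDr !kappa_neq1// !split_pow//.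
  have h1 : x `^ (t - 1) < (x + y) `^ (t - 1).
    by apply: gt0_ltr_powR => //; rewrite ?nnegrE ?ltW// ltrDl.
  have h2 : y `^ (t - 1) < (x + y) `^ (t - 1).
    by apply: gt0_ltr_powR => //; rewrite ?nnegrE ?ltW// ltrDr.
  by rewrite -(ltr_pM2l x0) in h1; rewrite -(ltr_pM2l y0) in h2; lra.
- rewrite !kappa1.
  have h1 : ln x < ln (x + y) by rewrite ltr_ln ?posrE// ltrDl.
  have h2 : ln y < ln (x + y) by rewrite ltr_ln ?posrE// ltrDr.
  by rewrite -(ltr_pM2l x0) in h1; rewrite -(ltr_pM2l y0) in h2; lra.
Qed.

(** By scaling one may assume x + y = 1 and p + p' = 2.  Then the sum of the
    first two terms is at least 0 by the tangent at 1, and that of the last two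
    is less than [kappa t 1], which is 0. *)
Lemma kappa_parallelogram (t p p' x y : R) : 0 <= t -> 0 < p -> 0 < p' ->
  0 < x -> 0 < y -> p + p' = 2 * (x + y) ->
  0 < kappa t p + kappa t p' - 2 * kappa t x - 2 * kappa t y.
Proof.
move=> t0 p0 p'0 x0 y0 pE.
have m0 : 0 < x + y by exact: addr_gt0.
set m := x + y in m0 pE *.
have E z : 0 < z -> kappa t z = m `^ t * kappa t (z / m) + z / m * kappa t m.
  by move=> z0; rewrite -kappaM ?divr_gt0// mulrC divfK// gt_eqF.
have mt : 0 <= m `^ t by exact: powR_ge0.
have h1 := kappa_ge_tangent t0 (divr_gt0 p0 m0).
have h2 := kappa_ge_tangent t0 (divr_gt0 p'0 m0).
have pm : p / m + p' / m = 2 by rewrite -mulrDl pE mulfK// gt_eqF.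
have h3 := kappa_superadditive t x0 y0; rewrite -/m in h3.
rewrite (E p)// (E p')//.
have h4 : 0 <= m `^ t * (kappa t (p / m) + kappa t (p' / m)) by rewrite mulr_ge0//; lra.
have h5 : p / m * kappa t m + p' / m * kappa t m = 2 * kappa t m by rewrite -mulrDl pm.
rewrite mulrDr in h4; lra.
Qed.

(** The identity [Gfun t s] = slope * [kappa t (s^2)] + quad * s^2 turns the case
    distinction on integer exponents into a choice of constants. *)
Definition Gfun_slope (t : R) : R := if t == 1 then 2^-1 else t - 1.
Definition Gfun_quad (t : R) : R := if t == 1 then 0 else 1.

Lemma Gfun_slope_neq0 t : Gfun_slope t != 0.
Proof.
rewrite /Gfun_slope; case: (eqVneq t 1) => [_|t1]; last by rewrite subr_eq0.
by rewrite invr_eq0 pnatr_eq0.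
Qed.

Lemma Gfun_kappa (t s : R) : 0 < t < 2 -> 0 < s ->
  Gfun t s = Gfun_slope t * kappa t (s ^+ 2) + Gfun_quad t * s ^+ 2.
Proof.
move=> /andP[t0 t2] s0; rewrite /Gfun gt_eqF// /Gfun_slope /Gfun_quad.
have s20 : 0 < s ^+ 2 by rewrite exprn_gt0.
have [->|t1] := eqVneq t 1.
  rewrite mulr1 ifT; last exact: rpred1.
  by rewrite kappa1 mul0r addr0 -[in RHS]powR_mulrn ?ltW// ln_powR; field.
rewrite ifF; last first.
  apply/negP => /intrP[z tz]; move: t0 t2 t1; rewrite tz.
  have -> : (2 : R) = 2%:~R by [].
  have -> : (1 : R) = 1%:~R by [].
  by rewrite ltr0z ltr_int eqr_int; lia.
by rewrite mul1r kappa_neq1// subrK -[in RHS]powR_mulrn ?ltW// -powRrM.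
Qed.

End kappa.

(** * The four-point stencil *)

Section stencil.
Context {R : realType}.
Implicit Types (e f g v : 'rV[R]_2) (ell : 'I_2).

Definition det2 e f : R := e 0 0 * f 0 1 - e 0 1 * f 0 0.
Definition sqnorm v : R := v 0 0 ^+ 2 + v 0 1 ^+ 2.
Definition osign ell : R := if ell == 0 then 1 else -1.
(** The two entries of row [ell] of the inverse of the matrix with rows e and
    f, in closed form so that their continuity in e and f is visible. *)
Definition inv_left e f ell : R := osign ell * f 0 (rev_ord ell) / det2 e f.
Definition inv_right e f ell : R := - (osign ell * e 0 (rev_ord ell)) / det2 e f.

Lemma rev_ord2_0 : rev_ord (0 : 'I_2) = 1. Proof. exact: val_inj. Qed.
Lemma rev_ord2_1 : rev_ord (1 : 'I_2) = 0. Proof. exact: val_inj. Qed.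

(** Cramer's rule, with the inverse exhibited explicitly. *)
Lemma invmx_col2 e f ell : det2 e f != 0 ->
  (invmx (col_mx e f : 'M[R]_2) ell 0 = inv_left e f ell) /\
  (invmx (col_mx e f : 'M[R]_2) ell 1 = inv_right e f ell).
Proof.
move=> d0; pose X : 'M[R]_2 := \matrix_(i, j) if j == 0 then inv_left e f i else inv_right e f i.
have A0 : (col_mx e f : 'M[R]_2) 0 =1 e 0.
  move=> j; transitivity ((col_mx e f : 'M[R]_(1 + 1, 2)) (lshift 1 0) j).
    by congr (fun_of_matrix _ _ _); exact: val_inj.
  exact: col_mxEu.
have A1 : (col_mx e f : 'M[R]_2) 1 =1 f 0.
  move=> j; transitivity ((col_mx e f : 'M[R]_(1 + 1, 2)) (rshift 1 0) j).
    by congr (fun_of_matrix _ _ _); exact: val_inj.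
  exact: col_mxEd.
have XA : X *m (col_mx e f : 'M[R]_2) = 1%:M.
  apply/matrixP => i j; rewrite !mxE big_ord_recl big_ord1.
  have -> : lift ord0 (0 : 'I_1) = 1 :> 'I_2 by exact: val_inj.
  rewrite A0 A1 !mxE /= /inv_left /inv_right /osign /det2.
  rewrite /det2 in d0.
  case: (ord2_cases i) => ->; case: (ord2_cases j) => ->;
    rewrite ?rev_ord2_0 ?rev_ord2_1 /=; by field.
have AX : (col_mx e f : 'M[R]_2) *m X = 1%:M by exact: mulmx1C.
have [uA uX] := mulmx1_unit AX.
have -> : invmx (col_mx e f : 'M[R]_2) = X by rewrite -[LHS]mul1mx -XA mulmxK.
by rewrite !mxE.
Qed.

(** The coefficients of nabla for a quadrilateral with vertices 0, e, f, g: the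
    row [ell] of the two inverse matrices. *)
Definition stencil_coef ell e f g (k : bool * bool) : R :=
  match k with
  | (false, false) => inv_left e f ell + inv_right e f ell
  | (true, false) => inv_left (e - g) (f - g) ell - inv_left e f ell
  | (false, true) => inv_right (e - g) (f - g) ell - inv_right e f ell
  | (true, true) => - (inv_left (e - g) (f - g) ell + inv_right (e - g) (f - g) ell)
  end.

Definition stencil_pt e f g (k : bool * bool) : 'rV[R]_2 :=
  match k with
  | (false, false) => 0 | (true, false) => e | (false, true) => f | (true, true) => g
  end.

Lemma big_bool2 (V : nmodType) (F : bool * bool -> V) :
  \sum_k F k = F (true, true) + F (true, false) + (F (false, true) + F (false, false)).
Proof.
transitivity (\sum_(k1 : bool) \sum_(k2 : bool) F (k1, k2)).
  by rewrite pair_bigA; apply: eq_bigr => -[].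
by rewrite !big_bool.
Qed.

Lemma stencil_coef_sum ell e f g : \sum_k stencil_coef ell e f g k = 0.
Proof. by rewrite big_bool2 /=; ring. Qed.

(** Each of the two difference quotients that make up nabla recovers the
    coordinate [ell] of the gradient of an affine function exactly, and nabla is
    their difference. *)
Lemma stencil_coef_linear ell e f g :
  det2 e f != 0 -> det2 (e - g) (f - g) != 0 ->
  \sum_k stencil_coef ell e f g k *: stencil_pt e f g k = 0.
Proof.
move=> d1 d2; apply/rowP => j; rewrite big_bool2 !mxE /=.
move: d1 d2; rewrite /inv_left /inv_right /osign /det2 !mxE => d1 d2.
case: (ord2_cases ell) => ->; case: (ord2_cases j) => ->;
  rewrite ?rev_ord2_0 ?rev_ord2_1 /=; by field; rewrite d1 d2.
Qed.

(** The quadratic form of the coefficients against [kappa], with the mesh scaled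
    away. *)
Definition stencil_form ell (t : R) e f g : R :=
  \sum_k \sum_(l | k != l) stencil_coef ell e f g k * stencil_coef ell e f g l *
     kappa t (sqnorm (stencil_pt e f g k - stencil_pt e f g l)).

(** The squared distance is a polynomial of degree 2 in the difference. *)
Lemma affine_null_sqnorm (c : bool * bool -> R) (P : bool * bool -> 'rV[R]_2) :
  \sum_k c k = 0 -> \sum_k c k *: P k = 0 ->
  \sum_k \sum_(l | k != l) c k * c l * sqnorm (P k - P l) = 0.
Proof.
move=> c0 cP.
have cPj j : \sum_k c k * P k 0 j = 0.
  move: cP => /(congr1 (fun M : 'rV[R]_2 => M 0 j)); rewrite summxE [X in _ = X]mxE => E.
  by rewrite -[RHS]E; apply: eq_bigr => k _; rewrite mxE.
transitivity (\sum_k \sum_l c k * c l * sqnorm (P k - P l)).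
  apply: eq_bigr => k _; rewrite [RHS](bigD1 k)//= subrr /sqnorm !mxE expr0n /= addr0 mulr0 add0r.
  by apply: eq_bigl => l; rewrite eq_sym.
transitivity (\sum_k \sum_l c k * c l * ((P k 0 0 - P l 0 0) ^+ 2 * (P k 0 1 - P l 0 1) ^+ 0) +
   \sum_k \sum_l c k * c l * ((P k 0 0 - P l 0 0) ^+ 0 * (P k 0 1 - P l 0 1) ^+ 2)).
  rewrite -big_split; apply: eq_bigr => k _ /=; rewrite -big_split; apply: eq_bigr => l _ /=.
  by rewrite /sqnorm !mxE !expr0; ring.
by rewrite !affine_null_cubic ?addr0.
Qed.

(** For a parallelogram the four coefficients are w and -w in alternation, so
    sides, of which there are two of each length, and diagonals enter with
    opposite signs. *)
Lemma stencil_form_limit ell t (a b : 'rV[R]_2) : det2 a b != 0 ->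
  stencil_form ell t a b (a + b) =
  2 * ((b 0 (rev_ord ell) - a 0 (rev_ord ell)) / det2 a b) ^+ 2 *
  (kappa t (sqnorm (a + b)) + kappa t (sqnorm (b - a)) -
    2 * kappa t (sqnorm a) - 2 * kappa t (sqnorm b)).
Proof.
move=> d0; set w := (b 0 _ - a 0 _) / _.
have e1 : a - (a + b) = - b by rewrite opprD addrA subrr sub0r.
have e2 : b - (a + b) = - a by rewrite opprD addrCA subrr addr0.
have dd : det2 (- b) (- a) = - det2 a b by rewrite /det2 !mxE; ring.
have s2 : osign ell ^+ 2 = 1.
  by rewrite /osign; case: ifP => _; rewrite ?expr1n// sqrrN expr1n.
have c00 : stencil_coef ell a b (a + b) (false, false) = osign ell * w.
  by rewrite /= /inv_left /inv_right /w; field.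
have c10 : stencil_coef ell a b (a + b) (true, false) = - (osign ell * w).
  by rewrite /= e1 e2 /inv_left /inv_right dd /w !mxE; field; rewrite ?oppr_eq0.
have c01 : stencil_coef ell a b (a + b) (false, true) = - (osign ell * w).
  by rewrite /= e1 e2 /inv_left /inv_right dd /w !mxE; field; rewrite ?oppr_eq0.
have c11 : stencil_coef ell a b (a + b) (true, true) = osign ell * w.
  by rewrite /= e1 e2 /inv_left /inv_right dd /w !mxE; field; rewrite ?oppr_eq0.
have sqN v : sqnorm (- v) = sqnorm v by rewrite /sqnorm !mxE !sqrrN.
rewrite /stencil_form; set c := stencil_coef ell a b (a + b) in c00 c10 c01 c11 *; clearbody c.
under eq_bigr do rewrite big_mkcond.
rewrite !big_bool2 /= !add0r !addr0.
rewrite c00 c10 c01 c11.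
rewrite e1 e2 !subr0 !sqN -(opprB b a) sqN.
have -> : a + b - a = b by rewrite addrAC subrr add0r.
have -> : a + b - b = a by rewrite addrK.
have W : forall x : R, osign ell * w * (osign ell * w) * x = w ^+ 2 * x.
  by move=> x; rewrite mulrACA -!expr2 s2 mul1r.
rewrite ?mulrN ?mulNr ?opprK !W; ring.
Qed.

Lemma sqnorm_gt0 v : v != 0 -> 0 < sqnorm v.
Proof.
move=> v0; rewrite lt_def; apply/andP; split; last by rewrite /sqnorm addr_ge0// sqr_ge0.
apply: contraNneq v0; rewrite /sqnorm => h.
have h0 := sqr_ge0 (v 0 0); have h1 := sqr_ge0 (v 0 1).
have v00 : v 0 0 = 0 by apply/eqP; rewrite -sqrf_eq0; apply/eqP; lra.
have v01 : v 0 1 = 0 by apply/eqP; rewrite -sqrf_eq0; apply/eqP; lra.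
by apply/eqP/rowP => j; rewrite mxE; case: (ord2_cases j) => ->.
Qed.

Lemma det2_distinct (a b : 'rV[R]_2) : det2 a b != 0 ->
  [/\ a != 0, b != 0, a + b != 0 & b - a != 0].
Proof.
move=> d0; split; apply: contraNneq d0 => h.
- by rewrite h /det2 !mxE; apply/eqP; ring.
- by rewrite h /det2 !mxE; apply/eqP; ring.
- have -> : b = - a by apply/eqP; rewrite -addr_eq0 addrC h.
  by rewrite /det2 !mxE; apply/eqP; ring.
- have -> : b = a by apply/eqP; rewrite -subr_eq0 h.
  by rewrite /det2; apply/eqP; ring.
Qed.

Lemma stencil_gap_gt0 t (a b : 'rV[R]_2) : 0 <= t -> det2 a b != 0 ->
  0 < kappa t (sqnorm (a + b)) + kappa t (sqnorm (b - a)) -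
    2 * kappa t (sqnorm a) - 2 * kappa t (sqnorm b).
Proof.
move=> t0 /det2_distinct[a0 b0 ab ba].
apply: kappa_parallelogram; rewrite ?sqnorm_gt0//.
by rewrite /sqnorm !mxE; ring.
Qed.

Lemma continuous_sum (M : topologicalType) (I : Type) (r : seq I) (Q : pred I)
    (F : I -> M -> R) (m : M) :
  (forall i, Q i -> {for m, continuous (F i)}) ->
  {for m, continuous (fun z => \sum_(i <- r | Q i) F i z)}.
Proof.
move=> h; elim: r => [|i r ih].
  have -> : (fun z : M => \sum_(i <- [::] | Q i) F i z) = (fun=> 0).
    by apply/funext => z; rewrite big_nil.
  exact: cvg_cst.
have -> : (fun z : M => \sum_(j <- i :: r | Q j) F j z) =
    (fun z => (if Q i then F i z else 0) + \sum_(j <- r | Q j) F j z).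
  by apply/funext => z; rewrite big_cons; case: ifP => _; rewrite ?add0r.
by apply: cvgD => //; case: ifP => Qi; [exact: h|exact: cvg_cst].
Qed.

Lemma continuous_det2 (M : topologicalType) (E F : M -> 'rV[R]_2) (m : M) :
  {for m, continuous E} -> {for m, continuous F} ->
  {for m, continuous (fun z => det2 (E z) (F z))}.
Proof.
by move=> cE cF; apply: cvgB; apply: cvgM; exact: continuous_rV_coord.
Qed.

Lemma continuous_sqnorm (M : topologicalType) (E : M -> 'rV[R]_2) (m : M) :
  {for m, continuous E} -> {for m, continuous (fun z => sqnorm (E z))}.
Proof. by move=> cE; apply: cvgD; apply: cvgM; exact: continuous_rV_coord. Qed.

Lemma continuous_inv2 (M : topologicalType) (E F : M -> 'rV[R]_2) (m : M) ell :
  {for m, continuous E} -> {for m, continuous F} -> det2 (E m) (F m) != 0 ->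
  {for m, continuous (fun z => inv_left (E z) (F z) ell)} /\
  {for m, continuous (fun z => inv_right (E z) (F z) ell)}.
Proof.
move=> cE cF d0; have cd : {for m, continuous (fun z => (det2 (E z) (F z))^-1)}.
  by apply: cvgV => //; exact: continuous_det2.
split; apply: cvgM => //; first by apply: cvgM; [exact: cvg_cst|exact: continuous_rV_coord].
by apply: cvgN; apply: cvgM; [exact: cvg_cst|exact: continuous_rV_coord].
Qed.

Lemma continuous_stencil_coef (M : topologicalType) (E F G : M -> 'rV[R]_2) (m : M) ell k :
  {for m, continuous E} -> {for m, continuous F} -> {for m, continuous G} ->
  det2 (E m) (F m) != 0 -> G m = E m + F m ->
  {for m, continuous (fun z => stencil_coef ell (E z) (F z) (G z) k)}.
Proof.
move=> cE cF cG d0 GE.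
have cEG : {for m, continuous (fun z => E z - G z)} by exact: cvgB.
have cFG : {for m, continuous (fun z => F z - G z)} by exact: cvgB.
have d1 : det2 (E m - G m) (F m - G m) != 0.
  rewrite GE; apply: contraNneq d0 => h; rewrite -oppr_eq0 -h /det2 !mxE; apply/eqP; ring.
have [cl cr] := continuous_inv2 ell cE cF d0.
have [cl' cr'] := continuous_inv2 ell cEG cFG d1.
case: k => -[] [] /=.
- by apply: cvgN; exact: cvgD.
- exact: cvgB.
- exact: cvgB.
- exact: cvgD.
Qed.

(** The four points must be distinct at m, because [kappa] is jointly continuous
    only where its second argument is positive; nondegeneracy of the limiting
    parallelogram ensures it. *)
Lemma continuous_stencil_form (M : topologicalType) (t : M -> R) (E F G : M -> 'rV[R]_2)
    (m : M) ell :
  {for m, continuous t} -> {for m, continuous E} -> {for m, continuous F} ->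
  {for m, continuous G} -> det2 (E m) (F m) != 0 -> G m = E m + F m ->
  {for m, continuous (fun z => stencil_form ell (t z) (E z) (F z) (G z))}.
Proof.
move=> ct cE cF cG d0 GE.
have cc k : {for m, continuous (fun z => stencil_coef ell (E z) (F z) (G z) k)}.
  exact: continuous_stencil_coef.
have cp k : {for m, continuous (fun z => stencil_pt (E z) (F z) (G z) k)}.
  by case: k => -[] []; [exact: cG|exact: cE|exact: cF|exact: cvg_cst].
have [E0 F0 EF FE] := det2_distinct d0.
have dist k l : k != l -> stencil_pt (E m) (F m) (G m) k - stencil_pt (E m) (F m) (G m) l != 0.
  have N v : v != 0 -> - v != 0 by rewrite oppr_eq0.
  have FE' : E m - F m != 0 by rewrite -opprB; exact: N.
  have G0 : G m != 0 by rewrite GE.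
  have e1 : E m - G m != 0 by rewrite GE opprD addrA subrr sub0r; exact: N.
  have e2 : F m - G m != 0 by rewrite GE opprD addrCA subrr addr0; exact: N.
  have e1' : G m - E m != 0 by rewrite -opprB; exact: N.
  have e2' : G m - F m != 0 by rewrite -opprB; exact: N.
  by case: k => -[] []; case: l => -[] [] //= _; rewrite ?sub0r ?subr0//; exact: N.
apply: continuous_sum => k _; apply: continuous_sum => l kl.
apply: cvgM; first by apply: cvgM; exact: cc.
have cd : {for m, continuous (fun z => stencil_pt (E z) (F z) (G z) k - stencil_pt (E z) (F z) (G z) l)}.
  by apply: cvgB; exact: cp.
have cq : {for m, continuous (fun z => sqnorm (stencil_pt (E z) (F z) (G z) k - stencil_pt (E z) (F z) (G z) l))}.
  exact: continuous_sqnorm.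
apply: (@kappa_continuous R M t _ m ct cq); exact/sqnorm_gt0/dist.
Qed.

End stencil.

(** * Stencils of vanishing mesh *)

Section stencil_asymptotics.
Context {R : realType}.
Implicit Types (p v : 'rV[R]_2) (ell : 'I_2).
Local Notation e0 := (delta_mx 0 0 : 'rV[R]_2).
Local Notation e1 := (delta_mx 0 1 : 'rV[R]_2).
Local Notation sq := (@unit_square R).
Variables (Omega : set 'rV[R]_2) (phi : 'rV[R]_2 -> 'rV[R]_2).
Hypothesis sqO : sq `<=` Omega.
Hypothesis C1 : C1_diffeo Omega phi.
Local Notation a := (phi_u phi).
Local Notation b := (phi_v phi).

(** The sites around a given one, recentred and divided by the mesh. *)
Definition step_u (l : R) p := l^-1 *: (phi (p + l *: e0) - phi p).
Definition step_v (l : R) p := l^-1 *: (phi (p + l *: e1) - phi p).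
Definition step_uv (l : R) p := l^-1 *: (phi (p + l *: e0 + l *: e1) - phi p).

Definition limit_stencil (m : R * 'rV[R]_2) : R * ('rV[R]_2 * ('rV[R]_2 * 'rV[R]_2)) :=
  (m.1, (a m.2, (b m.2, a m.2 + b m.2))).

(** Exponents and base points together, so that a single compactness argument
    gives uniformity in both. *)
Definition param_set : set (R * 'rV[R]_2) := `[0, 2]%classic `*` sq.

Lemma param_set_compact : compact param_set.
Proof. by apply: compact_setX; [exact: segment_compact|exact: unit_square_compact]. Qed.

Lemma continuous_limit_u m : param_set m -> {for m, continuous (fun z => a z.2)}.
Proof.
move=> [_ sm]; apply: (@continuous_comp _ _ _ snd a); first exact: cvg_snd.
by apply: (continuous_phi_u C1); exact: sqO.
Qed.

Lemma continuous_limit_v m : param_set m -> {for m, continuous (fun z => b z.2)}.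
Proof.
move=> [_ sm]; apply: (@continuous_comp _ _ _ snd b); first exact: cvg_snd.
by apply: (continuous_phi_v C1); exact: sqO.
Qed.

Lemma continuous_pair (M : topologicalType) (U V : topologicalType) (f : M -> U) (g : M -> V) (m : M) :
  {for m, continuous f} -> {for m, continuous g} -> {for m, continuous (fun z => (f z, g z))}.
Proof.
move=> cf cg.
have := @cvg_pair M U V (nbhs m) (nbhs (f m)) (nbhs (g m)) _ _ _ f g cf cg; exact.
Qed.

Lemma ball_pair (U V : pseudoMetricType R) (x y : U * V) (e : R) :
  ball x.1 e y.1 -> ball x.2 e y.2 -> ball x e y.
Proof. by []. Qed.

Lemma limit_stencil_continuous m : param_set m -> {for m, continuous limit_stencil}.
Proof.
move=> pm; have cu := continuous_limit_u pm; have cv := continuous_limit_v pm.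
have c1 : {for m, continuous (fun z : R * 'rV[R]_2 => z.1)} by exact: cvg_fst.
apply: (continuous_pair c1); apply: (continuous_pair cu); apply: (continuous_pair cv).
by apply: cvgD; [exact: cu|exact: cv].
Qed.

Lemma limit_stencil_compact : compact (limit_stencil @` param_set).
Proof.
apply: continuous_compact; last exact: param_set_compact.
by apply: continuous_in_subspaceT => x; rewrite inE => ?; exact: limit_stencil_continuous.
Qed.

(** Continuity is required only at nondegenerate limits, where matrix inversion
    and [kappa] are continuous. *)
Definition continuous_at_limit (f : R -> 'rV[R]_2 -> 'rV[R]_2 -> 'rV[R]_2 -> R) :=
  forall m, param_set m ->
    {for limit_stencil m, continuous
      (fun z : R * ('rV[R]_2 * ('rV[R]_2 * 'rV[R]_2)) => f z.1 z.2.1 z.2.2.1 z.2.2.2)}.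

(** The rescaled sites converge uniformly to the parallelogram of the partial
    derivatives, and f is uniformly continuous at the compact set of limits. *)
Lemma stencil_uniform f (e : R) : continuous_at_limit f -> 0 < e ->
  exists2 eta, 0 < eta & forall t p l, 0 <= t <= 2 -> sq p -> 0 < l < eta ->
    `|f t (step_u l p) (step_v l p) (step_uv l p) - f t (a p) (b p) (a p + b p)| < e.
Proof.
move=> cf e_gt0.
have cf' z : (limit_stencil @` param_set) z -> {for z, continuous
  (fun z : R * ('rV[R]_2 * ('rV[R]_2 * 'rV[R]_2)) => f z.1 z.2.1 z.2.2.1 z.2.2.2)}.
  by move=> [m pm <-]; exact: cf.
have [d d0 hd] := @compact_uniform R _ _ _ _ limit_stencil_compact cf' e_gt0.
have d2 : 0 < d / 2 by rewrite divr_gt0.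
have [eta eta0 h] := phi_first_order sqO C1 d2.
exists eta => // t p l t02 sp l0.
have [h1 h2 h3] := h p l sp l0.
have dd : d / 2 < d by rewrite ltr_pdivrMr// ltr_pMr// ltr1n.
have := hd (limit_stencil (t, p)) (t, (step_u l p, (step_v l p, step_uv l p))).
rewrite distrC; apply; first by exists (t, p) => //; split => //=; rewrite in_itv.
apply: ball_pair; first exact: ballxx.
apply: ball_pair; first by rewrite ballrV distrC; exact: le_lt_trans h1 dd.
apply: ball_pair; first by rewrite ballrV distrC; exact: le_lt_trans h2 dd.
by rewrite ballrV distrC; exact: le_lt_trans h3 dd.
Qed.

Lemma limit_bounded f : continuous_at_limit f ->
  exists2 C, 0 < C & forall t p, 0 <= t <= 2 -> sq p -> `|f t (a p) (b p) (a p + b p)| <= C.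
Proof.
move=> cf.
have [C hC] := @compact_bounded_above R _ (fun z : R * ('rV[R]_2 * ('rV[R]_2 * 'rV[R]_2)) => f z.1 z.2.1 z.2.2.1 z.2.2.2) _ limit_stencil_compact
  (fun z zK => let: ex_intro2 m pm e := zK in eq_ind _ (fun z => {for z, continuous _}) (cf m pm) _ e).
exists (`|C| + 1); first by rewrite ltr_pwDr.
move=> t p t02 sp; apply: (@le_trans _ _ C).
  apply: (hC (limit_stencil (t, p))).
  by exists (t, p) => //; split => //=; rewrite in_itv.
by have := ler_norm C; lra.
Qed.

Lemma stencil_bounded f : continuous_at_limit f ->
  exists2 C, 0 < C & exists2 eta, 0 < eta &
    forall t p l, 0 <= t <= 2 -> sq p -> 0 < l < eta ->
    `|f t (step_u l p) (step_v l p) (step_uv l p)| <= C.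
Proof.
move=> cf; have [C C0 hC] := limit_bounded cf.
have [eta eta0 h] := stencil_uniform cf ltr01.
exists (C + 1); first exact: addr_gt0.
exists eta => // t p l t02 sp l0.
have := ltW (h t p l t02 sp l0); have := hC t p t02 sp.
set x := f _ _ _ _; set y := f _ _ _ _ => h1 h2.
have -> : y = y - x + x by rewrite subrK.
by apply: le_trans (ler_normD _ _) _; rewrite addrC lerD.
Qed.

Lemma det2_jacobian p : sq p -> det2 (a p) (b p) != 0.
Proof.
move=> sp; have := phi_jacobian_neq0 sqO C1 sp.
by move: (a p) (b p) => e f; rewrite /det2 => h; rewrite [_ * f 0 0]mulrC.
Qed.

Lemma cfst (m : R * ('rV[R]_2 * ('rV[R]_2 * 'rV[R]_2))) : {for m, continuous (fun z => z.1)}.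
Proof. exact: cvg_fst. Qed.

Let cE (m : R * ('rV[R]_2 * ('rV[R]_2 * 'rV[R]_2))) : {for m, continuous (fun z => z.2.1)}.
Proof. by apply: (@continuous_comp _ _ _ snd fst); [exact: cvg_snd|exact: cvg_fst]. Qed.

Let cF (m : R * ('rV[R]_2 * ('rV[R]_2 * 'rV[R]_2))) : {for m, continuous (fun z => z.2.2.1)}.
Proof.
apply: (@continuous_comp _ _ _ (fun z => z.2.2) fst); last exact: cvg_fst.
by apply: (@continuous_comp _ _ _ snd snd); exact: cvg_snd.
Qed.

Let cG (m : R * ('rV[R]_2 * ('rV[R]_2 * 'rV[R]_2))) : {for m, continuous (fun z => z.2.2.2)}.
Proof.
apply: (@continuous_comp _ _ _ (fun z => z.2.2) snd); last exact: cvg_snd.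
by apply: (@continuous_comp _ _ _ snd snd); exact: cvg_snd.
Qed.

Lemma stencil_form_at_limit ell : continuous_at_limit (stencil_form ell).
Proof.
move=> m [_ sm]; have d0 := det2_jacobian sm.
by apply: continuous_stencil_form; [exact: cfst|exact: cE|exact: cF|exact: cG|exact: d0|].
Qed.

Lemma stencil_coef_at_limit ell k :
  continuous_at_limit (fun _ e f g => stencil_coef ell e f g k).
Proof.
move=> m [_ sm]; have d0 := det2_jacobian sm.
by apply: (continuous_stencil_coef (E := fun z => z.2.1) (F := fun z => z.2.2.1) (G := fun z => z.2.2.2)); [exact: cE|exact: cF|exact: cG|exact: d0|].
Qed.

Lemma stencil_pt_at_limit k j :
  continuous_at_limit (fun _ e f g => stencil_pt e f g k 0 j).
Proof.
move=> m _; apply: continuous_rV_coord.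
by case: k => -[] []; [exact: cG|exact: cE|exact: cF|exact: cvg_cst].
Qed.

Lemma det2_at_limit : continuous_at_limit (fun _ e f _ => det2 e f).
Proof. by move=> m _; apply: continuous_det2; [exact: cE|exact: cF]. Qed.

Lemma det2B_at_limit : continuous_at_limit (fun _ e f g => det2 (e - g) (f - g)).
Proof. by move=> m _; apply: continuous_det2; apply: cvgB; [exact: cE|exact: cG|exact: cF|exact: cG]. Qed.

(** The two determinants converge uniformly to plus and minus the Jacobian
    determinant, which is bounded away from 0. *)
Lemma stencil_det_neq0 : exists2 eta, 0 < eta & forall p l, sq p -> 0 < l < eta ->
  det2 (step_u l p) (step_v l p) != 0 /\
  det2 (step_u l p - step_uv l p) (step_v l p - step_uv l p) != 0.
Proof.
have cab p : sq p -> {for p, continuous (fun q => det2 (a q) (b q) * det2 (a q) (b q))}.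
  move=> sp; have cd : {for p, continuous (fun q => det2 (a q) (b q))}.
    apply: continuous_det2; [apply: (continuous_phi_u C1)|apply: (continuous_phi_v C1)]; exact: sqO.
  by have := cvgM cd cd; exact.
have [|c c0 hc] := compact_positive_min unit_square_compact cab.
  by move=> p sp; rewrite -expr2 exprn_even_gt0//=; exact: det2_jacobian.
(* The minimum with 1 turns a lower bound on the square into one on the
   absolute value. *)
pose d := Num.min c 1.
have d0 : 0 < d by rewrite lt_min c0 ltr01.
have dp p : sq p -> d <= `|det2 (a p) (b p)|.
  move=> sp; rewrite leNgt; apply/negP => small.
  have dc : d <= c by rewrite ge_min lexx.
  have d1 : d <= 1 by rewrite ge_min lexx orbT.
  have := le_trans dc (hc p sp); rewrite -expr2 -(real_normK (num_real _)).
  have := normr_ge0 (det2 (a p) (b p)); move: small; set x := `|_| => ? ?; nra.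
have [n1 n10 h1] := stencil_uniform det2_at_limit d0.
have [n2 n20 h2] := stencil_uniform det2B_at_limit d0.
exists (Num.min n1 n2); first by rewrite lt_min n10.
move=> p l sp; rewrite lt_min => /andP[l0 /andP[l1 l2]].
have t0 : 0 <= (0 : R) <= 2 by rewrite lexx ler0n.
have := h1 0 p l t0 sp; rewrite l0 l1 => /(_ isT) H1.
have := h2 0 p l t0 sp; rewrite l0 l2 => /(_ isT) H2.
have dB : det2 (a p - (a p + b p)) (b p - (a p + b p)) = - det2 (a p) (b p).
  rewrite opprD addrA subrr sub0r opprD addrCA subrr addr0.
  by move: (a p) (b p) => x y; rewrite /det2 !mxE; ring.
split; apply/eqP => h.
  by rewrite h sub0r normrN in H1; have := le_lt_trans (dp p sp) H1; rewrite ltxx.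
rewrite h dB sub0r !normrN in H2.
by have := le_lt_trans (dp p sp) H2; rewrite ltxx.
Qed.

End stencil_asymptotics.

(** * Scaling of stencils on the grid *)

Section kappa_zero.
Context {R : realType}.

Lemma kappa0 (t : R) : kappa t 0 = 0. Proof. by rewrite /kappa mul0r. Qed.

Lemma Gfun_kappa_ge0 (t s : R) : 0 < t < 2 -> 0 <= s ->
  Gfun t s = Gfun_slope t * kappa t (s ^+ 2) + Gfun_quad t * s ^+ 2.
Proof.
move=> t02; rewrite le_eqVlt => /predU1P[<-|]; last exact: Gfun_kappa.
by rewrite /Gfun eqxx expr0n /= kappa0 !mulr0 addr0.
Qed.

Lemma kappaM_ge0 (t l x : R) : 0 < l -> 0 <= x ->
  kappa t (l * x) = l `^ t * kappa t x + x * kappa t l.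
Proof.
move=> l0; rewrite le_eqVlt => /predU1P[<-|]; last exact: kappaM.
by rewrite mulr0 !kappa0 mulr0 mul0r addr0.
Qed.

Lemma sqnorm_ge0 (v : 'rV[R]_2) : 0 <= sqnorm v.
Proof. by rewrite /sqnorm addr_ge0// sqr_ge0. Qed.

Lemma enorm_sqnorm (v : 'rV[R]_2) : enorm v ^+ 2 = sqnorm v.
Proof. by rewrite enorm_sqr. Qed.

Lemma sqnormZ (l : R) (v : 'rV[R]_2) : sqnorm (l *: v) = l ^+ 2 * sqnorm v.
Proof. by rewrite /sqnorm !mxE; ring. Qed.

Lemma powR_sqr (l t : R) : 0 < l -> (l ^+ 2) `^ t * (l^-1 * l^-1) = l `^ (2 * t - 2).
Proof.
move=> l0; rewrite -powR_mulrn ?ltW// -powRrM powRD ?(gt_eqF l0) ?implybT//.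
by rewrite powRN powR_mulrn ?ltW// expr2 invfM.
Qed.

End kappa_zero.

Section stencil_scaling.
Context {R : realType}.
Variables (c : bool * bool -> R) (pt : bool * bool -> 'rV[R]_2) (l : R).
Hypothesis l0 : 0 < l.
Hypothesis c0 : \sum_k c k = 0.
Hypothesis cpt : \sum_k c k *: pt k = 0.

(** By [kappaM] and [affine_null_sqnorm], a change of scale only contributes a
    power of the mesh. *)
Lemma Gfun_stencil (t : R) : 0 < t < 2 ->
  \sum_k \sum_(m | k != m) (l^-1 * c k) * (l^-1 * c m) * Gfun t (enorm (l *: (pt k - pt m))) =
  Gfun_slope t * l `^ (2 * t - 2) * \sum_k \sum_(m | k != m) c k * c m * kappa t (sqnorm (pt k - pt m)).
Proof.
move=> t02.
transitivity (Gfun_slope t * l `^ (2 * t - 2) *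
    \sum_k \sum_(m | k != m) c k * c m * kappa t (sqnorm (pt k - pt m)) +
  (Gfun_slope t * kappa t (l ^+ 2) * (l^-1 * l^-1) + Gfun_quad t) *
    \sum_k \sum_(m | k != m) c k * c m * sqnorm (pt k - pt m)); last first.
  by rewrite (affine_null_sqnorm c0 cpt) mulr0 addr0.
rewrite !mulr_sumr -big_split; apply: eq_bigr => k _ /=.
rewrite !mulr_sumr -big_split; apply: eq_bigr => m _ /=.
rewrite Gfun_kappa_ge0 ?enorm_ge0// enorm_sqnorm sqnormZ.
rewrite kappaM_ge0 ?sqnorm_ge0 ?exprn_gt0// -powR_sqr//.
have ln0 : l != 0 by rewrite gt_eqF.
by field.
Qed.

(** The terms of degree 0 and 2 in the distance are annihilated by the
    coefficients, which leaves the principal irregular term and the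
    remainder. *)
Lemma covariance_stencil (Kt : 'rV[R]_2 -> R) (nu : R) (beta : nat -> R) (bs : R)
    (r : 'rV[R]_2 -> 'rV[R]_2 -> R) (x : 'rV[R]_2) :
  0 < nu < 2 -> covariance_model Kt nu beta bs r -> (forall y, r y y = 0) ->
  \sum_k \sum_m (l^-1 * c k) * (l^-1 * c m) * Kt (l *: (pt k - pt m)) =
  bs * Gfun_slope nu * l `^ (2 * nu - 2) *
    \sum_k \sum_(m | k != m) c k * c m * kappa nu (sqnorm (pt k - pt m)) +
  \sum_k \sum_(m | k != m) (l^-1 * c k) * (l^-1 * c m) * r (x + l *: pt k) (x + l *: pt m).
Proof.
move=> nu02 model rxx.
(* For nu < 1 the polynomial part is constant, for 1 <= nu < 2 it has in
   addition a term of degree 2. *)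
have [b1 bE] : exists b1, forall s : R,
    \sum_(j < (Num.truncn nu).+1) beta j * s ^+ (2 * j) = beta 0%N + b1 * s ^+ 2.
  have : (Num.truncn nu < 2)%N by rewrite truncn_lt_nat; lra.
  case: (Num.truncn nu) => [|[|]]// _.
    by exists 0 => s; rewrite big_ord1 muln0 expr0 mulr1 mul0r addr0.
  by exists (beta 1%N) => s; rewrite big_ord_recl big_ord1 /= muln0 expr0 mulr1.
have KE k m : Kt (l *: (pt k - pt m)) = beta 0%N + b1 * l ^+ 2 * sqnorm (pt k - pt m) +
    bs * Gfun nu (enorm (l *: (pt k - pt m))) + r (x + l *: pt k) (x + l *: pt m).
  have -> : l *: (pt k - pt m) = (x + l *: pt k) - (x + l *: pt m).
    by rewrite scalerBr opprD addrACA subrr add0r.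
  rewrite model bE; have -> : (x + l *: pt k) - (x + l *: pt m) = l *: (pt k - pt m).
    by rewrite scalerBr opprD addrACA subrr add0r.
  by rewrite enorm_sqnorm sqnormZ mulrA.
transitivity (\sum_k \sum_(m | k != m) (l^-1 * c k) * (l^-1 * c m) *
    (b1 * l ^+ 2 * sqnorm (pt k - pt m) + bs * Gfun nu (enorm (l *: (pt k - pt m))) +
     r (x + l *: pt k) (x + l *: pt m)) + \sum_k (l^-1 * c k) * \sum_m (l^-1 * c m) * beta 0%N).
  rewrite -big_split; apply: eq_bigr => k _ /=.
  transitivity (\sum_m (l^-1 * c k) * (l^-1 * c m) *
    (b1 * l ^+ 2 * sqnorm (pt k - pt m) + bs * Gfun nu (enorm (l *: (pt k - pt m))) +
     r (x + l *: pt k) (x + l *: pt m)) + (l^-1 * c k) * \sum_m (l^-1 * c m) * beta 0%N).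
    rewrite mulr_sumr -big_split; apply: eq_bigr => m _ /=; rewrite KE; ring.
  congr (_ + _); rewrite (bigD1 k)//= rxx subrr scaler0.
  have e00 : enorm (0 : 'rV[R]_2) = 0 by apply/eqP; rewrite -sqrf_eq0 enorm_sqr !mxE expr0n addr0.
  have s00 : sqnorm (0 : 'rV[R]_2) = 0 by rewrite /sqnorm !mxE expr0n addr0.
  rewrite e00 s00 /Gfun eqxx !mulr0 !addr0 mulr0 add0r.
  by apply: eq_bigl => m; rewrite eq_sym.
rewrite -[X in _ + X]mulr_suml -mulr_sumr c0 !mulr0 mul0r addr0.
transitivity (b1 * (\sum_k \sum_(m | k != m) c k * c m * sqnorm (pt k - pt m)) +
   bs * (\sum_k \sum_(m | k != m) (l^-1 * c k) * (l^-1 * c m) * Gfun nu (enorm (l *: (pt k - pt m)))) +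
   \sum_k \sum_(m | k != m) (l^-1 * c k) * (l^-1 * c m) * r (x + l *: pt k) (x + l *: pt m)).
  rewrite !mulr_sumr -!big_split; apply: eq_bigr => k _ /=.
  rewrite !mulr_sumr -!big_split; apply: eq_bigr => m _ /=.
  have ln0 : l != 0 by rewrite gt_eqF.
  by field.
by rewrite (affine_null_sqnorm c0 cpt) mulr0 add0r Gfun_stencil// !mulrA.
Qed.

End stencil_scaling.

Section grid.
Context {R : realType}.
Variables (phi : 'rV[R]_2 -> 'rV[R]_2) (n th : nat).
Hypothesis n_gt0 : (0 < n)%N.
Hypothesis th_gt0 : (0 < th)%N.

Definition grid (i j : nat) : 'rV[R]_2 := plane_pt (i%:R / n%:R) (j%:R / n%:R).
Definition mesh : R := th%:R / n%:R.

Lemma mesh_gt0 : 0 < mesh. Proof. by rewrite divr_gt0 ?ltr0n. Qed.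

Lemma grid_unit_square i j : (i <= n)%N -> (j <= n)%N -> unit_square (grid i j).
Proof.
move=> ni nj k; rewrite mxE; case: ifP => _;
by rewrite divr_ge0 ?ler0n//= ler_pdivrMr ?ltr0n// mul1r ler_nat.
Qed.

Lemma grid_shift_u i j : grid (i + th) j = grid i j + mesh *: delta_mx 0 0.
Proof.
apply/rowP => k; rewrite !mxE natrD mulrDl.
by case: (ord2_cases k) => ->; rewrite /= ?mulr1 ?mulr0 ?addr0.
Qed.

Lemma grid_shift_v i j : grid i (j + th) = grid i j + mesh *: delta_mx 0 1.
Proof.
apply/rowP => k; rewrite !mxE natrD mulrDl.
by case: (ord2_cases k) => ->; rewrite /= ?mulr1 ?mulr0 ?addr0.
Qed.

Local Notation U i j := (step_u phi mesh (grid i j)).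
Local Notation V i j := (step_v phi mesh (grid i j)).
Local Notation W i j := (step_uv phi mesh (grid i j)).

Lemma site_u i j : site phi n (i + th) j = site phi n i j + mesh *: U i j.
Proof.
rewrite /site -!/(grid _ _) grid_shift_u /step_u scalerA mulfV ?gt_eqF ?mesh_gt0//.
by rewrite scale1r addrCA subrr addr0.
Qed.

Lemma site_v i j : site phi n i (j + th) = site phi n i j + mesh *: V i j.
Proof.
rewrite /site -!/(grid _ _) grid_shift_v /step_v scalerA mulfV ?gt_eqF ?mesh_gt0//.
by rewrite scale1r addrCA subrr addr0.
Qed.

Lemma site_uv i j : site phi n (i + th) (j + th) = site phi n i j + mesh *: W i j.
Proof.
rewrite /site -!/(grid _ _) grid_shift_v grid_shift_u /step_uv scalerA mulfV ?gt_eqF ?mesh_gt0//.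
by rewrite scale1r addrCA subrr addr0.
Qed.

Lemma site_stencil i j (k : bool * bool) :
  site phi n (i + th * k.1) (j + th * k.2) =
  site phi n i j + mesh *: stencil_pt (U i j) (V i j) (W i j) k.
Proof.
case: k => -[] [] /=; rewrite ?muln1 ?muln0 ?addn0.
- exact: site_uv.
- exact: site_u.
- exact: site_v.
- by rewrite scaler0 addr0.
Qed.

Lemma inv2_scale (l : R) (e f : 'rV[R]_2) ell : l != 0 -> det2 e f != 0 ->
  [/\ det2 (l *: e) (l *: f) != 0, inv_left (l *: e) (l *: f) ell = l^-1 * inv_left e f ell &
   inv_right (l *: e) (l *: f) ell = l^-1 * inv_right e f ell].
Proof.
move=> l0 d0.
have dE : det2 (l *: e) (l *: f) = l ^+ 2 * det2 e f by rewrite /det2 !mxE; ring.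
split; first by rewrite dE mulf_neq0// expf_neq0.
- by rewrite /inv_left dE !mxE; move: d0; set D := det2 e f => d0; field; rewrite ?l0 ?d0.
- by rewrite /inv_right dE !mxE; move: d0; set D := det2 e f => d0; field; rewrite ?l0 ?d0.
Qed.

Lemma coef_stencil ell i j k : det2 (U i j) (V i j) != 0 ->
  det2 (U i j - W i j) (V i j - W i j) != 0 ->
  coef phi n th ell i j k = mesh^-1 * stencil_coef ell (U i j) (V i j) (W i j) k.
Proof.
move=> dA dB; have l0 : mesh != 0 by rewrite gt_eqF ?mesh_gt0.
have AE : Amx phi n th i j = col_mx (mesh *: U i j) (mesh *: V i j).
  by rewrite /Amx site_u site_v ![site phi n i j + _]addrC !addrK.
have BE : Bmx phi n th i j = col_mx (mesh *: (U i j - W i j)) (mesh *: (V i j - W i j)).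
  rewrite /Bmx site_uv site_u site_v !scalerBr.
  have cancel (x y z : 'rV[R]_2) : x + y - (x + z) = y - z by rewrite opprD addrACA subrr add0r.
  by rewrite !cancel.
have [dA' lA rA] := inv2_scale ell l0 dA; have [dB' lB rB] := inv2_scale ell l0 dB.
have [a0 a1] := invmx_col2 ell dA'; have [b0 b1] := invmx_col2 ell dB'.
rewrite /coef /alphac /betac AE BE a0 a1 b0 b1 lA rA lB rB.
by case: k => -[] [] /=; ring.
Qed.

Lemma fbar_stencil (bs : R -> R) ell t : 0 < t < 2 ->
  (forall i j, (i <= n)%N -> (j <= n)%N -> det2 (U i j) (V i j) != 0 /\
    det2 (U i j - W i j) (V i j - W i j) != 0) ->
  fbar phi n bs th ell t = bs t * Gfun_slope t * mesh `^ (2 * t - 2) *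
    \sum_(1 <= i < (n - th).+1) \sum_(1 <= j < (n - th).+1)
       stencil_form ell t (U i j) (V i j) (W i j).
Proof.
move=> t02 dn.
rewrite /fbar -!mulrA; congr (_ * _); rewrite !mulrA mulr_sumr.
apply: eq_big_nat => i /andP[_ ni]; rewrite mulr_sumr.
apply: eq_big_nat => j /andP[_ nj].
have in' : (i <= n)%N by lia.
have jn : (j <= n)%N by lia.
have [dA dB] := dn i j in' jn.
have := Gfun_stencil mesh_gt0 (stencil_coef_sum ell (U i j) (V i j) (W i j))
  (stencil_coef_linear ell dA dB) t02.
rewrite -/(stencil_form ell t (U i j) (V i j) (W i j)) => <-.
apply: eq_bigr => k _; apply: eq_bigr => m _; rewrite (coef_stencil ell k dA dB) (coef_stencil ell m dA dB).
have cancel (x y z : 'rV[R]_2) : x + y - (x + z) = y - z by rewrite opprD addrACA subrr add0r.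
by rewrite (site_stencil i j k) (site_stencil i j m) cancel -scalerBr.
Qed.

End grid.

(** * Sums over the grid *)

Section box_sums.
Context {R : realType}.
Implicit Types (F G : nat -> nat -> R).

Lemma box_sum_bound F (a b c d : nat) (C : R) :
  (forall i j, (a <= i < b)%N -> (c <= j < d)%N -> `|F i j| <= C) ->
  `|\sum_(a <= i < b) \sum_(c <= j < d) F i j| <= (b - a)%:R * ((d - c)%:R * C).
Proof.
move=> h; apply: le_trans (ler_norm_sum _ _ _) _.
have -> : (b - a)%:R * ((d - c)%:R * C) = \sum_(a <= i < b) (d - c)%:R * C.
  by rewrite sumr_const_nat -[RHS]mulr_natl.
apply: ler_sum_nat => i ib; apply: le_trans (ler_norm_sum _ _ _) _.
have -> : (d - c)%:R * C = \sum_(c <= j < d) C by rewrite sumr_const_nat -[RHS]mulr_natl.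
by apply: ler_sum_nat => j jb; exact: h.
Qed.

(** The sum of F runs over a smaller box, and the boundary layer contributes
    at most 2 n (n - m) terms. *)
Lemma box_sum_close F G (m n : nat) (e C : R) : (m <= n)%N -> 0 <= e -> 0 <= C ->
  (forall i j, (1 <= i < m.+1)%N -> (1 <= j < m.+1)%N -> `|F i j - G i j| <= e) ->
  (forall i j, (1 <= i < n.+1)%N -> (1 <= j < n.+1)%N -> `|G i j| <= C) ->
  `|\sum_(1 <= i < m.+1) \sum_(1 <= j < m.+1) F i j -
    \sum_(1 <= i < n.+1) \sum_(1 <= j < n.+1) G i j| <=
  e * n%:R ^+ 2 + 2 * C * (n - m)%:R * n%:R.
Proof.
move=> mn e0 C0 hF hG.
have -> : \sum_(1 <= i < n.+1) \sum_(1 <= j < n.+1) G i j =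
  \sum_(1 <= i < m.+1) \sum_(1 <= j < m.+1) G i j +
  (\sum_(1 <= i < m.+1) \sum_(m.+1 <= j < n.+1) G i j +
   \sum_(m.+1 <= i < n.+1) \sum_(1 <= j < n.+1) G i j).
  rewrite (@big_cat_nat _ _ _ m.+1)//= addrA; congr (_ + _).
  by rewrite -big_split; apply: eq_bigr => i _ /=; rewrite -big_cat_nat.
rewrite opprD addrA -sumrB.
under [X in `|X - _|]eq_bigr do rewrite -sumrB.
apply: le_trans (ler_normB _ _) _; apply: lerD.
  apply: le_trans (box_sum_bound hF) _; rewrite subn1 /= mulrA mulrC.
  rewrite ler_wpM2l// expr2 -!natrM ler_nat; exact: leq_mul.
apply: le_trans (ler_normD _ _) _.
have h1 : `|\sum_(1 <= i < m.+1) \sum_(m.+1 <= j < n.+1) G i j| <= (m.+1 - 1)%:R * ((n.+1 - m.+1)%:R * C).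
  by apply: box_sum_bound => i j ? ?; apply: hG; lia.
have h2 : `|\sum_(m.+1 <= i < n.+1) \sum_(1 <= j < n.+1) G i j| <= (n.+1 - m.+1)%:R * ((n.+1 - 1)%:R * C).
  by apply: box_sum_bound => i j ? ?; apply: hG; lia.
apply: le_trans (lerD h1 h2) _; rewrite !subn1 !subSS /=.
have -> : 2 * C * (n - m)%:R * n%:R = n%:R * ((n - m)%:R * C) + (n - m)%:R * (n%:R * C) :> R by ring.
by rewrite lerD2r ler_wpM2r ?ler_nat// mulr_ge0.
Qed.

Lemma sum_subrange (f : nat -> R) (a m n : nat) :
  (forall i, (1 <= i < n.+1)%N -> 0 <= f i) -> (a + m <= n)%N ->
  \sum_(a.+1 <= i < (a + m).+1) f i <= \sum_(1 <= i < n.+1) f i.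
Proof.
move=> f0 amn.
rewrite (@big_cat_nat _ _ _ (a + m).+1 1 n.+1)//= (@big_cat_nat _ _ _ a.+1 1 (a + m).+1)//=; last first.
  by rewrite ltnS leq_addr.
have p1 : 0 <= \sum_(1 <= i < a.+1) f i.
  by rewrite big_nat_cond sumr_ge0// => i; rewrite andbT => ?; apply: f0; lia.
have p2 : 0 <= \sum_((a + m).+1 <= i < n.+1) f i.
  by rewrite big_nat_cond sumr_ge0// => i; rewrite andbT => ?; apply: f0; lia.
by move: p1 p2; clear; lra.
Qed.

(** An interval of length [del] contains about n [del] of the fractions i / n;
    rounding costs one of them, hence the factor 1/2. *)
Lemma interval_indices (n : nat) (u del : R) : 0 <= u -> 0 < del -> u + del <= 1 ->
  2 <= n%:R * del ->
  exists a m : nat, [/\ (a + m <= n)%N, n%:R * del / 2 <= m%:R &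
    forall i, (a.+1 <= i < (a + m).+1)%N -> u <= i%:R / n%:R <= u + del].
Proof.
move=> u0 del0 ud nd.
have n0 : 0 < n%:R :> R by rewrite ltNge; apply/negP => ?; have := @ler0n R n; nra.
exists (Num.truncn (n%:R * u)), (Num.truncn (n%:R * del)).
have [a1 a2] : (Num.truncn (n%:R * u))%:R <= n%:R * u /\ n%:R * u < (Num.truncn (n%:R * u)).+1%:R.
  by split; [rewrite truncn_le ?mulr_ge0// ltW|exact: truncnS_gt].
have [m1 m2] : (Num.truncn (n%:R * del))%:R <= n%:R * del /\ n%:R * del < (Num.truncn (n%:R * del)).+1%:R.
  by split; [rewrite truncn_le ?mulr_ge0// ltW|exact: truncnS_gt].
set a := Num.truncn _ in a1 a2 *; set m := Num.truncn _ in m1 m2 *.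
have am : a%:R + m%:R <= n%:R * (u + del) :> R by rewrite mulrDr lerD.
split.
- rewrite -(ler_nat R) natrD; apply: le_trans am _.
  by rewrite -[leRHS]mulr1 ler_wpM2l// ltW.
- by move: m2; rewrite -natr1; lra.
- move=> i /andP[ai im]; rewrite ler_pdivlMr// ler_pdivrMr//.
  have : a.+1%:R <= i%:R :> R by rewrite ler_nat.
  have : i%:R <= (a + m)%:R :> R by rewrite ler_nat -ltnS.
  by rewrite natrD ![_ * n%:R]mulrC => ? ?; apply/andP; split; lra.
Qed.

Lemma unit_subinterval (x del : R) : 0 <= x <= 1 -> 0 < del -> del <= 2^-1 ->
  exists x1, [/\ 0 <= x1, x1 + del <= 1 &
    forall y, x1 <= y <= x1 + del -> `|x - y| <= del].
Proof.
move=> x01 del0 del12; have [x12|x12] := leP x 2^-1.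
  by exists x; split; [lra|lra|move=> y ?; rewrite ler_norml; lra].
by exists (x - del); split; [lra|lra|move=> y ?; rewrite ler_norml; lra].
Qed.

Lemma box_sum_lower F (n : nat) (u v del c : R) : 0 <= u -> 0 <= v -> 0 < del ->
  u + del <= 1 -> v + del <= 1 -> 2 <= n%:R * del -> 0 <= c ->
  (forall i j, (1 <= i < n.+1)%N -> (1 <= j < n.+1)%N -> 0 <= F i j) ->
  (forall i j, u <= i%:R / n%:R <= u + del -> v <= j%:R / n%:R <= v + del -> c <= F i j) ->
  c * (del / 2) ^+ 2 * n%:R ^+ 2 <= \sum_(1 <= i < n.+1) \sum_(1 <= j < n.+1) F i j.
Proof.
move=> u0 v0 del0 ud vd nd c0 F0 Fc.
have [a [m [amn mn ha]]] := interval_indices u0 del0 ud nd.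
have [b [k [bkn kn hb]]] := interval_indices v0 del0 vd nd.
apply: le_trans (sum_subrange (a := a) (m := m) _ amn); last first.
  by move=> i i1; rewrite big_nat_cond sumr_ge0// => j; rewrite andbT => ?; exact: F0.
apply: (@le_trans _ _ (\sum_(a.+1 <= i < (a + m).+1) k%:R * c)).
  rewrite sumr_const_nat subSS addKn -[leRHS]mulr_natl mulrA [leRHS]mulrC.
  have -> : c * (del / 2) ^+ 2 * n%:R ^+ 2 = c * ((n%:R * del / 2) * (n%:R * del / 2)) by ring.
  by rewrite ler_wpM2l// ler_pM// !mulr_ge0 ?ler0n ?ltW.
apply: ler_sum_nat => i im.
apply: le_trans (sum_subrange (a := b) (m := k) _ bkn); last first.
  by move=> j j1; apply: F0 => //; lia.
have -> : k%:R * c = \sum_(b.+1 <= j < (b + k).+1) c.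
  by rewrite sumr_const_nat subSS addKn -[RHS]mulr_natl.
by apply: ler_sum_nat => j jk; apply: Fc; [exact: ha|exact: hb].
Qed.

End box_sums.

Section real_continuity.
Context {R : realType} (M : topologicalType) (f g : M -> R) (m : M).
Hypothesis (cf : {for m, continuous f}) (cg : {for m, continuous g}).

Lemma real_continuousD : {for m, continuous (fun z => f z + g z)}.
Proof. by have := cvgD cf cg; exact. Qed.

Lemma real_continuousB : {for m, continuous (fun z => f z - g z)}.
Proof. by have := cvgB cf cg; exact. Qed.

Lemma real_continuousM : {for m, continuous (fun z => f z * g z)}.
Proof. by have := cvgM cf cg; exact. Qed.

Lemma real_continuousMl (c : R) : {for m, continuous (fun z => c * f z)}.
Proof. by have := cvgM (@cvg_cst _ c _ (nbhs m) _) cf; exact. Qed.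

Lemma real_continuousV : f m != 0 -> {for m, continuous (fun z => (f z)^-1)}.
Proof. by move=> f0; have := cvgV f0 cf; exact. Qed.

End real_continuity.

Section stencil_sums.
Context {R : realType}.
Local Notation sq := (@unit_square R).
Variables (Omega : set 'rV[R]_2) (phi : 'rV[R]_2 -> 'rV[R]_2) (ell : 'I_2).
Hypothesis sqO : sq `<=` Omega.
Hypothesis C1 : C1_diffeo Omega phi.
Local Notation a := (phi_u phi).
Local Notation b := (phi_v phi).

Definition stencil_sum (th n : nat) (t : R) : R :=
  \sum_(1 <= i < (n - th).+1) \sum_(1 <= j < (n - th).+1)
    stencil_form ell t (step_u phi (mesh n th) (grid n i j))
      (step_v phi (mesh n th) (grid n i j)) (step_uv phi (mesh n th) (grid n i j)).

Definition limit_sum (n : nat) (t : R) : R :=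
  \sum_(1 <= i < n.+1) \sum_(1 <= j < n.+1)
    stencil_form ell t (a (grid n i j)) (b (grid n i j)) (a (grid n i j) + b (grid n i j)).

Lemma grid_box (n i j : nat) : (1 <= i < n.+1)%N -> (1 <= j < n.+1)%N -> sq (grid n i j).
Proof. by move=> i1 j1; apply: grid_unit_square; lia. Qed.

Lemma near_mesh_lt (th : nat) (eta : R) : (0 < th)%N -> 0 < eta ->
  \forall n \near \oo, (0 < n)%N /\ 0 < (mesh n th : R) < eta.
Proof.
move=> th0 eta0; near=> n.
have n0 : (0 < n)%N by near: n; exact: nbhs_infty_gt.
split => //; rewrite mesh_gt0//= /mesh ltr_pdivrMr ?ltr0n//.
rewrite mulrC -ltr_pdivrMr//; near: n; exact: nbhs_infty_gtr.
Unshelve. all: end_near. Qed.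

Lemma stencil_sum_close (th : nat) (e : R) : (0 < th)%N -> 0 < e ->
  \forall n \near \oo, forall t, 0 <= t <= 2 ->
    `|stencil_sum th n t - limit_sum n t| <= e * n%:R ^+ 2.
Proof.
move=> th0 e0.
have cf := stencil_form_at_limit sqO C1 (ell := ell).
have [C C0 hC] := limit_bounded sqO C1 cf.
have e20 : 0 < e / 2 by rewrite divr_gt0.
have [eta eta0 h] := stencil_uniform sqO C1 cf e20.
near=> n; move=> t t02.
have [n0 m0] : (0 < n)%N /\ 0 < (mesh n th : R) < eta by near: n; exact: near_mesh_lt.
have nC : 4 * C * th%:R / e <= n%:R by near: n; exact: nbhs_infty_ger.
have thn : (n - th <= n)%N by exact: leq_subr.
apply: le_trans (box_sum_close thn (ltW e20) (ltW C0) _ _) _.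
- move=> i j i1 j1; apply: ltW; apply: h => //; apply: (grid_box (n := n)); [move: i1|move: j1]; move: thn; clear; lia.
- move=> i j i1 j1; apply: hC => //; exact: grid_box.
have h1 : (n - (n - th))%:R <= th%:R :> R by rewrite ler_nat; lia.
move: nC; rewrite ler_pdivrMr// => nC.
have nn : 0 <= n%:R :> R by [].
have h2 := ler_wpM2r nn nC.
have h3 : 2 * C * (n - (n - th))%:R * n%:R <= 2 * C * th%:R * n%:R.
  by rewrite ler_wpM2r// ler_wpM2l// mulr_ge0// ltW.
rewrite expr2; move: h2 h3; clear; lra.
Unshelve. all: end_near. Qed.

Lemma Jfun_neq0_weight nu (u v : R) : Jfun phi nu ell u v != 0 ->
  b (plane_pt u v) 0 (rev_ord ell) - a (plane_pt u v) 0 (rev_ord ell) != 0.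
Proof. by apply: contraNneq => h; rewrite /Jfun h expr0n /= !mul0r. Qed.

(** Positivity of the parallelogram expression is uniform over exponents in
    [0, 2] and points of the square, by compactness. *)
Lemma stencil_gap_lower : exists2 c, 0 < c & forall t p, 0 <= t <= 2 -> sq p ->
  c <= kappa t (sqnorm (a p + b p)) + kappa t (sqnorm (b p - a p)) -
    2 * kappa t (sqnorm (a p)) - 2 * kappa t (sqnorm (b p)).
Proof.
pose f (m : R * 'rV[R]_2) := kappa m.1 (sqnorm (a m.2 + b m.2)) + kappa m.1 (sqnorm (b m.2 - a m.2)) -
    2 * kappa m.1 (sqnorm (a m.2)) - 2 * kappa m.1 (sqnorm (b m.2)).
have [m pm|m pm|c c0 hc] := @compact_positive_min R _ f _ param_set_compact.
- have cu := continuous_limit_u sqO C1 pm; have cv := continuous_limit_v sqO C1 pm.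
  have c1 : {for m, continuous (fun z : R * 'rV[R]_2 => z.1)} by exact: cvg_fst.
  have d0 := det2_jacobian sqO C1 pm.2.
  have [a0 b0 ab ba] := det2_distinct d0.
  have cD : {for m, continuous (fun z => a z.2 + b z.2)} by apply: cvgD; [exact: cu|exact: cv].
  have cB : {for m, continuous (fun z => b z.2 - a z.2)} by apply: cvgB; [exact: cv|exact: cu].
  have K (E : R * 'rV[R]_2 -> 'rV[R]_2) : {for m, continuous E} -> E m != 0 ->
      {for m, continuous (fun z : R * 'rV[R]_2 => kappa z.1 (sqnorm (E z)))}.
    move=> cE E0; apply: kappa_continuous; [exact: c1| |exact: sqnorm_gt0].
    exact: continuous_sqnorm.
  have k1 := real_continuousD (K _ cD ab) (K _ cB ba).
  have k2 := real_continuousMl (c := 2) (K _ cu a0).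
  have k3 := real_continuousMl (c := 2) (K _ cv b0).
  have k4 := real_continuousB k1 k2.
  have k5 := real_continuousB k4 k3.
  exact: k5.
- apply: stencil_gap_gt0; last exact: (det2_jacobian sqO C1 pm.2).
  by have := pm.1; rewrite /= in_itv => /andP[].
exists c => // t p t02 sp; apply: (hc (t, p)).
by split => //=; rewrite in_itv.
Qed.

(** All terms are nonnegative, and those at the sites in some small square
    around a point where the weight does not vanish are bounded below. *)
Lemma limit_sum_lower nu (u v : R) : 0 <= u <= 1 -> 0 <= v <= 1 ->
  Jfun phi nu ell u v != 0 ->
  exists2 c, 0 < c & \forall n \near \oo, forall t, 0 <= t <= 2 -> c * n%:R ^+ 2 <= limit_sum n t.
Proof.
move=> u01 v01 /Jfun_neq0_weight w0.
have [c c0 hc] := stencil_gap_lower.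
pose w (p : 'rV[R]_2) := (b p 0 (rev_ord ell) - a p 0 (rev_ord ell)) / det2 (a p) (b p).
pose p0 : 'rV[R]_2 := plane_pt u v.
have sp0 : sq p0 by move=> j; rewrite mxE; case: ifP.
have wp0 : 0 < w p0 * w p0.
  rewrite -expr2 exprn_even_gt0//= mulf_neq0//.
  by rewrite invr_eq0; exact: (det2_jacobian sqO C1 sp0).
have cw : {for p0, continuous (fun p => w p * w p)}.
  have ca := continuous_phi_u C1 (sqO sp0); have cb := continuous_phi_v C1 (sqO sp0).
  have cd := continuous_det2 ca cb.
  have d0 := det2_jacobian sqO C1 sp0.
  have cw : {for p0, continuous w}.
    exact: (real_continuousM (real_continuousB (continuous_rV_coord (j := rev_ord ell) cb)
      (continuous_rV_coord (j := rev_ord ell) ca)) (real_continuousV cd d0)).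
  exact: real_continuousM.
have wp02 : 0 < w p0 * w p0 / 2 by rewrite divr_gt0.
have /cvgrPdist_lt /(_ _ wp02) /nbhs_ballP[eps eps0 hw] := cw.
pose del := Num.min (eps / 2) 2^-1.
have del0 : 0 < del by rewrite lt_min divr_gt0//= invr_gt0.
have del12 : del <= 2^-1 by rewrite ge_min lexx orbT.
have dele : del < eps.
  by apply: (@le_lt_trans _ _ (eps / 2)); [rewrite ge_min lexx|rewrite ltr_pdivrMr// ltr_pMr ?ltr1n].
have [u1 [u10 u11 hu]] := unit_subinterval u01 del0 del12.
have [v1 [v10 v11 hv]] := unit_subinterval v01 del0 del12.
pose m := 2 * (w p0 * w p0 / 2) * c.
have m0 : 0 < m by apply: mulr_gt0 => //; apply: mulr_gt0.
exists (m * (del / 2) ^+ 2); first by rewrite mulr_gt0// exprn_gt0// divr_gt0.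
near=> n; move=> t t02.
have nd : 2 <= n%:R * del by rewrite -ler_pdivrMr//; near: n; exact: nbhs_infty_ger.
have form p : sq p -> stencil_form ell t (a p) (b p) (a p + b p) = 2 * (w p * w p) *
    (kappa t (sqnorm (a p + b p)) + kappa t (sqnorm (b p - a p)) -
    2 * kappa t (sqnorm (a p)) - 2 * kappa t (sqnorm (b p))).
  by move=> sp; rewrite stencil_form_limit ?(det2_jacobian sqO C1 sp)// -expr2.
have w20 p : 0 <= w p * w p by rewrite -expr2 sqr_ge0.
apply: (box_sum_lower u10 v10 del0 u11 v11 nd (ltW m0)).
- move=> i j i1 j1; have sp := grid_box i1 j1 : sq (grid n i j).
  rewrite form//; apply: mulr_ge0; first by apply: mulr_ge0 => //; exact: w20.
  exact: le_trans (ltW c0) (hc t _ t02 sp).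
- move=> i j ui vj.
  have sp : sq (grid n i j).
    by move=> k; rewrite mxE; case: ifP => _; [move: ui u10 u11|move: vj v10 v11]; clear; lra.
  rewrite form// /m; apply: ler_pM; last exact: hc.
  + by rewrite mulr_ge0// ltW.
  + exact: ltW.
  rewrite ler_wpM2l//.
  have : `|w p0 * w p0 - w (grid n i j) * w (grid n i j)| < w p0 * w p0 / 2.
    apply: hw; rewrite ballrV; apply: le_lt_trans dele; apply: norm_le_coord => [|k]; first exact: ltW.
    by rewrite !mxE; case: ifP => _; [exact: hu|exact: hv].
  by rewrite ltr_norml; move: (w p0 * w p0) (w _ * w _); clear => x y; lra.
Unshelve. all: end_near. Qed.

Lemma stencil_sum_bounds nu (u v : R) : 0 <= u <= 1 -> 0 <= v <= 1 ->
  Jfun phi nu ell u v != 0 ->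
  exists2 c, 0 < c & forall th e, (0 < th)%N -> 0 < e ->
  \forall n \near \oo, forall t, 0 <= t <= 2 ->
    c * n%:R ^+ 2 <= stencil_sum th n t /\
    `|stencil_sum th n t - limit_sum n t| <= e * n%:R ^+ 2.
Proof.
move=> u01 v01 J0; have [c c0 hc] := limit_sum_lower u01 v01 J0.
exists (c / 2) => [|th e th0 e0]; first by rewrite divr_gt0.
have c20 : 0 < c / 2 by rewrite divr_gt0.
near=> n; move=> t t02.
have h1 : c * n%:R ^+ 2 <= limit_sum n t.
  by move: t t02; near: n.
have h2 : `|stencil_sum th n t - limit_sum n t| <= c / 2 * n%:R ^+ 2.
  by move: t t02 {h1}; near: n; exact: stencil_sum_close.
split; last by move: t t02 {h1 h2}; near: n; exact: stencil_sum_close.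
by move: h1 h2; rewrite ler_norml; clear; lra.
Unshelve. all: end_near. Qed.

(** The sums for both spacings are close to the same sum of limits. *)
Lemma stencil_sum_ratio nu (u v : R) (e : R) : 0 <= u <= 1 -> 0 <= v <= 1 ->
  Jfun phi nu ell u v != 0 -> 0 < e ->
  \forall n \near \oo, forall t, 0 <= t <= 2 ->
    [/\ 0 < stencil_sum 1 n t, 0 < stencil_sum 2 n t &
     `|stencil_sum 2 n t / stencil_sum 1 n t - 1| <= e].
Proof.
move=> u01 v01 J0 e0; have [c c0 hc] := stencil_sum_bounds u01 v01 J0.
have ec0 : 0 < e * c / 2 by rewrite divr_gt0// mulr_gt0.
have H1 := hc 1%N _ isT ec0; have H2 := hc 2%N _ isT ec0.
have H0 : \forall n \near \oo, (0 < n)%N by exact: nbhs_infty_gt.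
move: H0 H1 H2; apply: filterS3 => n n_gt0 B1 B2 t t02.
have n0 : 0 < n%:R :> R by rewrite ltr0n.
have [h1 k1] := B1 t t02; have [h2 k2] := B2 t t02.
have cn : 0 < c * n%:R ^+ 2 by rewrite mulr_gt0// exprn_gt0.
move: (stencil_sum 1 n t) (stencil_sum 2 n t) (limit_sum n t) h1 k1 h2 k2 => x y z h1 k1 h2 k2.
have s1 := lt_le_trans cn h1; have s2 := lt_le_trans cn h2; split => //.
have -> : y / x - 1 = (y - x) / x.
  by rewrite mulrBl mulfV// gt_eqF.
rewrite normrM normfV (gtr0_norm s1) ler_pdivrMr//.
apply: (@le_trans _ _ (e * (c * n%:R ^+ 2))); last by rewrite ler_wpM2l// ltW.
move: k1 k2; rewrite !ler_norml; clear; lra.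
Qed.

End stencil_sums.

(** * The ratio of expected variations *)

Section continuity_in_smoothness.
Context {R : realType}.

(** For a fixed second argument continuity in the exponent holds everywhere,
    including at 0. *)
Lemma kappa_continuous_exponent (x : R) : continuous (fun t => kappa t x).
Proof.
move=> t.
have h : {for t, continuous (fun t : R => exp_slope ((t - 1) * ln x))}.
  apply: (@continuous_comp _ _ _ (fun t : R => (t - 1) * ln x) exp_slope); last exact: exp_slope_continuous.
  apply: real_continuousM; last exact: cvg_cst.
  by apply: real_continuousB; [exact: cvg_id|exact: cvg_cst].
exact: (real_continuousMl (c := x) (real_continuousMl (c := ln x) h)).
Qed.

Lemma stencil_form_continuous_exponent ell (e f g : 'rV[R]_2) :
  continuous (fun t => stencil_form ell t e f g).
Proof.
move=> t; apply: continuous_sum => k _; apply: continuous_sum => l _.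
by apply: real_continuousMl; exact: kappa_continuous_exponent.
Qed.

Lemma powR_continuous_exponent (x : R) : 0 < x -> continuous (fun t : R => x `^ t).
Proof.
move=> x0 t.
have -> : (fun t : R => x `^ t) = (fun t => expR (t * ln x)).
  by apply/funext => s; rewrite /powR gt_eqF.
apply: (@continuous_comp _ _ _ (fun t : R => t * ln x) expR); last exact: continuous_expR.
by apply: real_continuousM; [exact: cvg_id|exact: cvg_cst].
Qed.

End continuity_in_smoothness.

Section Fbar.
Context {R : realType}.
Local Notation sq := (@unit_square R).
Variables (Omega : set 'rV[R]_2) (phi : 'rV[R]_2 -> 'rV[R]_2) (ell : 'I_2).
Hypothesis sqO : sq `<=` Omega.
Hypothesis C1 : C1_diffeo Omega phi.

Lemma stencil_sum_continuous th n : continuous (stencil_sum phi ell th n).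
Proof.
move=> t; apply: continuous_sum => i _; apply: continuous_sum => j _.
exact: stencil_form_continuous_exponent.
Qed.

Lemma grid_det_neq0 th : (0 < th)%N ->
  \forall n \near \oo, (0 < n)%N /\ forall i j, (i <= n)%N -> (j <= n)%N ->
   det2 (step_u phi (mesh n th) (grid n i j)) (step_v phi (mesh n th) (grid n i j)) != 0 /\
   det2 (step_u phi (mesh n th) (grid n i j) - step_uv phi (mesh n th) (grid n i j))
     (step_v phi (mesh n th) (grid n i j) - step_uv phi (mesh n th) (grid n i j)) != 0.
Proof.
move=> th0; have [eta eta0 h] := stencil_det_neq0 sqO C1.
have := near_mesh_lt th0 eta0; apply: filterS => n [n0 m0]; split => // i j ni nj.
by apply: h => //; exact: grid_unit_square.
Qed.

Variable bs : R -> R.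
Hypothesis bs_neq0 : forall t, 0 < t < 2 -> bs t != 0.
Variables (nu u v : R).
Hypothesis u01 : 0 <= u <= 1.
Hypothesis v01 : 0 <= v <= 1.
Hypothesis J0 : Jfun phi nu ell u v != 0.

(** The factors that depend on the exponent cancel in the ratio.  The resulting
    expression is continuous on the closed interval, so it also gives the end
    values of [Fbar], which are defined as limits. *)
Lemma Fbar_stencil : \forall n \near \oo, forall t, 0 <= t <= 2 ->
  Fbar phi n bs ell t = 2 `^ (2 * t - 2) * (stencil_sum phi ell 2 n t / stencil_sum phi ell 1 n t).
Proof.
have H1 := grid_det_neq0 (isT : (0 < 1)%N); have H2 := grid_det_neq0 (isT : (0 < 2)%N).
have H3 := stencil_sum_ratio sqO C1 u01 v01 J0 ltr01.
move: H1 H2 H3; apply: filterS3 => n [n0 d1] [_ d2] hS.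
set g := fun t : R => 2 `^ (2 * t - 2) * (stencil_sum phi ell 2 n t / stencil_sum phi ell 1 n t).
have inner t : 0 < t < 2 -> fratio phi n bs ell t = g t.
  move=> t02; have t02' : 0 <= t <= 2 by case/andP: t02 => ? ?; rewrite !ltW.
  have [s1 s2 _] := hS t t02'.
  rewrite /fratio !(fbar_stencil n0 _ bs ell t02)// -/(stencil_sum phi ell 2 n t) -/(stencil_sum phi ell 1 n t).
  have -> : mesh n 2 = 2 * mesh n 1 :> R by rewrite /mesh mul1r.
  have m0 : 0 < mesh n 1 :> R by exact: mesh_gt0.
  rewrite powRM ?ltW// /g.
  have : mesh n 1 `^ (2 * t - 2) != 0 :> R by rewrite gt_eqF// powR_gt0.
  have := Gfun_slope_neq0 t; have := bs_neq0 t02; move: s1.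
  move: (stencil_sum phi ell 1 n t) (stencil_sum phi ell 2 n t) (mesh n 1 `^ _) (2 `^ _) (bs t) (Gfun_slope t).
  move=> x y z w b s x0 b0 s0 z0; have x1 : x != 0 by rewrite gt_eqF.
  by field; rewrite x1 b0 s0 z0.
have cg t : 0 <= t <= 2 -> {for t, continuous g}.
  move=> t02; have [s1 _ _] := hS t t02.
  apply: real_continuousM.
    apply: (@continuous_comp _ _ _ (fun t : R => 2 * t - 2) (fun x : R => 2 `^ x)).
      by apply: real_continuousB; [apply: real_continuousMl; exact: cvg_id|exact: cvg_cst].
    by apply: powR_continuous_exponent.
  apply: real_continuousM; first exact: stencil_sum_continuous.
  by apply: real_continuousV; [exact: stencil_sum_continuous|rewrite gt_eqF].
have gt0_near : \forall d \near (0 : R)^'+, (0 < d < 2).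
  near=> d; apply/andP; split; first by near: d; exact: nbhs_right_gt.
  by near: d; exact: nbhs_right_lt.
move=> t t02; rewrite /Fbar -/(g t); case: (eqVneq t 0) => [->|t0].
  apply: cvg_lim => //.
  have c0 : g d @[d --> 0^'+] --> g 0 by apply: cvg_at_right_filter; apply: cg; rewrite lexx ler0n.
  apply: cvg_trans c0; apply: near_eq_cvg; move: gt0_near; apply: filterS => d d02.
  by rewrite inner.
case: (eqVneq t 2) => [->|t2].
  apply: cvg_lim => //.
  have c2 : g (2 - d) @[d --> 0^'+] --> g 2.
    apply: cvg_at_right_filter; rewrite -[X in _ --> g X]subr0.
    apply: (@continuous_comp _ _ _ (fun d : R => 2 - d) g).
      by apply: real_continuousB; [exact: cvg_cst|exact: cvg_id].
    by apply: cg; rewrite subr0 lexx ler0n.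
  apply: cvg_trans c2; apply: near_eq_cvg; move: gt0_near; apply: filterS => d d02.
  by rewrite inner//; case/andP: d02 => ? ?; lra.
by apply: inner; move: t02; rewrite !le_eqVlt (eq_sym 0) (negbTE t0) (negbTE t2).
Unshelve. all: end_near. Qed.

Lemma Fbar_uniform (e : R) : 0 < e -> \forall n \near \oo, forall t, 0 <= t <= 2 ->
  `|Fbar phi n bs ell t - 2 `^ (2 * t - 2)| <= e * 2 `^ (2 * t - 2).
Proof.
move=> e0; have H := stencil_sum_ratio sqO C1 u01 v01 J0 e0.
move: Fbar_stencil H; apply: filterS2 => n hF hS t t02; rewrite hF//.
have [_ _] := hS t t02; move: (_ / _) => x hx.
have p0 : 0 <= 2 `^ (2 * t - 2) :> R by exact: powR_ge0.
rewrite -[X in _ - X]mulr1 -mulrBr normrM ger0_norm// mulrC.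
exact: ler_wpM2r.
Qed.

End Fbar.

(** * Fourth derivatives of the covariance near the domain *)

Section finite_uniformity.
Context {R : realType}.

(** Common constants for finitely many statements that weaken as eta decreases
    and C increases. *)
Lemma finite_uniformity (Q : nat -> R -> R -> Prop) (N : nat) :
  (forall k eta C eta' C', Q k eta C -> eta' <= eta -> C <= C' -> Q k eta' C') ->
  (forall k, (k < N)%N -> exists2 eta, 0 < eta & exists2 C, 0 < C & Q k eta C) ->
  exists2 eta, 0 < eta & exists2 C, 0 < C & forall k, (k < N)%N -> Q k eta C.
Proof.
move=> mono; elim: N => [|N ih] h; first by exists 1 => //; exists 1.
have [|e1 e10 [C1 C10 h1]] := ih; first by move=> k kN; apply: h; exact: ltnW.
have [e2 e20 [C2 C20 h2]] := h N (ltnSn N).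
exists (Num.min e1 e2); first by rewrite lt_min e10.
exists (C1 + C2); first exact: addr_gt0.
move=> k; rewrite ltnS leq_eqVlt => /predU1P[->|kN].
  by apply: mono h2 _ _; [rewrite ge_min lexx orbT|rewrite lerDr ltW].
by apply: mono (h1 k kN) _ _; [rewrite ge_min lexx|rewrite lerDl ltW].
Qed.

Lemma half_lt (x y : R) : 0 < x -> y <= x / 2 -> y < x. Proof. lra. Qed.
Lemma half_le (x : R) : 0 <= x -> x / 2 <= x. Proof. lra. Qed.
Lemma half_sum (x y e : R) : 0 <= x -> x < e / 2 -> y <= x / 2 -> x + y < e. Proof. lra. Qed.
Lemma half_diff (x y z : R) : x <= y + z -> z <= x / 2 -> x / 2 <= y. Proof. lra. Qed.

End finite_uniformity.

Section covariance_derivatives.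
Context {R : realType}.
Local Notation sq := (@unit_square R).
Variables (Omega : set 'rV[R]_2) (phi : 'rV[R]_2 -> 'rV[R]_2).
Hypothesis sqO : sq `<=` Omega.
Hypothesis C1 : C1_diffeo Omega phi.
Local Notation Delta := (phi @` sq).
Variables (Kt : 'rV[R]_2 -> R) (nu Cd : R).
Hypothesis nu02 : 0 < nu < 2.

Definition difference_set : set 'rV[R]_2 :=
  [set h | exists x y, [/\ Delta x, Delta y, x <> y & h = x - y]].

Hypothesis smooth : forall a1 a2 : nat, (a1 + a2 = 4)%N ->
  exists U : set 'rV[R]_2, difference_set `<=` U /\ partials_continuous U a1 a2 Kt.
Hypothesis deriv_bound : forall a1 a2 : nat, (a1 + a2 = 4)%N ->
  forall x y, Delta x -> Delta y -> x <> y ->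
    `|partials a1 a2 Kt (x - y)| <= Cd * enorm (x - y) `^ (2 * nu - 4).

Lemma difference_set_compact (e : R) : 0 < e ->
  compact (difference_set `&` [set h | e <= `|h|]).
Proof.
move=> e0.
have -> : difference_set `&` [set h | e <= `|h|] =
    [set phi z.1 - phi z.2 | z in sq `*` sq] `&` [set h | e <= `|h|].
  apply/seteqP; split => h /= [].
    by move=> [x [y [[p sp <-] [q sq' <-] _ ->]]] eh; split => //; exists (p, q).
  move=> [[p q] /= [sp sq'] <-] eh; split => //.
  exists (phi p), (phi q); split; [by exists p|by exists q| |by []] => pq.
  by move: eh; rewrite pq subrr normr0 leNgt e0.
apply: compact_closedI; last first.
  apply: (@closed_comp _ _ (fun h : 'rV[R]_2 => `|h|) [set x | e <= x]); last exact: closed_ge.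
  by move=> h _; exact: norm_continuous.
have [cphi _ _] := C1.
apply: continuous_compact; last by apply: compact_setX; exact: unit_square_compact.
apply: continuous_in_subspaceT => z; rewrite inE => -[s1 s2].
have c1 : {for z, continuous (fun z : 'rV[R]_2 * 'rV[R]_2 => phi z.1)}.
  apply: (@continuous_comp _ _ _ fst phi); first exact: cvg_fst.
  by apply: cphi; rewrite inE; exact: sqO.
have c2 : {for z, continuous (fun z : 'rV[R]_2 * 'rV[R]_2 => phi z.2)}.
  apply: (@continuous_comp _ _ _ snd phi); first exact: cvg_snd.
  by apply: cphi; rewrite inE; exact: sqO.
by have := cvgB c1 c2; exact.
Qed.

(** Two regimes.  Near 0 the difference set contains a punctured ball, because
    the image of the square has interior points, so h + g is itself a
    difference of two points.  Away from 0 the differences form a compact set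
    inside the open set of smoothness, where uniform continuity costs at most
    1; this is the origin of the summand 1. *)
Lemma derivative_neighbourhood_order (a1 a2 : nat) : (a1 + a2 = 4)%N ->
  exists2 eta, 0 < eta & exists2 C, 0 < C & forall h g, difference_set h ->
    `|g| <= eta -> `|g| <= `|h| / 2 ->
    partials_exist [set h + g] a1 a2 Kt /\
    `|partials a1 a2 Kt (h + g)| <= C * (`|h| `^ (2 * nu - 4) + 1).
Proof.
move=> a4; have [U [dU [oU eU cU]]] := smooth a4.
have [x0 [e e0 hball]] := phi_range_ball sqO C1.
have e20 : 0 < e / 2 by rewrite divr_gt0.
have nu4 : 0 <= 4 - 2 * nu by case/andP: nu02 => ? ?; lra.
(* The radius e of the ball is split in half, to leave room for g. *)
pose K := difference_set `&` [set h | e / 2 <= `|h|].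
have cK : compact K by exact: difference_set_compact.
have KU : K `<=` U by move=> h [dh _]; exact: dU.
have [eta1 eta10 hU] := compact_open_margin cK oU KU.
have cf h : K h -> {for h, continuous (partials a1 a2 Kt)}.
  by move=> Kh; apply: cU; rewrite inE; exact: KU.
have [eta2 eta20 hc] := compact_uniform cK cf ltr01.
pose C := `|Cd| * 2 `^ (4 - 2 * nu) + 1.
have two0 : 0 < 2 `^ (4 - 2 * nu) :> R by apply: powR_gt0.
have C0 : 0 < C by rewrite ltr_wpDl// mulr_ge0 ?powR_ge0.
have decay (x y : R) : 0 < x -> x / 2 <= y ->
    `|Cd| * y `^ (2 * nu - 4) <= `|Cd| * 2 `^ (4 - 2 * nu) * x `^ (2 * nu - 4).
  move=> x1 xy; rewrite -mulrA ler_wpM2l//.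
  have -> : 2 `^ (4 - 2 * nu) * x `^ (2 * nu - 4) = (x / 2) `^ (2 * nu - 4).
    rewrite powRM ?ltW// ?invr_gt0// mulrC; congr (_ * _).
    by rewrite -powR_inv1// -powRrM mulN1r opprB.
  have y1 : 0 < y by apply: lt_le_trans xy; rewrite divr_gt0.
  have -> : 2 * nu - 4 = - (4 - 2 * nu) by rewrite opprB.
  rewrite !powRN lef_pV2 ?posrE ?powR_gt0 ?divr_gt0//.
  by apply: ge0_ler_powR; rewrite ?nnegrE ?divr_ge0 ?(ltW x1) ?(ltW y1).
have bd h : difference_set h -> h != 0 /\ `|partials a1 a2 Kt h| <= `|Cd| * enorm h `^ (2 * nu - 4).
  move=> [x [y [Dx Dy xy ->]]]; split; first by rewrite subr_eq0; exact/eqP.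
  apply: le_trans (deriv_bound a4 Dx Dy xy) _.
  by rewrite ler_wpM2r ?powR_ge0// ler_norm.
have fin (h z : 'rV[R]_2) : difference_set z -> h != 0 -> `|h| / 2 <= enorm z ->
    `|partials a1 a2 Kt z| <= `|Cd| * 2 `^ (4 - 2 * nu) * `|h| `^ (2 * nu - 4).
  move=> dz h0 hz; apply: le_trans (bd z dz).2 _; apply: decay => //.
  by rewrite normr_gt0.
have wide (x : R) : x <= `|Cd| * 2 `^ (4 - 2 * nu) -> forall y, 0 <= y ->
    x * y <= C * (y + 1).
  move=> xC y y0; apply: (@le_trans _ _ (C * y)).
    by rewrite ler_wpM2r//; apply: le_trans xC _; rewrite lerDl.
  by rewrite ler_wpM2l ?(ltW C0)// lerDl.
exists (Num.min (eta1 / 2) (eta2 / 2)); first by rewrite lt_min !divr_gt0.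
exists C => // h g dh; rewrite le_min => /andP[g1 g2] gh.
have h0 := (bd h dh).1.
have [hsmall|hlarge] := ltP `|h| (e / 2).
  have hg0 : h + g != 0.
    apply/eqP => hg; have hE : h = - g by apply/eqP; rewrite -addr_eq0 hg.
    have : 0 < `|h| by rewrite normr_gt0.
    by move=> /half_lt /(_ gh); rewrite hE normrN ltxx.
  have hge : `|h + g| < e.
    by apply: le_lt_trans (ler_normD _ _) _; exact: half_sum.
  have dhg : difference_set (h + g).
    exists (x0 + (h + g)), x0; split.
    - exact: hball.
    - by rewrite -[x0]addr0; apply: hball; rewrite normr0.
    - by move/eqP; rewrite -subr_eq0 addrAC subrr add0r (negbTE hg0).
    - by rewrite addrAC subrr add0r.
  split; first by move=> _ ->; apply: eU; exact: dU.
  apply: le_trans (wide _ (lexx _) _ (powR_ge0 _ _)); apply: fin => //.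
  apply: le_trans (norm_le_enorm _).
  by have := ler_normB (h + g) g; rewrite addrK => /half_diff; apply.
have Kh : K h by [].
have near (eta : R) : 0 < eta -> `|g| <= eta / 2 -> ball h eta (h + g).
  move=> eta0 ge; rewrite ballrV opprD addrA subrr sub0r normrN.
  by apply: le_lt_trans ge _; rewrite ltr_pdivrMr// ltr_pMr ?ltr1n.
split; first by move=> _ ->; apply: eU; apply: (hU h) => //; exact: near.
have c1 := hc h _ Kh (near _ eta20 g2).
have c2 := fin h h dh h0 _.
have c3 : `|partials a1 a2 Kt h| <= `|Cd| * 2 `^ (4 - 2 * nu) * `|h| `^ (2 * nu - 4).
  apply: c2; apply: le_trans (norm_le_enorm _).
  exact: half_le.
have -> : partials a1 a2 Kt (h + g) = partials a1 a2 Kt h - (partials a1 a2 Kt h - partials a1 a2 Kt (h + g)).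
  by rewrite opprB addrCA subrr addr0.
apply: le_trans (ler_normB _ _) _.
rewrite mulrDr mulr1; apply: lerD; last first.
  by apply: le_trans (ltW c1) _; rewrite lerDr mulr_ge0 ?powR_ge0.
by apply: le_trans c3 _; rewrite ler_wpM2r ?powR_ge0// lerDl.
Qed.

Lemma derivative_neighbourhood :
  exists2 eta, 0 < eta & exists2 C, 0 < C & forall a1 a2 h g, (a1 + a2 = 4)%N ->
    difference_set h -> `|g| <= eta -> `|g| <= `|h| / 2 ->
    partials_exist [set h + g] a1 a2 Kt /\
    `|partials a1 a2 Kt (h + g)| <= C * (`|h| `^ (2 * nu - 4) + 1).
Proof.
have [k eta C eta' C' Q ee CC h g dh g1 g2|k k5|eta eta0 [C C0 hQ]] :=
  @finite_uniformity R (fun k eta C => forall h g, difference_set h ->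
    `|g| <= eta -> `|g| <= `|h| / 2 ->
    partials_exist [set h + g] k (4 - k) Kt /\
    `|partials k (4 - k) Kt (h + g)| <= C * (`|h| `^ (2 * nu - 4) + 1)) 5.
- have [|q1 q2] := Q h g dh _ g2; first exact: le_trans g1 ee.
  split => //; apply: le_trans q2 _; rewrite ler_wpM2r// addr_ge0// powR_ge0.
- by apply: derivative_neighbourhood_order; rewrite subnKC.
exists eta => //; exists C => // a1 a2 h g a4.
have -> : a2 = (4 - a1)%N by rewrite -a4 addKn.
by apply: hQ; rewrite ltnS -a4 leq_addr.
Qed.

End covariance_derivatives.

(** * Variances of the stencils *)

Section stencil_covariances.
Context {R : realType}.
Local Notation sq := (@unit_square R).
Variables (Omega : set 'rV[R]_2) (phi : 'rV[R]_2 -> 'rV[R]_2) (ell : 'I_2).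
Hypothesis sqO : sq `<=` Omega.
Hypothesis C1 : C1_diffeo Omega phi.

(** Coefficients and recentred sites of the stencil at the site (i, j), with
    the mesh divided out. *)
Definition scoef n th i j := stencil_coef ell (step_u phi (mesh n th) (grid n i j))
  (step_v phi (mesh n th) (grid n i j)) (step_uv phi (mesh n th) (grid n i j)).
Definition spt n th i j := stencil_pt (step_u phi (mesh n th) (grid n i j))
  (step_v phi (mesh n th) (grid n i j)) (step_uv phi (mesh n th) (grid n i j)).

Lemma stencil_bounded_near f th : (0 < th)%N -> continuous_at_limit phi f ->
  exists2 C, 0 < C & \forall n \near \oo, forall i j t, (i <= n)%N -> (j <= n)%N -> 0 <= t <= 2 ->
    `|f t (step_u phi (mesh n th) (grid n i j)) (step_v phi (mesh n th) (grid n i j))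
       (step_uv phi (mesh n th) (grid n i j))| <= C.
Proof.
move=> th0 cf; have [C C0 [eta eta0 h]] := stencil_bounded sqO C1 cf.
exists C => //; have := near_mesh_lt th0 eta0; apply: filterS => n [n0 m0] i j t ni nj t02.
by apply: h => //; exact: grid_unit_square.
Qed.

Lemma site_regular th : (0 < th)%N -> exists2 C, 0 < C &
  \forall n \near \oo, (0 < n)%N /\ forall i j, (i <= n)%N -> (j <= n)%N ->
    [/\ forall k, coef phi n th ell i j k = (mesh n th)^-1 * scoef n th i j k,
      \sum_k scoef n th i j k = 0, \sum_k scoef n th i j k *: spt n th i j k = 0,
      forall k, `|scoef n th i j k| <= C & forall k, `|spt n th i j k| <= C].
Proof.
move=> th0.
have exC k : exists C : R, 0 < C /\
    \forall n \near \oo, forall i j, (i <= n)%N -> (j <= n)%N -> `|scoef n th i j k| <= C.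
  have [C C0 h] := stencil_bounded_near th0 (stencil_coef_at_limit sqO C1 (ell := ell) (k := k)).
  exists C; split => //; move: h; apply: filterS => n h i j ni nj.
  by apply: (h i j 0) => //; rewrite lexx ler0n.
have [Cc hc] := choice exC.
have exP (k : (bool * bool) * 'I_2) : exists C : R, 0 < C /\
    \forall n \near \oo, forall i j, (i <= n)%N -> (j <= n)%N -> `|spt n th i j k.1 0 k.2| <= C.
  have [C C0 h] := stencil_bounded_near th0 (stencil_pt_at_limit (phi := phi) (k := k.1) (j := k.2)).
  exists C; split => //; move: h; apply: filterS => n h i j ni nj.
  by apply: (h i j 0) => //; rewrite lexx ler0n.
have [Cp hp] := choice exP.
have S1 : 0 <= \sum_k Cc k by apply: sumr_ge0 => k _; exact: ltW (hc k).1.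
have S2 : 0 <= \sum_k Cp k by apply: sumr_ge0 => k _; exact: ltW (hp k).1.
have leS (I : finType) (F : I -> R) (k : I) : (forall k, 0 < F k) -> F k <= \sum_k F k.
  by move=> F0; rewrite (bigD1 k)//= lerDl sumr_ge0// => m _; exact: ltW.
exists (\sum_k Cc k + \sum_k Cp k + 1); first by rewrite ltr_wpDl// addr_ge0.
have H1 : \forall n \near \oo, forall k i j, (i <= n)%N -> (j <= n)%N -> `|scoef n th i j k| <= Cc k.
  by apply: filter_forall => k; exact: (hc k).2.
have H2 : \forall n \near \oo, forall k i j, (i <= n)%N -> (j <= n)%N -> `|spt n th i j k.1 0 k.2| <= Cp k.
  by apply: filter_forall => k; exact: (hp k).2.
have H3 := grid_det_neq0 sqO C1 th0.
move: H1 H2 H3; apply: filterS3 => n h1 h2 [n0 h3]; split => // i j ni nj.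
have [d1 d2] := h3 i j ni nj; split.
- by move=> k; rewrite coef_stencil.
- exact: stencil_coef_sum.
- exact: stencil_coef_linear.
- move=> k; apply: le_trans (h1 k i j ni nj) _; apply: le_trans (leS _ Cc k _) _.
    by move=> m; exact: (hc m).1.
  by rewrite -addrA lerDl addr_ge0.
- move=> k; apply: norm_le_coord => [|l]; first by rewrite addr_ge0// addr_ge0.
  apply: le_trans (h2 (k, l) i j ni nj) _; apply: le_trans (leS _ Cp (k, l) _) _.
    by move=> m; exact: (hp m).1.
  by rewrite addrAC lerDr addr_ge0.
Qed.

Variable Kt : 'rV[R]_2 -> R.

Definition nabla_cov n th (x y : nat * nat) : R :=
  \sum_k \sum_l coef phi n th ell x.1 x.2 k * coef phi n th ell y.1 y.2 l *
    Kt (site phi n (x.1 + th * k.1) (x.2 + th * k.2) - site phi n (y.1 + th * l.1) (y.2 + th * l.2)).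

Variables (nu tau bs : R) (beta : nat -> R) (r : 'rV[R]_2 -> 'rV[R]_2 -> R).
Hypothesis nu02 : 0 < nu < 2.
Hypothesis tau0 : 0 < tau.
Hypothesis rO : bigO_diag r (2 * nu + tau).
Hypothesis model : covariance_model Kt nu beta bs r.

Let rpow : 0 < 2 * nu + tau.
Proof. by case/andP: nu02 => ? _; rewrite addr_gt0// mulr_gt0. Qed.

Lemma remainder_diag y : r y y = 0.
Proof.
have [C [delta [d0 h]]] := rO.
have e0 : enorm (y - y) = 0 by apply/eqP; rewrite -sqrf_eq0 enorm_sqr subrr !mxE expr0n addr0.
have := h y y; rewrite e0 powR0 ?gt_eqF// mulr0 => /(_ d0).
by rewrite normr_le0 => /eqP.
Qed.

(** The remainder of the covariance model is of smaller order by the factor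
    mesh^tau. *)
Lemma nabla_variance th : (0 < th)%N -> exists2 C, 0 < C &
  \forall n \near \oo, forall i j, (i <= n)%N -> (j <= n)%N ->
    `|nabla_cov n th (i, j) (i, j) - bs * Gfun_slope nu * mesh n th `^ (2 * nu - 2) *
       stencil_form ell nu (step_u phi (mesh n th) (grid n i j))
         (step_v phi (mesh n th) (grid n i j)) (step_uv phi (mesh n th) (grid n i j))| <=
    C * (mesh n th `^ (2 * nu - 2) * mesh n th `^ tau).
Proof.
move=> th0; have [C C0 hreg] := site_regular th0.
have [Cr [delta [d0 hr]]] := rO.
(* There are 16 pairs of stencil points, at rescaled distance at most 4 C. *)
pose D := 16 * C ^+ 2 * `|Cr| * (4 * C) `^ (2 * nu + tau).
have D0 : 0 <= D by rewrite /D mulr_ge0 ?powR_ge0// mulr_ge0// mulr_ge0 ?sqr_ge0.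
exists (D + 1); first by rewrite ltr_wpDl.
have dC : 0 < delta / (4 * C) by rewrite divr_gt0// mulr_gt0.
have hm := near_mesh_lt th0 dC.
move: hreg hm; apply: filterS2 => n [n0 reg] [_ /andP[m0 md]] i j ni nj.
have [hcoef c0 cpt hC hP] := reg i j ni nj.
set l := mesh n th in m0 md hcoef *.
have -> : nabla_cov n th (i, j) (i, j) = \sum_k \sum_m (l^-1 * scoef n th i j k) *
    (l^-1 * scoef n th i j m) * Kt (l *: (spt n th i j k - spt n th i j m)).
  apply: eq_bigr => k _; apply: eq_bigr => m _; rewrite /= !hcoef.
  have cancel (x y z : 'rV[R]_2) : x + y - (x + z) = y - z by rewrite opprD addrACA subrr add0r.
  by rewrite (site_stencil phi n0 th0 i j k) (site_stencil phi n0 th0 i j m) cancel -scalerBr.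
rewrite (covariance_stencil m0 c0 cpt (site phi n i j) nu02 model remainder_diag).
rewrite addrAC -/(stencil_form ell nu _ _ _) subrr add0r.
set B := (l^-1 * C) * (l^-1 * C) * (`|Cr| * (l * (4 * C)) `^ (2 * nu + tau)).
have B0 : 0 <= B by rewrite /B !mulr_ge0 ?powR_ge0 ?invr_ge0 ?(ltW C0) ?(ltW m0).
have term k m : `|(l^-1 * scoef n th i j k) * (l^-1 * scoef n th i j m) *
    r (site phi n i j + l *: spt n th i j k) (site phi n i j + l *: spt n th i j m)| <= B.
  have hs q : `|l^-1 * scoef n th i j q| <= l^-1 * C.
    by rewrite normrM ger0_norm ?invr_ge0 ?(ltW m0)// ler_wpM2l// invr_ge0 ltW.
  rewrite !normrM -normrM -(normrM (l^-1)); apply: ler_pM => //; first by apply: ler_pM.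
  set x := site phi n i j + _; set y := site phi n i j + _.
  have xy : enorm (x - y) <= l * (4 * C).
    have -> : x - y = l *: (spt n th i j k - spt n th i j m).
      by rewrite /x /y opprD addrACA subrr add0r scalerBr.
    apply: le_trans (enorm_le_norm _) _; rewrite normrZ gtr0_norm// mulrCA ler_wpM2l ?(ltW m0)//.
    have -> : 4 * C = 2 * (C + C) by ring.
    by rewrite ler_wpM2l//; apply: le_trans (ler_normB _ _) _; exact: lerD.
  apply: le_trans (hr x y _) _.
    by apply: le_lt_trans xy _; rewrite -ltr_pdivlMr// mulr_gt0.
  apply: (@le_trans _ _ (`|Cr| * enorm (x - y) `^ (2 * nu + tau))).
    by rewrite ler_wpM2r ?powR_ge0// ler_norm.
  rewrite ler_wpM2l//; apply: ge0_ler_powR => //; rewrite ?nnegrE ?enorm_ge0 ?(ltW rpow)//.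
  by rewrite !mulr_ge0// ltW.
apply: (@le_trans _ _ (\sum_(k : bool * bool) \sum_(m : bool * bool) B)).
  apply: le_trans (ler_norm_sum _ _ _) _; apply: ler_sum => k _.
  apply: le_trans (ler_norm_sum _ _ _) _.
  by rewrite big_mkcond; apply: ler_sum => m _; case: ifP.
have -> : \sum_(k : bool * bool) \sum_(m : bool * bool) B = 16 * B.
  by rewrite !big_bool2; ring.
have -> : 16 * B = D * (l `^ (2 * nu - 2) * l `^ tau).
  rewrite /B /D powRM ?(ltW m0) ?mulr_ge0 ?(ltW C0)//.
  have -> : l `^ (2 * nu - 2) * l `^ tau = l `^ (2 * nu + tau) * (l^-1 * l^-1).
    rewrite -powRD ?(gt_eqF m0) ?implybT// -powR_inv1 ?(ltW m0)//.
    rewrite -!powRD ?(gt_eqF m0) ?implybT//; congr (_ `^ _); ring.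
  ring.
by rewrite ler_wpM2r ?mulr_ge0 ?powR_ge0// lerDl.
Qed.

Lemma nabla_variance_upper th : (0 < th)%N -> exists2 C, 0 < C &
  \forall n \near \oo, forall i j, (i <= n)%N -> (j <= n)%N ->
    `|nabla_cov n th (i, j) (i, j)| <= C * mesh n th `^ (2 * nu - 2).
Proof.
move=> th0; have [C C0 hv] := nabla_variance th0.
have [D D0 hf] := stencil_bounded_near th0 (stencil_form_at_limit sqO C1 (ell := ell)).
exists (`|bs * Gfun_slope nu| * D + C); first by rewrite ltr_wpDl// mulr_ge0// ltW.
have hm := near_mesh_lt th0 (ltr01 : 0 < 1 :> R).
move: hv hf hm; apply: filterS3 => n hv hf [_ /andP[m0 m1]] i j ni nj.
have nu02' : 0 <= nu <= 2 by case/andP: nu02 => ? ?; rewrite !ltW.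
have h1 := hv i j ni nj; have h2 := hf i j nu ni nj nu02'.
move: h1 h2; set V := nabla_cov _ _ _ _; set f := stencil_form _ _ _ _ _; set y := mesh n th `^ (2 * nu - 2).
have y0 : 0 <= y by exact: powR_ge0.
have m1t : mesh n th `^ tau <= 1 :> R.
  have <- : 1 `^ tau = 1 :> R by rewrite powR1.
  apply: ge0_ler_powR; rewrite ?nnegrE ?ler01 ?(ltW tau0) ?(ltW m0) ?(ltW m1)//.
move=> h1 h2; have -> : V = (V - bs * Gfun_slope nu * y * f) + bs * Gfun_slope nu * f * y.
  by rewrite mulrAC subrK.
apply: le_trans (ler_normD _ _) _; rewrite mulrDl addrC; apply: lerD.
  rewrite normrM (ger0_norm y0) ler_wpM2r// normrM ler_wpM2l//.
by apply: le_trans h1 _; rewrite ler_wpM2l ?(ltW C0)// ler_piMr.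
Qed.

Definition variance_sum n th : R :=
  \sum_(1 <= i < (n - th).+1) \sum_(1 <= j < (n - th).+1) nabla_cov n th (i, j) (i, j).

Lemma variance_sum_close th (e : R) : (0 < th)%N -> 0 < e ->
  \forall n \near \oo, [/\ (0 < n)%N, 0 < (mesh n th : R) &
    `|variance_sum n th - bs * Gfun_slope nu * mesh n th `^ (2 * nu - 2) * stencil_sum phi ell th n nu|
      <= e * mesh n th `^ (2 * nu - 2) * n%:R ^+ 2].
Proof.
move=> th0 e0; have [C C0 hv] := nabla_variance th0.
have eta0 : 0 < (e / C) `^ (tau^-1) by rewrite powR_gt0 ?divr_gt0.
have hm := near_mesh_lt th0 eta0.
move: hv hm; apply: filterS2 => n hv [n0 /andP[m0 me]]; split => //.
set y := mesh n th `^ (2 * nu - 2); have y0 : 0 <= y by exact: powR_ge0.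
have me' : C * mesh n th `^ tau <= e.
  rewrite mulrC -ler_pdivlMr//.
  apply: (@le_trans _ _ (((e / C) `^ (tau^-1)) `^ tau)).
    by apply: ge0_ler_powR; rewrite ?nnegrE ?(ltW tau0) ?(ltW m0) ?(ltW eta0) ?(ltW me).
  by rewrite -powRrM mulVf ?gt_eqF// powRr1// divr_ge0 ?ltW.
rewrite /variance_sum /stencil_sum mulr_sumr -sumrB.
under [X in `|X|]eq_bigr do rewrite mulr_sumr -sumrB.
apply: (@le_trans _ _ ((n - th)%:R * ((n - th)%:R * (e * y)))).
  have := @box_sum_bound R (fun i j => nabla_cov n th (i, j) (i, j) - bs * Gfun_slope nu * y *
       stencil_form ell nu (step_u phi (mesh n th) (grid n i j))
         (step_v phi (mesh n th) (grid n i j)) (step_uv phi (mesh n th) (grid n i j)))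
    1 (n - th).+1 1 (n - th).+1 (e * y).
  rewrite subn1 /=; apply => i j /andP[_ i1] /andP[_ j1].
  have ni : (i <= n)%N by apply: leq_trans (leq_subr th n); rewrite -ltnS.
  have nj : (j <= n)%N by apply: leq_trans (leq_subr th n); rewrite -ltnS.
  apply: le_trans (hv i j ni nj) _.
  by rewrite mulrCA mulrC ler_wpM2r.
rewrite [leRHS]mulrC mulrA expr2; apply: ler_wpM2r; first by rewrite mulr_ge0// ltW.
by rewrite -!natrM ler_nat leq_mul ?leq_subr.
Qed.

End stencil_covariances.

(** * Row sums of the covariance matrix *)

Section counting.

Lemma window_count (a b d : nat) : (\sum_(1 <= k < d.+1) (a <= k < b) <= b - a)%N.
Proof.
suff h : (\sum_(1 <= k < d.+1) (a <= k < b) <= minn d.+1 b - a)%N.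
  by apply: leq_trans h _; apply: leq_sub2r; rewrite geq_minr.
elim: d => [|d ih]; first by rewrite big_nil.
rewrite big_nat_recr//=; apply: leq_trans (leq_add ih (leqnn _)) _.
by case: (boolP (a <= d.+1 < b)%N) => h /=; lia.
Qed.

Lemma window_size (x s : nat) : (x + s - (x.+1 - s) <= 2 * s)%N.
Proof. lia. Qed.

Lemma outside_window (x y s : nat) :
  ~~ (x.+1 - s <= y < x + s)%N -> (y + s <= x)%N \/ (x + s <= y)%N.
Proof. lia. Qed.

Lemma inner_box (n th k : nat) : (1 <= k < (n - th).+1)%N -> (k <= n)%N.
Proof. lia. Qed.

End counting.

Section mesh_powers.
Context {R : realType}.

Lemma mesh_powR (n th : nat) (a : R) : (0 < n)%N -> (0 < th)%N ->
  mesh n th `^ a = th%:R `^ a * n%:R `^ (- a).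
Proof.
move=> n0 th0; rewrite /mesh powRM ?invr_ge0 ?ler0n//; congr (_ * _).
by rewrite -powR_inv1 ?ler0n// -powRrM mulN1r.
Qed.

Lemma truncnS_le_double (x : R) : 1 <= x -> (Num.truncn x).+1%:R <= 2 * x.
Proof.
move=> x1; have x0 : 0 <= x by apply: le_trans x1.
have : (Num.truncn x)%:R <= x by rewrite truncn_le.
by rewrite -natr1; lra.
Qed.

Lemma powR_nat_ge1 (n : nat) (a : R) : (0 < n)%N -> 0 <= a -> 1 <= n%:R `^ a.
Proof.
move=> n0 a0; apply: (@le_trans _ _ (1 `^ a)); first by rewrite powR1.
by apply: ge0_ler_powR; rewrite ?nnegrE ?ler01 ?ler0n ?ler1n.
Qed.

Lemma product_box_sum (m : nat) (f g : nat -> R) (V F : R) :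
  \sum_(1 <= i < m.+1) \sum_(1 <= j < m.+1) (f i * g j * V + F) =
  (\sum_(1 <= i < m.+1) f i) * (\sum_(1 <= j < m.+1) g j) * V + m%:R * (m%:R * F).
Proof.
transitivity (\sum_(1 <= i < m.+1) (f i * ((\sum_(1 <= j < m.+1) g j) * V) + m%:R * F)).
  apply: eq_bigr => i _; rewrite big_split /= sumr_const_nat subn1 /= -[F *+ m]mulr_natl.
  by rewrite mulr_suml mulr_sumr; congr (_ + _); apply: eq_bigr => j _; rewrite mulrA.
by rewrite big_split /= sumr_const_nat subn1 /= -mulr_suml -[_ *+ m]mulr_natl mulrA.
Qed.

Lemma cross_terms_le (a b y z : R) : 0 <= a -> 0 <= b -> 0 <= y -> 0 <= z ->
  a * y + b * z <= (a + b) * (y + z).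
Proof.
move=> a0 b0 y0 z0; have := mulr_ge0 a0 z0; have := mulr_ge0 b0 y0.
have -> : (a + b) * (y + z) = a * y + b * z + (b * y + a * z) by ring.
by move=> ? ?; rewrite lerDl addr_ge0.
Qed.

Lemma half_power_ge (K : R) : 0 <= K -> \forall n \near \oo, K <= n%:R `^ 2^-1.
Proof.
move=> K0; near=> n.
have -> : K = (K ^+ 2) `^ 2^-1.
  by rewrite -powR_mulrn// -powRrM mulfV ?powRr1.
apply: ge0_ler_powR; rewrite ?nnegrE ?invr_ge0 ?ler0n ?sqr_ge0//.
near: n; exact: nbhs_infty_ger.
Unshelve. all: end_near. Qed.

Lemma half_power_sqr (n : nat) : n%:R `^ 2^-1 * n%:R `^ 2^-1 = n%:R :> R.
Proof. by rewrite -expr2 -powR_mulrn ?powR_ge0// -powRrM mulVf// powRr1. Qed.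

End mesh_powers.

Section row_sums.
Context {R : realType}.
Local Notation sq := (@unit_square R).
Variables (Omega : set 'rV[R]_2) (phi : 'rV[R]_2 -> 'rV[R]_2) (ell : 'I_2).
Hypothesis sqO : sq `<=` Omega.
Hypothesis C1 : C1_diffeo Omega phi.
Local Notation Delta := (phi @` sq).
Variables (Kt : 'rV[R]_2 -> R) (nu Cd : R).
Hypothesis nu02 : 0 < nu < 2.
Hypothesis smooth : forall a1 a2 : nat, (a1 + a2 = 4)%N ->
  exists U : set 'rV[R]_2, difference_set phi `<=` U /\ partials_continuous U a1 a2 Kt.
Hypothesis deriv_bound : forall a1 a2 : nat, (a1 + a2 = 4)%N ->
  forall x y, Delta x -> Delta y -> x <> y ->
    `|partials a1 a2 Kt (x - y)| <= Cd * enorm (x - y) `^ (2 * nu - 4).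

(** The difference of order four is bounded by mesh^2 times the fourth
    derivatives at a distance of order n^(-1/2) or more, hence by a multiple of
    n^(-2) n^(2 - nu). *)
Lemma far_covariance th : (0 < th)%N -> exists2 C, 0 < C &
  \forall n \near \oo, forall i j i' j', (i <= n)%N -> (j <= n)%N -> (i' <= n)%N -> (j' <= n)%N ->
    (n%:R `^ 2^-1)^-1 <= `|(grid n i j : 'rV[R]_2) - grid n i' j'| ->
    `|nabla_cov phi ell Kt n th (i, j) (i', j')| <= C * n%:R `^ (- nu).
Proof.
move=> th0.
have [C C0 hreg] := site_regular ell sqO C1 th0.
have [L L0 hL] := phi_inverse_lipschitz sqO C1.
have [eta eta0 [B B0 hB]] := derivative_neighbourhood sqO C1 nu02 smooth deriv_bound.
pose K := 16 * (C ^+ 2 * (5 * (B * (L `^ (4 - 2 * nu) + 1)) * (2 * C) ^+ 4)) * th%:R ^+ 2.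
have K0 : 0 < K.
  have p1 : 0 < L `^ (4 - 2 * nu) + 1 by rewrite ltr_wpDl ?powR_ge0.
  have p2 : 0 < (2 * C) ^+ 4 by rewrite exprn_gt0// mulr_gt0.
  have p3 : 0 < C ^+ 2 by rewrite exprn_gt0.
  have p4 : 0 < th%:R ^+ 2 :> R by rewrite exprn_gt0// ltr0n.
  by rewrite /K; apply: mulr_gt0 => //; apply: mulr_gt0 => //; apply: mulr_gt0 => //;
    apply: mulr_gt0 => //; apply: mulr_gt0 => //; apply: mulr_gt0.
exists K => //.
have eC : 0 < eta / (4 * C) by rewrite divr_gt0// mulr_gt0.
have hm := near_mesh_lt th0 eC.
have KK : 0 <= 8 * C * L * th%:R by rewrite !mulr_ge0// ltW.
have hq := half_power_ge KK.
move: hreg hm hq; apply: filterS3 => n [n0 reg] [_ /andP[m0 me]] hq i j i' j' ni nj ni' nj'.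
have nR : 0 < n%:R :> R by rewrite ltr0n.
have q0 : 0 < n%:R `^ 2^-1 :> R by rewrite powR_gt0.
have qq := half_power_sqr (R := R) n.
move=> far.
set l := mesh n th in m0 me reg *.
set q := n%:R `^ 2^-1 in hq q0 qq far.
have [ha c0 cpt hC hP] := reg i j ni nj.
have [ha' c0' cpt' hC' hP'] := reg i' j' ni' nj'.
pose h := site phi n i j - site phi n i' j'.
have hge : (L * q)^-1 <= `|h|.
  rewrite invfM ler_pdivrMl//; apply: le_trans far _.
  by apply: hL; exact: grid_unit_square.
have Lq0 : 0 < L * q by exact: mulr_gt0.
have h0 : 0 < `|h| by apply: lt_le_trans hge; rewrite invr_gt0.
have lE : l = th%:R / (q * q) by rewrite qq.
have mh : 4 * C * l <= `|h| / 2.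
  apply: (@le_trans _ _ ((L * q)^-1 / 2)); last by rewrite ler_wpM2r// invr_ge0.
  rewrite lE -[leRHS]invfM -[leRHS]div1r ler_pdivlMr ?mulr_gt0// mulrA.
  have -> : 4 * C * (th%:R / (q * q)) * (L * q) * 2 = 8 * C * L * th%:R / q.
    by field; rewrite gt_eqF.
  by rewrite ler_pdivrMr// mul1r.
have dh : difference_set phi h.
  exists (site phi n i j), (site phi n i' j'); split => //.
  - by exists (grid n i j) => //; exact: grid_unit_square.
  - by exists (grid n i' j') => //; exact: grid_unit_square.
  - by move=> E; move: h0; rewrite /h E subrr normr0 ltxx.
pose X := B * (`|h| `^ (2 * nu - 4) + 1).
have bound : `|nabla_cov phi ell Kt n th (i, j) (i', j')| <=
    16 * ((l^-1 * C) ^+ 2 * (5 * X * (2 * C * l) ^+ 4)).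
  have -> : nabla_cov phi ell Kt n th (i, j) (i', j') =
     \sum_k \sum_m (l^-1 * scoef phi ell n th i j k) * (l^-1 * scoef phi ell n th i' j' m) *
       Kt (h + (l *: spt phi n th i j k - l *: spt phi n th i' j' m)).
    apply: eq_bigr => k _; apply: eq_bigr => m _; rewrite /= ha ha'.
    rewrite (site_stencil phi n0 th0 i j k) (site_stencil phi n0 th0 i' j' m).
    by congr (_ * Kt _); rewrite /h opprD addrACA.
  have hs n' x y k : `|scoef phi ell n' th x y k| <= C -> `|l^-1 * scoef phi ell n' th x y k| <= l^-1 * C.
    by move=> sC; rewrite normrM ger0_norm ?invr_ge0 ?(ltW m0)// ler_wpM2l// invr_ge0 ltW.
  have -> : 16 = (#|{: bool * bool}| * #|{: bool * bool}|)%:R :> R by rewrite card_prod card_bool.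
  apply: fourth_difference_bound.
  - by rewrite -mulr_sumr c0 mulr0.
  - under eq_bigr do rewrite scalerA mulrAC mulVf ?gt_eqF// mul1r; exact: cpt.
  - by rewrite -mulr_sumr c0' mulr0.
  - under eq_bigr do rewrite scalerA mulrAC mulVf ?gt_eqF// mul1r; exact: cpt'.
  - by move=> k; apply: hs.
  - by move=> k; apply: hs.
  - move=> k m; rewrite -scalerBr normrZ gtr0_norm// mulrC; apply: ler_wpM2r; first exact: ltW.
    apply: le_trans (ler_normB _ _) _.
    have -> : 2 * C = C + C by ring.
    exact: lerD.
  - move=> a1 a2 s t a4 sr tr; rewrite -addrA; apply: hB => //.
      have g : `|s *: delta_mx 0 0 + t *: delta_mx 0 1 : 'rV[R]_2| <= 4 * C * l.
        apply: le_trans (ler_normD _ _) _; rewrite !normrZ.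
        have -> : 4 * C * l = 2 * C * l * 1 + 2 * C * l * 1 by ring.
        by apply: lerD; apply: ler_pM => //; exact: norm_unit_vector.
      apply: le_trans g _.
      by rewrite mulrC -ler_pdivlMr ?mulr_gt0// ltW.
    apply: le_trans (mh).
    apply: le_trans (ler_normD _ _) _; rewrite !normrZ.
    have -> : 4 * C * l = 2 * C * l * 1 + 2 * C * l * 1 by ring.
    by apply: lerD; apply: ler_pM => //; exact: norm_unit_vector.
apply: le_trans bound _.
have nu42 : 0 <= 4 - 2 * nu by case/andP: nu02 => ? ?; lra.
have nu2 : 0 <= 2 - nu by case/andP: nu02 => ? ?; lra.
have E1 : q `^ (4 - 2 * nu) = n%:R `^ (2 - nu).
  by rewrite /q -powRrM; congr (_ `^ _); field.
have n1 : 1 <= n%:R `^ (2 - nu) :> R by exact: powR_nat_ge1.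
have Xle : X <= B * ((L `^ (4 - 2 * nu) + 1) * n%:R `^ (2 - nu)).
  rewrite /X ler_wpM2l ?(ltW B0)// (mulrDl (L `^ (4 - 2 * nu)) 1) mul1r.
  apply: (@lerD _ (`|h| `^ (2 * nu - 4)) _ 1) => //.
  rewrite -E1 -powRM ?(ltW L0) ?(ltW q0)//.
  have -> : 2 * nu - 4 = - (4 - 2 * nu) by rewrite opprB.
  rewrite powRN invf_ple ?posrE ?powR_gt0// -powRN.
  have -> : (L * q) `^ (- (4 - 2 * nu)) = ((L * q)^-1) `^ (4 - 2 * nu).
    by rewrite -[in RHS]powR_inv1 ?(ltW Lq0)// -powRrM mulN1r.
  by apply: ge0_ler_powR; rewrite ?nnegrE ?invr_ge0 ?(ltW Lq0).
apply: (@le_trans _ _ (16 * ((l^-1 * C) ^+ 2 * (5 * (B * ((L `^ (4 - 2 * nu) + 1) * n%:R `^ (2 - nu))) * (2 * C * l) ^+ 4)))).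
  apply: ler_wpM2l => //; apply: ler_wpM2l; first exact: sqr_ge0.
  apply: ler_wpM2r; first by rewrite exprn_ge0// !mulr_ge0// ltW.
  by apply: ler_wpM2l.
have nE : n%:R `^ (2 - nu) = n%:R ^+ 2 * n%:R `^ (- nu) :> R.
  by rewrite -powR_mulrn ?ler0n// -powRD// (gt_eqF nR) implybT.
rewrite nE /K lE qq le_eqVlt; apply/orP; left; apply/eqP.
have thR : th%:R != 0 :> R by rewrite pnatr_eq0 -lt0n.
by field; rewrite thR gt_eqF.
Qed.

Hypothesis tau_model : exists (tau bs : R) (beta : nat -> R) (r : 'rV[R]_2 -> 'rV[R]_2 -> R),
  [/\ 0 < tau, bigO_diag r (2 * nu + tau) & covariance_model Kt nu beta bs r].

(** The threshold distance n^(-1/2) is a compromise: about n sites are closer,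
    with covariances bounded by variances, and at most n^2 are further
    away. *)
Lemma row_sum_bound th : (0 < th)%N ->
  (forall n x y, `|nabla_cov phi ell Kt n th x y| <=
     (nabla_cov phi ell Kt n th x x + nabla_cov phi ell Kt n th y y) / 2) ->
  exists2 A, 0 < A & \forall n \near \oo, forall i j,
    (1 <= i < (n - th).+1)%N -> (1 <= j < (n - th).+1)%N ->
    \sum_(1 <= i' < (n - th).+1) \sum_(1 <= j' < (n - th).+1)
      `|nabla_cov phi ell Kt n th (i, j) (i', j')| <=
    A * (n%:R * mesh n th `^ (2 * nu - 2) + n%:R ^+ 2 * n%:R `^ (- nu)).
Proof.
move=> th0 CS; have [tau [bs [beta [r [tau0 rO model]]]]] := tau_model.
have [Cv Cv0 hv] := nabla_variance_upper ell sqO C1 nu02 tau0 rO model th0.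
have [Cf Cf0 hf] := far_covariance th0.
exists (16 * Cv + Cf); first by rewrite addr_gt0// mulr_gt0.
have hq := half_power_ge (ler01 : 0 <= 1 :> R).
move: hv hf hq; apply: filterS3 => n hv hf hq i j i1 j1.
(* At n = 0 the half power vanishes and the threshold is not reached. *)
have n0 : (0 < n)%N.
  by case: n hq {hv hf i1 j1} => // hq; move: hq; rewrite powR0 ?invr_eq0// ler10.
have nR : 0 < n%:R :> R by rewrite ltr0n.
have q0 : 0 < n%:R `^ 2^-1 :> R by rewrite powR_gt0.
have qq := half_power_sqr (R := R) n.
set q := n%:R `^ 2^-1 in hq q0 qq hf.
(* The integer window, at least n^(1/2) wide. *)
pose s := (Num.truncn q).+1.
have qs : q <= s%:R by apply: ltW; exact: truncnS_gt.
have sq2 : s%:R <= 2 * q.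
  exact: truncnS_le_double.
set V := Cv * mesh n th `^ (2 * nu - 2).
set F := Cf * n%:R `^ (- nu).
have V0 : 0 <= V by rewrite mulr_ge0 ?powR_ge0// ltW.
have F0 : 0 <= F by rewrite mulr_ge0 ?powR_ge0// ltW.
pose w (x y : nat) : R := ((x.+1 - s <= y < x + s)%N)%:R.
have inbox k : (1 <= k < (n - th).+1)%N -> (k <= n)%N by exact: inner_box.
have term i' j' : (1 <= i' < (n - th).+1)%N -> (1 <= j' < (n - th).+1)%N ->
    `|nabla_cov phi ell Kt n th (i, j) (i', j')| <= w i i' * w j j' * V + F.
  move=> i'1 j'1; rewrite /w.
  have near_case : `|nabla_cov phi ell Kt n th (i, j) (i', j')| <= V.
    apply: le_trans (CS n (i, j) (i', j')) _.
    have h1 := le_trans (ler_norm _) (hv i j (inbox _ i1) (inbox _ j1)).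
    have h2 := le_trans (ler_norm _) (hv i' j' (inbox _ i'1) (inbox _ j'1)).
    by rewrite ler_pdivrMr// mulr_natr mulr2n; exact: lerD.
  have far_case (x y : nat) (k : 'I_2) :
      ((grid n i j : 'rV[R]_2) - grid n i' j') 0 k = (x%:R - y%:R) / n%:R ->
      ~~ (x.+1 - s <= y < x + s)%N -> `|nabla_cov phi ell Kt n th (i, j) (i', j')| <= F.
    move=> E xy; apply: (hf i j i' j'); rewrite ?inbox//.
    apply: le_trans (coord_le_norm _ k); rewrite E normrM (ger0_norm (x := n%:R^-1)) ?invr_ge0 ?ler0n//.
    rewrite ler_pdivlMr// -qq mulrA mulVf ?gt_eqF// mul1r; apply: le_trans qs _.
    have [h|h] : (y + s <= x)%N \/ (x + s <= y)%N by exact: outside_window.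
      by apply: le_trans (ler_norm _); rewrite lerBrDr -natrD ler_nat addnC.
    by rewrite distrC; apply: le_trans (ler_norm _); rewrite lerBrDr -natrD ler_nat addnC.
  case: (boolP (i.+1 - s <= i' < i + s)%N) => wi; last first.
    rewrite !mul0r add0r; apply: (far_case i i' 0 _ wi).
    by rewrite !mxE /= -mulrBl.
  case: (boolP (j.+1 - s <= j' < j + s)%N) => wj; last first.
    rewrite mulr0 mul0r add0r; apply: (far_case j j' 1 _ wj).
    by rewrite !mxE /= -mulrBl.
  by rewrite !mul1r; apply: le_trans near_case _; rewrite lerDl.
apply: (@le_trans _ _ (\sum_(1 <= i' < (n - th).+1) \sum_(1 <= j' < (n - th).+1) (w i i' * w j j' * V + F))).
  by apply: ler_sum_nat => i' i'1; apply: ler_sum_nat => j' j'1; exact: term.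
have wsum x : \sum_(1 <= y < (n - th).+1) w x y <= 4 * q.
  rewrite /w -natr_sum; apply: (@le_trans _ _ (2 * s)%:R); last first.
    have -> : 4 * q = 2 * (2 * q) by ring.
    by rewrite natrM ler_wpM2l.
  rewrite ler_nat; apply: leq_trans (window_count _ _ _) _; exact: window_size.
have w0 x : 0 <= \sum_(1 <= y < (n - th).+1) w x y by apply: sumr_ge0 => y _; rewrite ler0n.
have -> : \sum_(1 <= i' < (n - th).+1) \sum_(1 <= j' < (n - th).+1) (w i i' * w j j' * V + F) =
   (\sum_(1 <= i' < (n - th).+1) w i i') * (\sum_(1 <= j' < (n - th).+1) w j j') * V +
   (n - th)%:R * ((n - th)%:R * F).
  exact: product_box_sum.
have P1 : (\sum_(1 <= i' < (n - th).+1) w i i') * (\sum_(1 <= j' < (n - th).+1) w j j') * V <=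
    16 * n%:R * V.
  apply: ler_wpM2r => //; apply: le_trans (ler_pM (w0 i) (w0 j) (wsum i) (wsum j)) _.
  by rewrite -qq le_eqVlt; apply/orP; left; apply/eqP; ring.
have P2 : (n - th)%:R * ((n - th)%:R * F) <= n%:R ^+ 2 * F.
  by rewrite mulrA expr2 ler_wpM2r// -!natrM ler_nat leq_mul ?leq_subr.
apply: le_trans (lerD P1 P2) _; rewrite /V /F.
have y0 : 0 <= n%:R * mesh n th `^ (2 * nu - 2) :> R by rewrite mulr_ge0 ?powR_ge0 ?ler0n.
have z0 : 0 <= n%:R ^+ 2 * n%:R `^ (- nu) :> R by rewrite mulr_ge0 ?powR_ge0 ?exprn_ge0 ?ler0n.
have -> : 16 * n%:R * (Cv * mesh n th `^ (2 * nu - 2)) = 16 * Cv * (n%:R * mesh n th `^ (2 * nu - 2)) by ring.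
have -> : n%:R ^+ 2 * (Cf * n%:R `^ (- nu)) = Cf * (n%:R ^+ 2 * n%:R `^ (- nu)) by ring.
apply: cross_terms_le => //; last exact: ltW.
by rewrite mulr_ge0// ltW.
Qed.

End row_sums.

Lemma negative_half_absurd (R : realFieldType) (z : R) : 0 < - z -> 0 - z <= - (z / 2) -> False.
Proof. lra. Qed.

(** * Asymptotics of the total variance *)

Section variance_asymptotics.
Context {R : realType}.
Local Notation sq := (@unit_square R).
Variables (Omega : set 'rV[R]_2) (phi : 'rV[R]_2 -> 'rV[R]_2) (ell : 'I_2).
Hypothesis sqO : sq `<=` Omega.
Hypothesis C1 : C1_diffeo Omega phi.
Variables (Kt : 'rV[R]_2 -> R) (nu tau bs : R) (beta : nat -> R) (r : 'rV[R]_2 -> 'rV[R]_2 -> R).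
Hypothesis nu02 : 0 < nu < 2.
Hypothesis tau0 : 0 < tau.
Hypothesis rO : bigO_diag r (2 * nu + tau).
Hypothesis model : covariance_model Kt nu beta bs r.
Variables (nu' u v : R).
Hypothesis u01 : 0 <= u <= 1.
Hypothesis v01 : 0 <= v <= 1.
Hypothesis J0 : Jfun phi nu' ell u v != 0.
Hypothesis bs0 : bs != 0.
Hypothesis variance_ge0 : forall n th, 0 <= variance_sum phi ell Kt n th.

Let nu02' : 0 <= nu <= 2. Proof. by case/andP: nu02 => ? ?; rewrite !ltW. Qed.
Local Notation M := (bs * Gfun_slope nu).

Definition normalised_variance n th : R :=
  variance_sum phi ell Kt n th / (mesh n th `^ (2 * nu - 2) * n%:R ^+ 2).

Lemma normalised_variance_limit th (e : R) : (0 < th)%N -> 0 < e ->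
  \forall n \near \oo, [/\ (0 < n)%N, 0 < (mesh n th : R) &
    `|normalised_variance n th - M * (limit_sum phi ell n nu / n%:R ^+ 2)| <= e].
Proof.
move=> th0 e0; have e20 : 0 < e / 2 by rewrite divr_gt0.
have M1 : 0 < `|M| + 1 by rewrite ltr_pwDr.
have eM : 0 < e / 2 / (`|M| + 1) by rewrite divr_gt0.
have h1 := variance_sum_close ell sqO C1 nu02 tau0 rO model th0 e20.
have h2 := stencil_sum_close ell sqO C1 th0 eM.
move: h1 h2; apply: filterS2 => n [n0 m0 h1] h2; split => //.
have nR : 0 < n%:R ^+ 2 :> R by rewrite exprn_gt0// ltr0n.
have y0 : 0 < mesh n th `^ (2 * nu - 2) :> R by rewrite powR_gt0.
move: h1 (h2 nu nu02'); rewrite /normalised_variance.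
move: (variance_sum _ _ _ _ _) (stencil_sum _ _ _ _ _) (limit_sum _ _ _ _) => V S L.
move: (mesh n th `^ _) (n%:R ^+ 2) y0 nR => y N y0 N0 {h2} h1 h2.
have -> : V / (y * N) - M * (L / N) = (V - M * y * S) / (y * N) + M * ((S - L) / N).
  by field; rewrite !gt_eqF.
apply: le_trans (ler_normD _ _) _.
have -> : e = e / 2 + (`|M| + 1) * (e / 2 / (`|M| + 1)).
  by rewrite [_ * (_ / _)]mulrC divfK ?gt_eqF// -splitr.
apply: lerD.
  rewrite normrM normfV (gtr0_norm (mulr_gt0 y0 N0)) ler_pdivrMr ?mulr_gt0//.
  by rewrite mulrA.
rewrite normrM; apply: ler_pM => //; first by rewrite lerDl.
by rewrite normrM normfV (gtr0_norm N0) ler_pdivrMr.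
Qed.

Lemma limit_sum_normalised_lower : exists2 c, 0 < c &
  \forall n \near \oo, c <= limit_sum phi ell n nu / n%:R ^+ 2.
Proof.
have [c c0 hc] := limit_sum_lower sqO C1 u01 v01 J0.
exists c => //; have n0 : \forall n \near \oo, (0 < n)%N by exact: nbhs_infty_gt.
move: hc n0; apply: filterS2 => n hc n0.
by rewrite ler_pdivlMr ?exprn_gt0 ?ltr0n//; exact: hc.
Qed.

(** A variance is nonnegative, so the leading coefficient cannot have the wrong
    sign; this determines the sign of the coefficient of the principal
    irregular term. *)
Lemma model_slope_gt0 : 0 < M.
Proof.
have M0 : M != 0 by rewrite mulf_neq0 ?Gfun_slope_neq0.
rewrite lt_def M0 /= leNgt; apply/negP => Mneg.
have [c c0 hc] := limit_sum_normalised_lower.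
have e0 : 0 < - M * c / 2 by rewrite divr_gt0// mulr_gt0// oppr_gt0.
have h := normalised_variance_limit (isT : (0 < 1)%N) e0.
have [n [hn [n0 m0 hv]]] : exists n, c <= limit_sum phi ell n nu / n%:R ^+ 2 /\
    [/\ (0 < n)%N, 0 < (mesh n 1 : R) &
    `|normalised_variance n 1 - M * (limit_sum phi ell n nu / n%:R ^+ 2)| <= - M * c / 2].
  by have [n hn] := filter_ex (filterI hc h); exists n.
have V0 : 0 <= normalised_variance n 1.
  by rewrite divr_ge0 ?mulr_ge0 ?powR_ge0 ?sqr_ge0.
move: hv hn V0; move: (normalised_variance n 1) (_ / _) => V s hv hn V0.
have : M * s <= M * c by rewrite ler_nM2l.
have := mulr_gt0 (_ : 0 < - M) c0; rewrite oppr_gt0 => /(_ Mneg).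
move: hv V0; rewrite ler_norml !mulNr; move: (M * s) (M * c) => x z /andP[_ h1] h2 h3 h4.
have h5 := le_trans (lerB h2 h4) h1.
exact: negative_half_absurd h3 h5.
Qed.

Lemma variance_sum_lower th : (0 < th)%N -> exists2 c, 0 < c &
  \forall n \near \oo, c <= normalised_variance n th.
Proof.
move=> th0; have [c c0 hc] := limit_sum_normalised_lower.
have e0 : 0 < M * c / 2 by rewrite divr_gt0// mulr_gt0// model_slope_gt0.
exists (M * c / 2) => //.
have h := normalised_variance_limit th0 e0.
move: hc h; apply: filterS2 => n hc [_ _].
have : M * c <= M * (limit_sum phi ell n nu / n%:R ^+ 2) by rewrite ler_pM2l ?model_slope_gt0.
move: (normalised_variance n th) (M * c) (M * (_ / _)) => x y z h1.
by rewrite ler_norml => /andP[h2 _]; lra.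
Qed.

Lemma variance_sum_ratio (e : R) : 0 < e -> \forall n \near \oo,
  [/\ 0 < variance_sum phi ell Kt n 1, 0 < variance_sum phi ell Kt n 2 &
  `|variance_sum phi ell Kt n 2 / variance_sum phi ell Kt n 1 - 2 `^ (2 * nu - 2)| <=
     e * 2 `^ (2 * nu - 2)].
Proof.
move=> e0.
have [c1 c10 h1] := variance_sum_lower (isT : (0 < 1)%N).
have [c2 c20 h2] := variance_sum_lower (isT : (0 < 2)%N).
have e'0 : 0 < e * c1 / 2 by rewrite divr_gt0// mulr_gt0.
have k1 := normalised_variance_limit (isT : (0 < 1)%N) e'0.
have k2 := normalised_variance_limit (isT : (0 < 2)%N) e'0.
have h12 : \forall n \near \oo, c1 <= normalised_variance n 1 /\ c2 <= normalised_variance n 2.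
  by move: h1 h2; apply: filterS2.
move: h12 k1 k2; apply: filterS3 => n [{}h1 {}h2] [n0 m1 k1] [_ m2 k2].
have nR : 0 < n%:R ^+ 2 :> R by rewrite exprn_gt0// ltr0n.
have y1 : 0 < mesh n 1 `^ (2 * nu - 2) :> R by rewrite powR_gt0.
have y2 : mesh n 2 `^ (2 * nu - 2) = 2 `^ (2 * nu - 2) * mesh n 1 `^ (2 * nu - 2) :> R.
  by rewrite -powRM ?(ltW m1)//; congr (_ `^ _); rewrite /mesh mul1r.
have z0 : 0 < 2 `^ (2 * nu - 2) :> R by apply: powR_gt0.
have E1 : variance_sum phi ell Kt n 1 = normalised_variance n 1 * (mesh n 1 `^ (2 * nu - 2) * n%:R ^+ 2).
  by rewrite divfK// mulf_neq0// gt_eqF.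
have E2 : variance_sum phi ell Kt n 2 =
    normalised_variance n 2 * (2 `^ (2 * nu - 2) * mesh n 1 `^ (2 * nu - 2) * n%:R ^+ 2).
  by rewrite /normalised_variance y2 divfK// gt_eqF//; apply: mulr_gt0 => //; exact: mulr_gt0.
rewrite E1 E2; move: k1 k2 h1 h2.
move: (normalised_variance n 1) (normalised_variance n 2) (M * _) => a1 a2 s k1 k2 h1 h2.
move: (mesh n 1 `^ _) (n%:R ^+ 2) (2 `^ _) y1 nR z0 => y N z y0 N0 z0.
have a10 : 0 < a1 by exact: lt_le_trans h1.
have a20 : 0 < a2 by exact: lt_le_trans h2.
split; [by rewrite !mulr_gt0|by rewrite !mulr_gt0|].
have -> : a2 * (z * y * N) / (a1 * (y * N)) - z = (a2 - a1) / a1 * z.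
  by field; rewrite !gt_eqF.
rewrite normrM (gtr0_norm z0) ler_wpM2r ?(ltW z0)//.
rewrite normrM normfV (gtr0_norm a10) ler_pdivrMr//.
apply: (@le_trans _ _ (e * c1)); last by rewrite ler_wpM2l ?(ltW e0).
have -> : a2 - a1 = (a2 - s) - (a1 - s) by rewrite opprB addrA subrK.
apply: le_trans (ler_normB _ _) _; apply: le_trans (lerD k2 k1) _.
by rewrite -splitr.
Qed.

End variance_asymptotics.

(** * Almost sure behaviour of the quadratic variations *)

Section gaussian_stencils.
Context {d : measure_display} {T : measurableType d} {R : realType} (P : probability T R).
Variable X : 'rV[R]_2 -> {RV P >-> R}.
Variables (phi : 'rV[R]_2 -> 'rV[R]_2) (ell : 'I_2) (Kt : 'rV[R]_2 -> R) (mu : R).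
Hypothesis gX : gaussian_field X.
Hypothesis EX : forall x, ('E_P[X x] = mu%:E)%E.
Hypothesis covX : forall x y, covariance P (X x) (X y) = (Kt (x - y))%:E.

Definition nabla_field n th (x : nat * nat) (w : T) : R :=
  nabla phi n th ell (fun i j => X (site phi n i j) w) x.1 x.2.

Lemma coef_sum n th i j : \sum_k coef phi n th ell i j k = 0.
Proof. by rewrite big_bool2 /=; ring. Qed.

Lemma nabla_field_increment n th x : increment_space X (nabla_field n th x).
Proof.
have inc y z : increment_space X (fun w => X y w - X z w) by exact: increment_spaceB.
have := increment_spaceD (- alphac phi n th x.1 x.2 ell 1)
  (increment_spaceD (- alphac phi n th x.1 x.2 ell 0)
  (increment_spaceD (betac phi n th x.1 x.2 ell 1)
  (increment_spaceD (betac phi n th x.1 x.2 ell 0) (increment_space0 X)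
    (inc (site phi n (x.1 + th) x.2) (site phi n (x.1 + th) (x.2 + th))))
    (inc (site phi n x.1 (x.2 + th)) (site phi n (x.1 + th) (x.2 + th))))
    (inc (site phi n (x.1 + th) x.2) (site phi n x.1 x.2)))
    (inc (site phi n x.1 (x.2 + th)) (site phi n x.1 x.2)).
congr increment_space; apply/funext => w; rewrite /nabla_field /nabla; ring.
Qed.

Lemma nabla_field_moments n th x : finite_moments P (nabla_field n th x).
Proof. by have [+ _] := increment_space_gaussian gX EX => /(_ _ (nabla_field_increment n th x)) []. Qed.

Lemma nabla_field_product n th x y :
  \int[P]_w (nabla_field n th x w * nabla_field n th y w) = nabla_cov phi ell Kt n th x y.
Proof.
have fX := gaussian_field_moments gX.
transitivity (\int[P]_w (\sum_k \sum_l coef phi n th ell x.1 x.2 k * coef phi n th ell y.1 y.2 l *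
    (X (site phi n (x.1 + th * k.1) (x.2 + th * k.2)) w *
     X (site phi n (y.1 + th * l.1) (y.2 + th * l.2)) w))).
  apply: eq_Rintegral => w _; rewrite /nabla_field !nabla_coef mulr_suml.
  apply: eq_bigr => k _; rewrite mulr_sumr; apply: eq_bigr => l _; ring.
rewrite Rintegral_sum_moments; last by move=> k; solve_moments.
transitivity (\sum_k \sum_l coef phi n th ell x.1 x.2 k * coef phi n th ell y.1 y.2 l *
    (Kt (site phi n (x.1 + th * k.1) (x.2 + th * k.2) -
     site phi n (y.1 + th * l.1) (y.2 + th * l.2)) + mu ^+ 2)).
  apply: eq_bigr => k _; rewrite Rintegral_sum_moments; last by move=> l; solve_moments.
  apply: eq_bigr => l _; rewrite RintegralMl_moments; last by solve_moments.
  by rewrite (gaussian_field_product gX EX covX).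
transitivity (nabla_cov phi ell Kt n th x y +
   (\sum_k coef phi n th ell x.1 x.2 k) * (\sum_l coef phi n th ell y.1 y.2 l * mu ^+ 2)).
  rewrite mulr_suml -big_split; apply: eq_bigr => k _ /=.
  by rewrite mulr_sumr -big_split; apply: eq_bigr => l _ /=; ring.
by rewrite coef_sum mul0r addr0.
Qed.

Lemma nabla_cov_ge0 n th x : 0 <= nabla_cov phi ell Kt n th x x.
Proof.
have fx := nabla_field_moments n th x.
rewrite -nabla_field_product -(Rintegral_cst_prob P 0).
apply: le_Rintegral_moments; [by solve_moments|by solve_moments|].
by move=> w; rewrite -expr2 sqr_ge0.
Qed.

(** From the nonnegativity of the second moment of the sum and of the
    difference. *)
Lemma nabla_cov_le n th x y : `|nabla_cov phi ell Kt n th x y| <=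
  (nabla_cov phi ell Kt n th x x + nabla_cov phi ell Kt n th y y) / 2.
Proof.
have fx := nabla_field_moments n th x; have fy := nabla_field_moments n th y.
have h (s : R) : s ^+ 2 = 1 -> s * nabla_cov phi ell Kt n th x y <=
    (nabla_cov phi ell Kt n th x x + nabla_cov phi ell Kt n th y y) / 2.
  move=> s1; rewrite -!nabla_field_product.
  rewrite -RintegralD_moments; [|by solve_moments|by solve_moments].
  rewrite [leRHS]mulrC -!RintegralMl_moments; [|by solve_moments|by solve_moments].
  apply: le_Rintegral_moments; [by solve_moments|by solve_moments|].
  move=> w; move: (nabla_field n th x w) (nabla_field n th y w) => a b.
  have := sqr_ge0 (a - s * b); rewrite sqrrB exprMn s1 mul1r !expr2; lra.
by rewrite ler_norml lerNl -mulN1r -[X in _ && (X <= _)]mul1r !h ?sqrrN ?expr1n.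
Qed.

Lemma variance_sum_ge0 n th : 0 <= variance_sum phi ell Kt n th.
Proof. by apply: sumr_ge0 => i _; apply: sumr_ge0 => j _; exact: nabla_cov_ge0. Qed.

Definition box n th : seq (nat * nat) :=
  [seq (i, j) | i <- index_iota 1 (n - th).+1, j <- index_iota 1 (n - th).+1].
Definition in_box n th (x : nat * nat) : bool :=
  (1 <= x.1 < (n - th).+1)%N && (1 <= x.2 < (n - th).+1)%N.

Lemma big_box n th (F : nat * nat -> R) :
  \sum_(x <- box n th) F x = \sum_(1 <= i < (n - th).+1) \sum_(1 <= j < (n - th).+1) F (i, j).
Proof. by rewrite big_allpairs. Qed.

(** Extended by 0 outside the box, so that a bound on row sums can be required
    for every index. *)
Definition box_field n th x : T -> R := if in_box n th x then nabla_field n th x else fun=> 0.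

Lemma box_field_increment n th x : increment_space X (box_field n th x).
Proof.
by rewrite /box_field; case: ifP => _; [exact: nabla_field_increment|exact: increment_space0].
Qed.

Lemma box_fieldE n th i j : (1 <= i < (n - th).+1)%N -> (1 <= j < (n - th).+1)%N ->
  box_field n th (i, j) = nabla_field n th (i, j).
Proof. by move=> i1 j1; rewrite /box_field /in_box i1 j1. Qed.

Lemma Vbar_sum_sqr n th w :
  Vbar phi n th ell (fun i j => X (site phi n i j) w) = sum_sqr (box n th) (box_field n th) w.
Proof.
rewrite /sum_sqr big_box; apply: eq_big_nat => i i1; apply: eq_big_nat => j j1.
by rewrite box_fieldE.
Qed.

Lemma Rintegral_Vbar n th :
  \int[P]_w sum_sqr (box n th) (box_field n th) w = variance_sum phi ell Kt n th.
Proof.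
have fY x : finite_moments P (box_field n th x).
  by rewrite /box_field; case: ifP => _; [exact: nabla_field_moments|exact: finite_moments_cst].
rewrite /sum_sqr Rintegral_sum_moments; last by move=> x; solve_moments.
rewrite big_box; apply: eq_big_nat => i i1; apply: eq_big_nat => j j1.
rewrite box_fieldE// -nabla_field_product.
by apply: eq_Rintegral => w _; rewrite expr2.
Qed.

Local Notation sq := (@unit_square R).
Local Notation Delta := (phi @` sq).
Variables (Omega : set 'rV[R]_2) (nu tau bs Cd : R) (beta : nat -> R)
  (r : 'rV[R]_2 -> 'rV[R]_2 -> R) (nu' u v : R).
Hypothesis sqO : sq `<=` Omega.
Hypothesis C1 : C1_diffeo Omega phi.
Hypothesis nu02 : 0 < nu < 2.
Hypothesis tau0 : 0 < tau.
Hypothesis rO : bigO_diag r (2 * nu + tau).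
Hypothesis model : covariance_model Kt nu beta bs r.
Hypothesis bs0 : bs != 0.
Hypothesis u01 : 0 <= u <= 1.
Hypothesis v01 : 0 <= v <= 1.
Hypothesis J0 : Jfun phi nu' ell u v != 0.
Hypothesis smooth : forall a1 a2 : nat, (a1 + a2 = 4)%N ->
  exists U : set 'rV[R]_2, difference_set phi `<=` U /\ partials_continuous U a1 a2 Kt.
Hypothesis deriv_bound : forall a1 a2 : nat, (a1 + a2 = 4)%N ->
  forall x y, Delta x -> Delta y -> x <> y ->
    `|partials a1 a2 Kt (x - y)| <= Cd * enorm (x - y) `^ (2 * nu - 4).

(** Compared with a total variance of order n^(4 - 2 nu), the near part of a
    row sum is smaller by a factor n and the far part by a factor n^(2 - nu);
    the exponent [kap] is the smaller of the two. *)
Lemma Vbar_ae_cvg th : (0 < th)%N ->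
  {ae P, forall w, Vbar phi n th ell (fun i j => X (site phi n i j) w) /
    variance_sum phi ell Kt n th @[n --> \oo] --> (1 : R)}.
Proof.
move=> th0.
have tau_model : exists (tau bs : R) (beta : nat -> R) (r : 'rV[R]_2 -> 'rV[R]_2 -> R),
  [/\ 0 < tau, bigO_diag r (2 * nu + tau) & covariance_model Kt nu beta bs r].
  by exists tau, bs, beta, r.
have CS := fun n x y => nabla_cov_le n th x y.
have [A A0 hrow] := row_sum_bound sqO C1 nu02 smooth deriv_bound tau_model th0 CS.
have [c c0 hvar] := variance_sum_lower sqO C1 nu02 tau0 rO model u01 v01 J0 bs0
  (fun n th => variance_sum_ge0 n th) th0.
pose kap := Num.min 1 (2 - nu).
have nu2 : 0 < 2 - nu by case/andP: nu02 => _; rewrite subr_gt0.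
have kap0 : 0 < kap by rewrite lt_min ltr01.
pose B := A * (1 + th%:R `^ (2 - 2 * nu)) / c.
have B0 : 0 < B by rewrite divr_gt0// mulr_gt0// ltr_pwDl// powR_ge0.
pose rho n := A * (n%:R * mesh n th `^ (2 * nu - 2) + n%:R ^+ 2 * n%:R `^ (- nu)).
have n0 : \forall n \near \oo, (0 < n)%N by exact: nbhs_infty_gt.
have := @quadratic_variation_ae_cvg _ _ _ P _ (increment_space_gaussian gX EX) _
  (fun n => box n th) (fun n => box_field n th) rho B kap
  (fun n x => box_field_increment n th x) B0 kap0.
move=> main; have {main} : {ae P, forall t, sum_sqr (box n th) (box_field n th) t /
    \int[P]_t' sum_sqr (box n th) (box_field n th) t' @[n --> \oo] --> (1 : R)}.
  apply: main; move: hrow hvar n0; apply: filterS3 => n hrow hvar n0.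
  have nR : 0 < n%:R :> R by rewrite ltr0n.
  have m0 : 0 < (mesh n th : R) by exact: mesh_gt0.
  have y0 : 0 < mesh n th `^ (2 * nu - 2) :> R by rewrite powR_gt0.
  have D0 : 0 < mesh n th `^ (2 * nu - 2) * n%:R ^+ 2 :> R.
    by apply: mulr_gt0 => //; rewrite exprn_gt0.
  have rho0 : 0 <= rho n.
    rewrite /rho; apply: mulr_ge0; first exact: ltW.
    by apply: addr_ge0; apply: mulr_ge0; rewrite ?powR_ge0 ?exprn_ge0 ?ler0n.
  rewrite Rintegral_Vbar.
  have VE : c * (mesh n th `^ (2 * nu - 2) * n%:R ^+ 2) <= variance_sum phi ell Kt n th.
    by move: hvar; rewrite /normalised_variance ler_pdivlMr.
  split => //.
  - by apply: lt_le_trans VE; exact: mulr_gt0.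
  - move=> [i j]; rewrite big_box; have [ib|ib] := boolP (in_box n th (i, j)); last first.
      rewrite big1 => [|i' _]; first exact: rho0.
      rewrite big1 => // j' _; rewrite {1}/box_field (negbTE ib).
      by under eq_Rintegral do rewrite mul0r; rewrite Rintegral_cst_prob normr0.
    case/andP: (ib) => /= i1 j1; apply: le_trans (hrow i j i1 j1).
    rewrite le_eqVlt; apply/orP; left; apply/eqP.
    apply: eq_big_nat => i' i'1; apply: eq_big_nat => j' j'1.
    by rewrite !box_fieldE// nabla_field_product.
  have dec (e : R) : kap <= e -> n%:R `^ (- e) <= n%:R `^ (- kap) :> R.
    by move=> ke; apply: ler_powR; rewrite ?ler1n// lerN2.
  have d1 := dec 1 (_ : kap <= 1); have d2 := dec (2 - nu) (_ : kap <= 2 - nu).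
  rewrite /rho; apply: (@le_trans _ _ (B * n%:R `^ (- kap) * (c * (mesh n th `^ (2 * nu - 2) * n%:R ^+ 2)))); last first.
    by rewrite ler_wpM2l// mulr_ge0 ?powR_ge0// ltW.
  have -> : B * n%:R `^ (- kap) * (c * (mesh n th `^ (2 * nu - 2) * n%:R ^+ 2)) =
     A * (n%:R `^ (- kap) * (mesh n th `^ (2 * nu - 2) * n%:R ^+ 2) +
          n%:R `^ (- kap) * (th%:R `^ (2 - 2 * nu) * (mesh n th `^ (2 * nu - 2) * n%:R ^+ 2))).
    by rewrite /B; field; rewrite gt_eqF.
  rewrite ler_wpM2l ?(ltW A0)//; apply: lerD.
    have -> : n%:R * mesh n th `^ (2 * nu - 2) = n%:R `^ (- 1) * (mesh n th `^ (2 * nu - 2) * n%:R ^+ 2) :> R.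
      by rewrite powR_inv1 ?ler0n//; field; rewrite gt_eqF.
    by apply: ler_wpM2r; [exact: ltW|apply: d1; rewrite ge_min lexx].
  have -> : n%:R ^+ 2 * n%:R `^ (- nu) =
      n%:R `^ (- (2 - nu)) * (th%:R `^ (2 - 2 * nu) * (mesh n th `^ (2 * nu - 2) * n%:R ^+ 2)) :> R.
    have thR : th%:R == 0 :> R = false by rewrite pnatr_eq0 gtn_eqF.
    have -> : n%:R `^ (- nu) = (th%:R `^ (2 - 2 * nu) * th%:R `^ (2 * nu - 2)) *
        (n%:R `^ (- (2 - nu)) * n%:R `^ (- (2 * nu - 2))) :> R.
      rewrite -powRD ?thR ?implybT// -powRD ?(gt_eqF nR) ?implybT//.
      have -> : 2 - 2 * nu + (2 * nu - 2) = 0 by ring.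
      have -> : - (2 - nu) - (2 * nu - 2) = - nu by ring.
      by rewrite powRr0 mul1r.
    by rewrite mesh_powR//; ring.
  apply: ler_wpM2r; last by apply: d2; rewrite ge_min lexx orbT.
  by apply: mulr_ge0; [exact: powR_ge0|exact: ltW].
apply: filterS => w; apply: cvg_trans; apply: near_eq_cvg; apply: nearW => n.
by rewrite Rintegral_Vbar Vbar_sum_sqr.
Qed.

End gaussian_stencils.

(** * Consistency of the minimum contrast estimator *)

Section consistency.
Context {R : realType}.
Local Notation growth t := (2 `^ (2 * t - 2) : R).

Lemma relative_cvg1 (f g : nat -> R) :
  (forall e, 0 < e -> \forall n \near \oo, 0 < g n /\ `|f n - g n| <= e * g n) ->
  f n / g n @[n --> \oo] --> (1 : R).
Proof.
move=> h; apply/cvgrPdist_le => e e0; move: (h e e0); apply: filterS => n [g0 fg].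
have -> : 1 - f n / g n = - ((f n - g n) / g n) by field; rewrite gt_eqF.
by rewrite normrN normrM normfV (gtr0_norm g0) ler_pdivrMr.
Qed.

(** The logarithm of the quotient is 2 ln 2 (hat n - nu). *)
Lemma growth_cvg_inv (hat : nat -> R) (nu : R) :
  growth (hat n) / growth nu @[n --> \oo] --> (1 : R) -> hat n @[n --> \oo] --> nu.
Proof.
have g0 t : 0 < growth t by apply: powR_gt0.
have ln2 : ln 2 != 0 :> R by rewrite gt_eqF// ln_gt0// ltr1n.
have lnE n : ln (growth (hat n) / growth nu) = 2 * ln 2 * (hat n - nu).
  rewrite lnM ?posrE ?invr_gt0 ?g0// lnV ?posrE ?g0// !ln_powR; ring.
move=> h.
have : ln (growth (hat n) / growth nu) @[n --> \oo] --> ln (1 : R).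
  by apply: (cvg_comp _ _ h); exact: continuous_ln.
rewrite ln1 => h0.
have : (2 * ln 2)^-1 * ln (growth (hat n) / growth nu) + nu @[n --> \oo] --> (2 * ln 2)^-1 * 0 + nu.
  by apply: cvgD; [apply: cvgM => //; exact: cvg_cst|exact: cvg_cst].
rewrite mulr0 add0r; apply: cvg_trans; apply: near_eq_cvg; apply: nearW => n.
by rewrite lnE mulKf ?mulf_neq0// subrK.
Qed.

(** Minimality transfers the convergence of the contrast from [nu] to the
    estimates.  Division by the convergent factors then leaves the quotient of
    growth factors at the estimate and at [nu]. *)
Lemma minimum_contrast_consistency (V1 V2 D1 D2 : nat -> R) (F : nat -> R -> R)
    (hat : nat -> R) (nu : R) : 0 <= nu <= 2 ->
  V1 n / D1 n @[n --> \oo] --> (1 : R) -> V2 n / D2 n @[n --> \oo] --> (1 : R) ->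
  (forall e, 0 < e -> \forall n \near \oo,
     [/\ 0 < D1 n, 0 < D2 n & `|D2 n / D1 n - growth nu| <= e * growth nu]) ->
  (forall e, 0 < e -> \forall n \near \oo, forall t, 0 <= t <= 2 ->
     `|F n t - growth t| <= e * growth t) ->
  (\forall n \near \oo, 0 <= hat n <= 2 /\
     (V1 n * F n (hat n) / V2 n - 1) ^+ 2 <= (V1 n * F n nu / V2 n - 1) ^+ 2) ->
  hat n @[n --> \oo] --> nu.
Proof.
move=> nu02 h1 h2 hD hF hmin.
have g0 t : 0 < growth t by apply: powR_gt0.
have Dratio : D2 n / D1 n / growth nu @[n --> \oo] --> (1 : R).
  apply: relative_cvg1 => e e0; move: (hD e e0); apply: filterS => n [_ _ ?].
  by split.
have Fnu : F n nu / growth nu @[n --> \oo] --> (1 : R).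
  apply: relative_cvg1 => e e0; move: (hF e e0); apply: filterS => n h.
  by split => //; exact: h.
have Fhat : F n (hat n) / growth (hat n) @[n --> \oo] --> (1 : R).
  apply: relative_cvg1 => e e0; move: (hF e e0) hmin; apply: filterS2 => n h [h02 _].
  by split => //; exact: h.
have inv1 : 1^-1 = 1 :> R by exact: invr1.
have cV (f : nat -> R) : f n @[n --> \oo] --> (1 : R) -> (f n)^-1 @[n --> \oo] --> (1 : R).
  by move=> hf; rewrite -[X in _ --> X]inv1; apply: cvgV => //; exact: oner_neq0.
have cM (f g : nat -> R) : f n @[n --> \oo] --> (1 : R) -> g n @[n --> \oo] --> (1 : R) ->
    f n * g n @[n --> \oo] --> (1 : R).
  by move=> hf hg; rewrite -[X in _ --> X]mulr1; exact: cvgM.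
pose a n := V1 n / D1 n * ((V2 n / D2 n)^-1 * (D2 n / D1 n / growth nu)^-1).
have ca : a n @[n --> \oo] --> (1 : R) by exact: (cM _ _ h1 (cM _ _ (cV _ h2) (cV _ Dratio))).
(* A vanishing V2 is harmless here, both sides being 0 by convention. *)
have aE : \forall n \near \oo, forall x, V1 n * x / V2 n = a n * (x / growth nu).
  move: (hD 1 ltr01); apply: filterS => n [D10 D20 _] x; rewrite /a !invfM !invrK.
  have := g0 nu; move: (growth nu) (V2 n)^-1 D10 D20 => g W; move: (D1 n) (D2 n) => y z y0 z0 g0'.
  by field; rewrite !gt_eqF.
have cnu : a n * (F n nu / growth nu) @[n --> \oo] --> (1 : R) by exact: cM.
have chat : a n * (F n (hat n) / growth nu) @[n --> \oo] --> (1 : R).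
  apply/cvgrPdist_le => e e0; move/cvgrPdist_le: cnu => /(_ e e0).
  move: aE hmin; apply: filterS3 => n aE [_ hm] hc.
  rewrite !aE in hm; rewrite distrC; apply: le_trans _ hc; rewrite [leRHS]distrC.
  by rewrite -ler_sqr ?nnegrE// !real_normK ?num_real.
apply: growth_cvg_inv.
have := cM _ _ chat (cM _ _ (cV _ ca) (cV _ Fhat)).
apply: cvg_trans; apply: near_eq_cvg.
have a0 : \forall n \near \oo, a n != 0.
  move/cvgrPdist_lt: ca => /(_ 1 ltr01); apply: filterS => n h.
  by apply: contraTneq h => ->; rewrite subr0 normr1 ltxx.
have F0 : \forall n \near \oo, F n (hat n) / growth (hat n) != 0.
  move/cvgrPdist_lt: Fhat => /(_ 1 ltr01); apply: filterS => n h.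
  by apply: contraTneq h => ->; rewrite subr0 normr1 ltxx.
move: a0 F0; apply: filterS2 => n a0 F0.
have gn := g0 nu; have gh := g0 (hat n).
have Fn0 : F n (hat n) != 0 by apply: contraNneq F0 => ->; rewrite mul0r.
move: (a n) (F n (hat n)) (growth nu) (growth (hat n)) a0 Fn0 gn gh => x y z w x0 y0 z0 w0.
by field; rewrite x0 y0 !gt_eqF.
Qed.

End consistency.

Theorem theorem6 (R : realType) (d : measure_display) (T : measurableType d)
    (P : probability T R) (X : 'rV[R]_2 -> {RV P >-> R})
    (mu nu tau : R) (Kt : 'rV[R]_2 -> R) (b : nat -> R) (betastar : R -> R)
    (r : 'rV[R]_2 -> 'rV[R]_2 -> R) (ell : 'I_2)
    (Omega : set 'rV[R]_2) (phi : 'rV[R]_2 -> 'rV[R]_2)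
    (nuhat : nat -> T -> R) :
  let Delta := phi @` unit_square in
  0 < nu < 2 ->
  gaussian_field X ->
  stationary_isotropic X mu Kt ->
  (forall t, 0 < t < 2 -> betastar t != 0) ->
  0 < tau ->
  bigO_diag r (2 * nu + tau) ->
  covariance_model Kt nu b (betastar nu) r ->
  open Omega ->
  unit_square `<=` Omega ->
  C2_diffeo Omega phi ->
  (exists u v : R, [/\ 0 <= u <= 1, 0 <= v <= 1 & Jfun phi nu ell u v != 0]) ->
  (forall a1 a2 : nat, (a1 + a2 = 4)%N ->
     exists U : set 'rV[R]_2,
       [set h | exists x y, [/\ Delta x, Delta y, x <> y & h = x - y]] `<=` U /\
       partials_continuous U a1 a2 Kt) ->
  (exists C : R, forall a1 a2 : nat, (a1 + a2 = 4)%N ->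
     forall x y, Delta x -> Delta y -> x <> y ->
       `|partials a1 a2 Kt (x - y)| <= C * enorm (x - y) `^ (2 * nu - 4)) ->
  (\forall n \near \oo, {ae P, forall w,
     is_estimate phi n betastar ell (fun i1 i2 => X (site phi n i1 i2) w)
       (nuhat n w)}) ->
  {ae P, forall w, nuhat n w @[n --> \oo] --> nu}.
Proof.
move=> Delta nu02 gX [EX covX _] bs0 tau0 rO model _ sqO [C1 _] [u [v [u01 v01 J0]]] smooth [Cd deriv] hest.
have nu02' : 0 <= nu <= 2 by case/andP: nu02 => ? ?; rewrite !ltW.
have bsnu := bs0 nu nu02.
have V := Vbar_ae_cvg gX EX covX sqO C1 nu02 tau0 rO model bsnu u01 v01 J0 smooth deriv.
have D := variance_sum_ratio sqO C1 nu02 tau0 rO model u01 v01 J0 bsnu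
  (fun n th => variance_sum_ge0 phi ell gX EX covX n th).
have F := Fbar_uniform sqO C1 bs0 u01 v01 J0.
have [N _ hN] := hest.
have est : {ae P, forall w n, (N <= n)%N ->
    is_estimate phi n betastar ell (fun i1 i2 => X (site phi n i1 i2) w) (nuhat n w)}.
  apply: ae_foralln => n; have [Nn|nN] := leqP N n.
    by move: (hN n Nn); apply: filterS => w h _.
  by apply: aeW.
move: (V 1%N isT) (V 2%N isT) est; apply: filterS3 => w V1 V2 hmin.
apply: (minimum_contrast_consistency nu02' V1 V2 D F).
exists N => // n Nn; have [h02 hm] := hmin n Nn; split => //.
by have := hm nu nu02'; rewrite /criterion.
Qed.
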